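(* Let $N\ge 1$ be an integer, let $\gamma\ge 0$ satisfy $\gamma\geq \sqrt{2N}-1$, and let $\alpha\in\mathbb{R}$ satisfy $$\alpha^{2}+(\gamma+1)\alpha+\frac{N}{2}\leq 0 .$$ Let $f\in C^{1}(\mathbb{R}^{+}\times\mathbb{R})$, $f=f(t,u)$, satisfy $f\geq 0$ and $f_{u}\leq 0$ (where $f_u=\partial f/\partial u$). Let $u_0\in C(\mathbb{R}^{N})\cap L^{\infty}(\mathbb{R}^{N})$, $u_0\ge 0$, satisfy $$|\nabla (u_0^{1+\frac{\alpha}{2}})|\leq M \quad\text{in } \mathbb{R}^N$$ for some positive constant $M$. Let $u$ be the viscosity solution (that is, the weak solution constructed by the vanishing viscosity method) of the Cauchy problem $$u_{t}=u\Delta u-\gamma|\nabla u|^{2}+f(t,u)\ \text{ in } \Omega=\mathbb{R}^{N}\times\mathbb{R}^{+},\qquad u(x,0)=u_{0}(x),\ x\in\mathbb{R}^N .$$ Then $$|\nabla(u^{1+\frac{\alpha}{2}})|\leq M\quad\text{in }\overline{\Omega}.$$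
   Context: Here $\mathbb{R}^{+}=(0,\infty)$, $\Omega=\mathbb{R}^{N}\times\mathbb{R}^{+}$ with points $(x,t)$, and $\nabla$, $\Delta$ denote the gradient and Laplacian in the spatial variable $x$. Weak solution: a function $u\in L^{\infty}(\Omega)\cap L^{2}_{\mathrm{loc}}([0,+\infty);H^{1}_{\mathrm{loc}}(\mathbb{R}^{N}))$ is a weak solution of the Cauchy problem $u_{t}=u\Delta u-\gamma|\nabla u|^{2}+f(t,u)$ in $\Omega$, $u(\cdot,0)=u_0$, if (i) $u(x,t)\ge 0$ a.e. in $\Omega$; and (ii) for every $\psi\in C^{1,1}(\overline{\Omega})$ with compact support in $\overline{\Omega}$, $$\int_{\mathbb{R}^{N}}u_{0}\,\psi(x,0)\,dx+\iint_{\Omega}\big(u\psi_{t}-u\nabla u\cdot\nabla\psi-(1+\gamma)|\nabla u|^{2}\psi+f(t,u)\psi\big)\,dx\,dt=0 .$$ Viscosity solution (in the sense of vanishing viscosity): for $\epsilon>0$ let $u^{\epsilon}$ be the nonnegative classical solution, in $C^{2,1}(\Omega)\cap C(\overline{\Omega})\cap L^{\infty}(\Omega)$, of the regularized problem $$u_t=u\Delta u-\gamma|\nabla u|^{2}+f(t,u)+\epsilon\Delta u\ \text{ in }\Omega,\qquad u(x,0)=u_{0}(x),\ x\in\mathbb{R}^{N}.$$ A weak solution $u$ of the Cauchy problem obtained as the limit $u=\lim_{\epsilon\to 0}u^{\epsilon}$ (pointwise a.e. in $\Omega$) is called a viscosity solution. *)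

(* Defs.v *)
From HB Require Import structures.
From mathcomp Require Import all_boot all_order all_algebra.
From mathcomp Require Import all_classical all_reals all_analysis.
Import numFieldNormedType.Exports.

Set Implicit Arguments.
Unset Strict Implicit.
Unset Printing Implicit Defensive.

Import Order.TTheory GRing.Theory Num.Theory.

Local Open Scope classical_set_scope.
Local Open Scope ring_scope.

(* The sigma-algebra on row vectors generated by the coordinates, as the library
   does for tuples; over R it is the Borel sigma-algebra. *)
Section measurable_row.
Context {d} {T : sigmaRingType d}.
Variable n : nat.

Let coord : 'I_n -> 'rV[T]_n -> T := fun i x => x ord0 i.

Let row_set0 : g_sigma_preimage coord set0.
Proof. exact: sigma_algebra0. Qed.

Let row_setC A : g_sigma_preimage coord A -> g_sigma_preimage coord (~` A).
Proof. exact: sigma_algebraC. Qed.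

Let row_bigcup (F : (set 'rV[T]_n)^nat) :
  (forall i, g_sigma_preimage coord (F i)) ->
  g_sigma_preimage coord (\bigcup_i (F i)).
Proof. exact: sigma_algebra_bigcup. Qed.

HB.instance Definition _ := @isMeasurable.Build (measure_tuple_display d)
  'rV[T]_n (g_sigma_preimage coord) row_set0 row_setC row_bigcup.

End measurable_row.

Section measurable_row_lemmas.
Context {d} {T : measurableType d}.

Lemma measurable_coord n (i : 'I_n) :
  measurable_fun [set: 'rV[T]_n] (fun x : 'rV[T]_n => x ord0 i).
Proof.
move=> _ Y mY; rewrite setTI; apply: sub_sigma_algebra => /=.
rewrite -bigcup_seq/=; exists i => /=; first by rewrite mem_index_enum.
by exists Y => //; rewrite setTI.
Qed.

Lemma measurable_fun_row d1 (T1 : measurableType d1) n (f : T1 -> 'rV[T]_n) :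
  (forall i, measurable_fun [set: T1] (fun x => f x ord0 i)) ->
  measurable_fun [set: T1] f.
Proof.
move=> mf _ A; rewrite setTI => mA.
pose S := [set B : set 'rV[T]_n | measurable (f @^-1` B)].
suff : S A by [].
move: mA; apply: smallest_sub; last first.
  rewrite -bigcup_seq => B [i _ [C mC <-]]; rewrite /S /= setTI -comp_preimage.
  by rewrite -[X in measurable X]setTI; exact: (mf i).
split=> [|B mB|F mF]; rewrite /S /=.
- by rewrite preimage_set0.
- by rewrite setTD -preimage_setC; exact: measurableC.
- by rewrite preimage_bigcup; apply: bigcup_measurable => k _; exact: mF.
Qed.

End measurable_row_lemmas.

Lemma prod_sigma_finite d1 d2 (T1 : measurableType d1) (T2 : measurableType d2)
    (R : realType) (m1 : {sigma_finite_measure set T1 -> \bar R})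
    (m2 : {sigma_finite_measure set T2 -> \bar R}) :
  sigma_finite setT (m1 \x m2)%E.
Proof.
have /sigma_finiteP[F [TF ndF Foo]] := sigma_finiteT m1.
have /sigma_finiteP[G [TG ndG Goo]] := sigma_finiteT m2.
exists (fun n => F n `*` G n).
  rewrite -setXTT TF TG predeqE => -[x y]; split.
    move=> [/= [n _ Fnx] [k _ Gky]]; exists (maxn n k) => //; split.
    - by move: x Fnx; exact/subsetPset/ndF/leq_maxl.
    - by move: y Gky; exact/subsetPset/ndG/leq_maxr.
  by move=> [n _ []/= ? ?]; split; exists n.
move=> k; have [? ?] := Foo k; have [? ?] := Goo k.
split; first exact: measurableX.
by rewrite product_measure1E// lte_mul_pinfty// ge0_fin_numE.
Qed.

Section row_lebesgue_measure.
Context {R : realType}.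

Definition row_cons n (p : measurableTypeR R * 'rV[R]_n) : 'rV[R]_n.+1 :=
  \row_i (if unlift ord0 i is Some j then p.2 ord0 j else p.1).

Lemma measurable_row_cons n : measurable_fun setT (@row_cons n).
Proof.
apply: measurable_fun_row => i; case: (unliftP ord0 i) => [j|] ->.
- rewrite (_ : (fun _ => _) = (fun x : 'rV[R]_n => x ord0 j) \o snd).
    by apply: measurableT_comp => //; exact: measurable_coord.
  by apply/funext => p /=; rewrite mxE liftK.
- rewrite (_ : (fun _ => _) = fst); first exact: measurable_fst.
  by apply/funext => p /=; rewrite mxE unlift_none.
Qed.

HB.instance Definition _ n :=
  @isMeasurableFun.Build _ _ _ _ (@row_cons n) (@measurable_row_cons n).

Definition row_uncons n (v : 'rV[R]_n.+1) : measurableTypeR R * 'rV[R]_n :=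
  (v ord0 ord0, \row_j v ord0 (lift ord0 j)).

Lemma measurable_row_uncons n : measurable_fun setT (@row_uncons n).
Proof.
apply/measurable_fun_pair; first exact: measurable_coord.
apply: measurable_fun_row => i; rewrite (_ : (fun _ => _) =
  (fun v : 'rV[R]_n.+1 => v ord0 (lift ord0 i))); first exact: measurable_coord.
by apply/funext => v; rewrite mxE.
Qed.

Lemma row_consK n : cancel (@row_cons n) (@row_uncons n).
Proof.
move=> [a v]; rewrite /row_uncons /row_cons mxE unlift_none; congr pair.
by apply/rowP => j; rewrite !mxE liftK.
Qed.

Lemma row_unconsK n : cancel (@row_uncons n) (@row_cons n).
Proof.
move=> v; apply/rowP => i; rewrite mxE.
by case: (unliftP ord0 i) => [j|] -> //=; rewrite mxE.
Qed.

Section step.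
Variables (n : nat) (m : {sigma_finite_measure set 'rV[R]_n -> \bar R}).

Definition row_lebesgue_step : set 'rV[R]_n.+1 -> \bar R :=
  pushforward (@lebesgue_measure R \x m)%E (@row_cons n).

Let row_lebesgue_step0 : row_lebesgue_step set0 = 0%E.
Proof. exact: measure0. Qed.

Let row_lebesgue_step_ge0 A : (0 <= row_lebesgue_step A)%E.
Proof. exact: measure_ge0. Qed.

Let row_lebesgue_step_sigma_additive : semi_sigma_additive row_lebesgue_step.
Proof. exact: measure_semi_sigma_additive. Qed.

HB.instance Definition _ := isMeasure.Build _ _ _ row_lebesgue_step
  row_lebesgue_step0 row_lebesgue_step_ge0 row_lebesgue_step_sigma_additive.

Let row_lebesgue_step_sigma_finite : sigma_finite setT row_lebesgue_step.
Proof.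
have [F FT Ffin] := prod_sigma_finite (@lebesgue_measure R) m.
exists (fun k => @row_uncons n @^-1` F k).
  by rewrite -preimage_bigcup -FT preimage_setT.
move=> k; have [mF Foo] := Ffin k; split.
  by rewrite -[X in measurable X]setTI; exact: measurable_row_uncons.
rewrite /row_lebesgue_step /pushforward -comp_preimage.
by rewrite (_ : _ \o _ = id)//; apply/funext => p /=; rewrite row_consK.
Qed.

HB.instance Definition _ := Measure_isSigmaFinite.Build _ _ _ row_lebesgue_step
  row_lebesgue_step_sigma_finite.

End step.

(* Lebesgue measure on R^n, as an iterated product of one-dimensional Lebesgue
   measures; on the one-point space R^0 it is the Dirac mass. *)
Fixpoint row_lebesgue n : {sigma_finite_measure set 'rV[R]_n -> \bar R} :=
  if n is n'.+1 then row_lebesgue_step (row_lebesgue n')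
  else dirac (0 : 'rV[R]_0).

End row_lebesgue_measure.

Section calculus.
Context {R : realType}.

Definition dotv n (v w : 'rV[R]_n) : R := \sum_i v ord0 i * w ord0 i.

(* The library norm on 'rV[R]_n is the sup norm. *)
Definition enorm n (v : 'rV[R]_n) : R := Num.sqrt (dotv v v).

(* On a finite-dimensional V and an open set D this is membership in C^1(D). *)
Definition C1_on (V : normedModType R) (D : set V) (h : V -> R) : Prop :=
  forall v x, D x -> derivable h x v /\ {for x, continuous ('D_v h)}.

Definition C1c (V : normedModType R) (h : V -> R) : Prop :=
  C1_on setT h /\ exists2 K : set V, compact K & forall x, ~ K x -> h x = 0.

Definition locally_integrable_row n (g : 'rV[R]_n -> R) : Prop :=
  forall K, compact K -> (row_lebesgue n).-integrable K (EFin \o g).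

Definition weak_grad n (g : 'rV[R]_n -> R) (G : 'rV[R]_n -> 'rV[R]_n) : Prop :=
  [/\ locally_integrable_row g,
      forall i, locally_integrable_row (fun x => G x ord0 i) &
      forall (i : 'I_n) (phi : 'rV[R]_n -> R), C1c phi ->
        \int[row_lebesgue n]_x (g x * 'D_(delta_mx ord0 i) phi x) =
        - \int[row_lebesgue n]_x (G x ord0 i * phi x)].

(* |grad (g^p)| <= M.  The library sets 0 `^ p = 0 for p < 0, where the power is
   undefined, hence the positivity clause. *)
Definition grad_pow_le n (g : 'rV[R]_n -> R) (p M : R) : Prop :=
  (p < 0 -> {ae row_lebesgue n, forall x, 0 < g x}) /\
  exists2 G, weak_grad (fun x => g x `^ p) G &
    {ae row_lebesgue n, forall x, enorm (G x) <= M}.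

End calculus.

Section equation.
Context {R : realType} {N : nat}.
Implicit Types (z : 'rV[R]_N * R) (w psi : 'rV[R]_N * R -> R).

Definition Omega : set ('rV[R]_N * R) := [set z | 0 < z.2].
Definition cOmega : set ('rV[R]_N * R) := [set z | 0 <= z.2].

Definition dt_dir : 'rV[R]_N * R := (0, 1).
Definition dx_dir (i : 'I_N) : 'rV[R]_N * R := (delta_mx ord0 i, 0).

Definition dt w z : R := 'D_dt_dir w z.
Definition dx (i : 'I_N) w z : R := 'D_(dx_dir i) w z.
Definition grad w z : 'rV[R]_N := \row_i dx i w z.
Definition laplacian w z : R := \sum_i dx i (dx i w) z.

(* Twice continuously differentiable in x and once in t. *)
Definition C21_Omega w : Prop := forall z, Omega z ->
  [/\ {for z, continuous w},
      derivable w z dt_dir /\ {for z, continuous (dt w)},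
      forall i, derivable w z (dx_dir i) /\ {for z, continuous (dx i w)} &
      forall i j, derivable (dx i w) z (dx_dir j) /\
                  {for z, continuous (dx j (dx i w))}].

Definition classical_solution (gamma : R) (f : R -> R -> R)
    (u0 : 'rV[R]_N -> R) (eps : R) w : Prop :=
  [/\ C21_Omega w,
      {within cOmega, continuous w},
      exists K, forall z, Omega z -> `|w z| <= K,
      forall z, Omega z -> dt w z =
        w z * laplacian w z - gamma * dotv (grad w z) (grad w z)
        + f z.2 (w z) + eps * laplacian w z &
      forall x, w (x, 0) = u0 x].

Let mu := (row_lebesgue N \x @lebesgue_measure R)%E.

Definition Linfty_Omega w : Prop :=
  measurable_fun Omega w /\
  exists K, {ae mu, forall z, Omega z -> `|w z| <= K}.

(* w is in L^2_loc([0, +oo); H^1_loc(R^N)), with spatial gradient G. *)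
Definition L2loc_H1loc w (G : 'rV[R]_N * R -> 'rV[R]_N) : Prop :=
  [/\ measurable_fun Omega w,
      forall i, measurable_fun Omega (fun z => G z ord0 i),
      {ae @lebesgue_measure R, forall t, 0 < t ->
        weak_grad (fun x => w (x, t)) (fun x => G (x, t))} &
      forall (K : set 'rV[R]_N) (T : R), compact K ->
        mu.-integrable [set z | K z.1 /\ 0 < z.2 < T]
          (EFin \o (fun z => w z ^+ 2 + dotv (G z) (G z)))].

(* Elements of C^1 of the closed half-space are taken as restrictions of C^1
   functions on the whole space; the compactness of the support only concerns
   the closed half-space. *)
Definition test_function psi : Prop :=
  C1_on setT psi /\
  exists2 K : set ('rV[R]_N * R), compact K &
    forall z, cOmega z -> ~ K z -> psi z = 0.

(* The integrability clause makes the last term of the identity meaningful: f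
   may be singular at t = 0.  The other terms are integrable because of the
   first two clauses. *)
Definition weak_solution (gamma : R) (f : R -> R -> R) (u0 : 'rV[R]_N -> R)
    (u : 'rV[R]_N * R -> R) : Prop :=
  exists G : 'rV[R]_N * R -> 'rV[R]_N,
  [/\ Linfty_Omega u,
      L2loc_H1loc u G,
      {ae mu, forall z, Omega z -> 0 <= u z} &
      forall psi, test_function psi ->
        mu.-integrable Omega (EFin \o (fun z => f z.2 (u z) * psi z)) /\
        \int[row_lebesgue N]_x (u0 x * psi (x, 0)) +
        \int[mu]_(z in Omega)
          (u z * dt psi z - u z * dotv (G z) (grad psi z)
           - (1 + gamma) * dotv (G z) (G z) * psi z + f z.2 (u z) * psi z) = 0].

(* In Omega, u is only determined almost everywhere; on t = 0 it is given by the
   initial datum. *)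
Definition viscosity_solution (gamma : R) (f : R -> R -> R)
    (u0 : 'rV[R]_N -> R) (u : 'rV[R]_N * R -> R) : Prop :=
  [/\ weak_solution gamma f u0 u,
      forall x, u (x, 0) = u0 x &
      exists ueps : R -> 'rV[R]_N * R -> R,
        (forall eps, 0 < eps ->
          classical_solution gamma f u0 eps (ueps eps) /\
          forall z, cOmega z -> 0 <= ueps eps z) /\
        {ae mu, forall z, Omega z -> (ueps eps z @[eps --> 0^'+] --> u z)}].

End equation.

(* Main.v *)
Require Import Defs.

(* Put p = 1 + alpha / 2 < 1.  The regularized solution w = u^eps + eps is
   positive, and v = w^p solves, with q = 1/p,
     v_t = v^q Delta v + c v^(q-1) |grad v|^2 + source,   c = (1 - p - gamma) / p,
   whose source is nonincreasing in v.  Instead of differentiating the equation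
   (Bernstein), compare v at two points: if v(x,t) - v(y,t) first reaches
   M sqrt (|x-y|^2 + d e^(Ct)) plus a small quadratic barrier, then second order
   variations of (x, y) along each axis with speeds v(x)^(q/2) and v(y)^(q/2)
   bound the difference of the diffusion terms by
     M (N - 1) (v(x)^(q/2) - v(y)^(q/2))^2 / |x-y|,
   and the difference of the gradient terms, M^2 c (v(x)^(q-1) - v(y)^(q-1)),
   compensates it because of Cauchy-Schwarz and
     N - 1 + 4 (p-1)^2 + 4 gamma (p-1) <= 0,
   a consequence of the hypothesis on alpha.  So v(.,t) stays M-Lipschitz if it
   is at t = 0, uniformly in eps.
     At t = 0, testing the weak gradient of u0^p against bumps shows that u0^p is
   M-Lipschitz at its continuity points, and (u0 + eps)^p inherits this bound.
   When p < 0, a quadratic supersolution bounds v locally, hence keeps u positive.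
   Finally, a limit of M-Lipschitz C^1 functions has a weak gradient bounded by M:
   some averages of the gradients converge almost everywhere (Mazur). *)
From HB Require Import structures.
From mathcomp Require Import all_boot all_order all_algebra.
From mathcomp Require Import all_classical all_reals all_analysis.
From mathcomp Require Import ring lra measurable_realfun.
Import numFieldNormedType.Exports.
Import Order.TTheory GRing.Theory Num.Theory.

Set Implicit Arguments.
Unset Strict Implicit.
Unset Printing Implicit Defensive.

Local Open Scope classical_set_scope.
Local Open Scope ring_scope.

(** * Derivatives along lines *)

Section line_derivatives.
Context {R : realType}.

(** Differentiating the equation would ask for third space derivatives of u^eps, while the
    regularized solutions are only C^{2,1}; comparing two points uses no more than that. Adding eps
    to u^eps absorbs the viscosity: u^eps + eps is exactly the diffusion coefficient, so w solves
    the original equation with source f(t, w - eps), and w >= eps. On the resulting positive bounded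
    range all powers are Lipschitz. Their constants may degenerate as eps tends to 0, but they enter
    only the growth rates of the barrier and disappear when d and the quadratic barrier are sent to
    0; this is why M itself is preserved. The factor is N - 1 and not N because the N axes
    contribute N / psi with psi close to |x - y|, and the radial part of the Hessian of the distance
    takes 1 / psi back. The number d prevents the distance from being singular at x = y; the errors
    it creates are proportional to d and are paid for by its growth e^(Ct). *)

Lemma is_derive_lineP (V W : normedModType R) (f : V -> W) (x v : V) (s : R) d :
  is_derive s 1 (fun h : R => f (x + h *: v)) d <-> is_derive (x + s *: v) v f d.
Proof.
have E : (fun h : R => h^-1 *: (((fun h : R => f (x + h *: v)) \o shift s)
      (h *: (1 : R)) - f (x + s *: v))) =
    (fun h => h^-1 *: ((f \o shift (x + s *: v)) (h *: v) - f (x + s *: v))).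
  apply/funext => h /=; congr (_ *: (f _ - _)).
  by rewrite [h *: 1]mulr1 scalerDl addrCA.
by split=> -[df <-]; (split; [move: df|]); rewrite /derivable /derive /= E.
Qed.

Lemma is_derive_line (V W : normedModType R) (f : V -> W) (x v : V) (s : R) d :
  is_derive (x + s *: v) v f d -> is_derive s 1 (fun h : R => f (x + h *: v)) d.
Proof. by move/is_derive_lineP. Qed.

Lemma is_derive_line0 (V W : normedModType R) (f : V -> W) (x v : V) d :
  is_derive x v f d <-> is_derive (0 : R) 1 (fun h : R => f (x + h *: v)) d.
Proof. by rewrite is_derive_lineP scale0r addr0. Qed.

Lemma is_derive_scaled_line (V : normedModType R) (f : V -> R) (x v : V)
    (c s d : R) :
  is_derive (x + (s * c) *: v) v f d ->
  is_derive s 1 (fun h : R => f (x + (h * c) *: v)) (c * d).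
Proof.
move=> /is_derive_line dl.
have := @is_derive1_comp _ (fun h => f (x + h *: v)) (fun h : R => h * c) s d c dl.
rewrite mulrC; apply.
rewrite (_ : (fun h : R => h * c) = c *: id); last first.
  by apply/funext => h; rewrite mulrC.
by apply: is_derive_eq; rewrite [_ *: _]mulr1.
Qed.

Lemma is_derive_comp1 (V : normedModType R) (g : R -> R) (f : V -> R) (x v : V)
    (d e : R) :
  is_derive x v f d -> is_derive (f x) 1 g e ->
  is_derive x v (g \o f) (e * d).
Proof.
move=> /is_derive_line0 df dg; apply/is_derive_line0.
by apply: (@is_derive1_comp _ g (fun h => f (x + h *: v))); rewrite scale0r addr0.
Qed.

(** [g1] is differentiated at 0 only, so no Taylor expansion is used: if [g2] were positive, [g1]
    would be positive just to the right of 0, and the mean value theorem would push [g] above its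
    maximum. *)
Lemma second_derivative_test (g g1 : R -> R) (g2 : R) :
  (forall s : R, is_derive s 1 g (g1 s)) -> is_derive (0 : R) 1 g1 g2 ->
  (forall s, g s <= g 0) -> g1 0 = 0 /\ g2 <= 0.
Proof.
move=> dg [dg1 dg1E] gmax.
have g10 : g1 0 = 0.
  have dm : is_derive (0 : R) 1 g 0.
    apply: (@derive1_at_max _ g (- 1) 1) => //.
    - by rewrite in_itv/=; lra.
  by have [_ D0] := dm; have [_ D1] := dg 0; rewrite -D1.
split=> //; rewrite leNgt; apply/negP => g2_gt0.
have cv : h^-1 * g1 h @[h --> (0:R)^'+] --> g2.
  rewrite -dg1E; apply: cvg_dnbhs_at_right.
  rewrite (_ : (fun h => h^-1 * g1 h) =
    (fun h : R => h^-1 *: ((g1 \o shift 0) (h *: 1) - g1 0))); last first.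
    by apply/funext => h /=; rewrite g10 subr0 addr0 [h *: 1]mulr1.
  exact: dg1.
have : \forall h \near (0 : R)^'+, 0 < h^-1 * g1 h by exact: (cvgr_gt _ cv).
rewrite near_withinE => /nbhs_ballP[e /= e0 he].
have [c] : exists2 c, c \in `]0, e / 2[ & g (e / 2) - g 0 = g1 c * (e / 2 - 0).
  apply: MVT => //; first by rewrite divr_gt0.
  apply: derivable_within_continuous => s _; by have [] := dg s.
rewrite in_itv/= => /andP[c0 ce] ge.
have := he c; rewrite /ball/= sub0r normrN gtr0_norm// => /(_ _ c0).
have ce' : c < e by lra.
move=> /(_ ce'); rewrite pmulr_rgt0 ?invr_gt0// => g1c.
have := gmax (e / 2); rewrite -subr_le0 ge subr0 leNgt mulr_gt0// ?divr_gt0//.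
Qed.

(** At a first contact only earlier times can be compared, which leaves a one-sided limit and a sign
    instead of a vanishing derivative. *)
Lemma left_max_derive_ge0 (g : R -> R) (t d : R) : 0 < t ->
  is_derive t 1 g d -> (forall s, 0 <= s < t -> g s <= g t) -> 0 <= d.
Proof.
move=> t0 [dg <-] gmax.
have cv : h^-1 *: ((g \o shift t) (h *: 1) - g t) @[h --> (0:R)^'-] --> 'D_1 g t.
  exact: cvg_dnbhs_at_left.
rewrite leNgt; apply/negP => d0.
have : \forall h \near (0 : R)^'-, h^-1 *: ((g \o shift t) (h *: 1) - g t) < 0.
  exact: (cvgr_lt _ cv).
rewrite near_withinE => /nbhs_ballP[e /= e0 he].
(* Small enough for the sign of the quotient, and for [t + h] to stay nonnegative. *)
pose h := - (Num.min e t / 2).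
have m0 : 0 < Num.min e t by rewrite lt_min e0.
have h0 : h < 0 by rewrite /h oppr_lt0 divr_gt0.
have [me mt] : Num.min e t <= e /\ Num.min e t <= t by rewrite !ge_min !lexx orbT.
have hh : h = - (Num.min e t / 2) by [].
have := he h; rewrite /ball/= sub0r normrN ltr0_norm// [h *: 1]mulr1.
have -> : - h < e by lra.
move=> /(_ isT h0); rewrite nmulr_rlt0 ?invr_lt0// subr_gt0 ltNge gmax//.
by apply/andP; split; lra.
Qed.

End line_derivatives.

Lemma continuous_pair_at {T U V : topologicalType} (f : T -> U) (g : T -> V) (t : T) :
  {for t, continuous f} -> {for t, continuous g} ->
  {for t, continuous (fun s => (f s, g s))}.
Proof.
move=> cf cg.
exact: (@cvg_pair _ _ _ (nbhs t) (nbhs (f t)) (nbhs (g t)) _ _ _ f g cf cg).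
Qed.

(** * The Euclidean inner product and norm on row vectors *)

Section euclidean.
Context {R : realType} {n : nat}.
Implicit Types x y z : 'rV[R]_n.

Lemma dotvC x y : dotv x y = dotv y x.
Proof. by apply: eq_bigr => i _; rewrite mulrC. Qed.

Lemma dotvDl x y z : dotv (x + y) z = dotv x z + dotv y z.
Proof. by rewrite -big_split; apply: eq_bigr => i _; rewrite mxE mulrDl. Qed.

Lemma dotvZl c x y : dotv (c *: x) y = c * dotv x y.
Proof. by rewrite mulr_sumr; apply: eq_bigr => i _; rewrite mxE mulrA. Qed.

Lemma dotvDr x y z : dotv x (y + z) = dotv x y + dotv x z.
Proof. by rewrite dotvC dotvDl !(dotvC x). Qed.

Lemma dotvZr c x y : dotv x (c *: y) = c * dotv x y.
Proof. by rewrite dotvC dotvZl dotvC. Qed.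

Lemma dotv_delta i x : dotv (delta_mx ord0 i) x = x ord0 i.
Proof.
rewrite /dotv (bigD1 i)//= mxE !eqxx mul1r big1 ?addr0// => j ji.
by rewrite mxE (negbTE ji) andbF mul0r.
Qed.

Lemma dotv_ge0 x : 0 <= dotv x x.
Proof. by apply: sumr_ge0 => i _; rewrite -expr2 sqr_ge0. Qed.

Lemma dotv_addZ x v (s : R) : dotv (x + s *: v) (x + s *: v) =
  dotv x x + 2 * s * dotv x v + s ^+ 2 * dotv v v.
Proof. by rewrite dotvDl !dotvDr !dotvZl !dotvZr (dotvC v x); ring. Qed.

Lemma dotv_add_delta x i (s : R) :
  dotv (x + s *: delta_mx ord0 i) (x + s *: delta_mx ord0 i) =
  dotv x x + 2 * s * x ord0 i + s ^+ 2.
Proof. by rewrite dotv_addZ dotvC !dotv_delta mxE !eqxx mulr1. Qed.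

Lemma le_coord_dotv x i : x ord0 i ^+ 2 <= dotv x x.
Proof.
rewrite /dotv (bigD1 i)//= -expr2 lerDl.
by apply: sumr_ge0 => j _; rewrite -expr2 sqr_ge0.
Qed.

Lemma dotv_eq0 x : (dotv x x == 0) = (x == 0).
Proof.
apply/eqP/eqP => [x0|->]; last first.
  by rewrite /dotv big1// => i _; rewrite mxE mul0r.
apply/rowP => i; rewrite mxE; apply/eqP; rewrite -sqrf_eq0.
by rewrite eq_le sqr_ge0 andbT -x0 le_coord_dotv.
Qed.

Lemma enorm_ge0 x : 0 <= enorm x. Proof. exact: sqrtr_ge0. Qed.

Lemma enorm_sqr x : enorm x ^+ 2 = dotv x x.
Proof. by rewrite sqr_sqrtr// dotv_ge0. Qed.

Lemma enorm0 : enorm (0 : 'rV[R]_n) = 0.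
Proof. by rewrite /enorm (eqP (_ : dotv 0 0 == 0)) ?sqrtr0// dotv_eq0. Qed.

Lemma enormZ c x : enorm (c *: x) = `|c| * enorm x.
Proof.
by rewrite /enorm dotvZl dotvZr mulrA -expr2 sqrtrM ?sqr_ge0// sqrtr_sqr.
Qed.

Lemma enormN x : enorm (- x) = enorm x.
Proof. by rewrite -scaleN1r enormZ normrN normr1 mul1r. Qed.

Lemma dotv_cauchy x y : dotv x y <= enorm x * enorm y.
Proof.
have [->|y0] := eqVneq y 0.
  by rewrite enorm0 mulr0 dotvC /dotv big1// => i _; rewrite mxE mul0r.
have yy : 0 < dotv y y by rewrite lt_neqAle dotv_ge0 andbT eq_sym dotv_eq0.
rewrite (le_trans (ler_norm _))// -sqrtr_sqr /enorm -sqrtrM ?dotv_ge0//.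
apply: ler_wsqrtr.
have := dotv_ge0 (x + (- (dotv x y / dotv y y)) *: y).
rewrite dotv_addZ.
have -> : dotv x x + 2 * - (dotv x y / dotv y y) * dotv x y +
   (- (dotv x y / dotv y y)) ^+ 2 * dotv y y =
   (dotv x x * dotv y y - dotv x y ^+ 2) / dotv y y by field; rewrite gt_eqF.
by rewrite pmulr_lge0 ?invr_gt0// subr_ge0.
Qed.

Lemma enormD x y : enorm (x + y) <= enorm x + enorm y.
Proof.
rewrite -(@ler_pXn2r _ 2) ?nnegrE ?addr_ge0 ?enorm_ge0//.
rewrite enorm_sqr dotvDl !dotvDr (dotvC y x) sqrrD !enorm_sqr.
have := dotv_cauchy x y; lra.
Qed.

Lemma le_coord_enorm x i : `|x ord0 i| <= enorm x.
Proof. by rewrite -sqrtr_sqr ler_wsqrtr// le_coord_dotv. Qed.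

Lemma continuous_dotv {T : topologicalType} (f g : T -> 'rV[R]_n) (t : T) :
  {for t, continuous f} -> {for t, continuous g} ->
  {for t, continuous (fun s => dotv (f s) (g s))}.
Proof.
move=> cf cg; rewrite /dotv /continuous_at.
apply: (@cvg_big R 'I_n +%R 0 xpredT add_continuous T (nbhs t) _
  (fun i s => f s ord0 i * g s ord0 i)) => i _.
have cc (h : T -> 'rV[R]_n) : {for t, continuous h} ->
    h s ord0 i @[s --> t] --> h t ord0 i.
  move=> ch; apply: (@continuous_comp _ _ _ h (fun x : 'rV[R]_n => x ord0 i)) => //.
  exact: coord_continuous.
by apply: cvgM; exact: cc.
Qed.

Lemma compact_dotv_le C : exists2 K : set 'rV[R]_n, compact K &
  forall x, dotv x x <= C -> K x.
Proof.
exists [set x : 'rV[R]_n | forall i, [set` `[- (1 + C), 1 + C]] (x ord0 i)].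
  apply: (@rV_compact R n (fun=> [set` `[- (1 + C), 1 + C]])) => i.
  exact: segment_compact.
move=> x xC i /=; rewrite in_itv/= -ler_norml.
have := le_trans (le_coord_dotv x i) xC.
(* 2 |x_i| <= 1 + x_i^2 takes the place of a square root of [C]. *)
by have := sqr_ge0 (`|x ord0 i| - 1); rewrite -(real_normK (num_real (x ord0 i))); nra.
Qed.

End euclidean.

(** The contact time is the minimum of the time coordinate over the set where [H] is nonnegative,
    which [K] makes compact; on an unbounded space it is the barrier that supplies [K]. The
    inequality at the contact time itself is the limit of those before it. *)
Lemma first_touch {R : realType} (T : topologicalType) (H : T * R -> R)
    (K : set T) (t0 : R) (x1 : T) :
  compact K -> continuous H ->
  (forall x (t : R), 0 <= t <= t0 -> 0 <= H (x, t) -> K x) ->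
  (forall x, H (x, 0) < 0) -> 0 <= t0 -> 0 <= H (x1, t0) ->
  exists x (t : R), [/\ 0 < t <= t0, H (x, t) = 0, forall y, H (y, t) <= 0 &
    forall y (s : R), 0 <= s < t -> H (y, s) < 0].
Proof.
move=> cK cH HK H0 t00 Hx1.
pose S : set (T * R) := (K `*` `[0, t0]) `&` H @^-1` [set r | 0 <= r].
have cS : compact S.
  apply: compact_closedI; first by apply: compact_setX => //; exact: segment_compact.
  by apply: preimage_closed; [move=> x _; exact: cH|exact: closed_ge].
have S0 : S !=set0.
  by exists (x1, t0); split => //; split => /=; [apply: (HK _ t0)|];
    rewrite ?in_itv/= ?t00 ?lexx.
have [|[x t]] := compact_EVT_min (f := snd) S0 cS.
  by apply: continuous_subspaceT => z; exact: cvg_snd.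
rewrite inE => -[[/= Kx]]; rewrite in_itv/= => /andP[tge0 tt0] Hxt tmin.
have before y (s : R) : 0 <= s < t -> H (y, s) < 0.
  move=> /andP[s0 st]; rewrite ltNge; apply/negP => Hys.
  have := tmin (y, s); rewrite inE /= => /(_ _)/wrap[]; last by rewrite leNgt st.
  have sI : 0 <= s <= t0 by rewrite s0 (le_trans (ltW st)).
  by split => //; split; [exact: (HK _ s)|rewrite /= in_itv].
have t_gt0 : 0 < t.
  by rewrite lt_neqAle tge0 andbT; apply: contraTneq Hxt => <-; rewrite -ltNge.
have at_t y : H (y, t) <= 0.
  have cv : H (y, s) @[s --> t^'-] --> H (y, t).
    apply: cvg_at_left_filter.
    apply: (@continuous_comp R (T * R)%type R (fun s => (y, s)) H); last exact: cH.
    by apply: continuous_pair_at; first exact: cvg_cst.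
  rewrite leNgt; apply/negP => Hy.
  near (t : R)^'- => s.
  have : 0 < H (y, s) by near: s; exact: (cvgr_gt _ cv).
  apply/negP; rewrite -leNgt ltW// before//.
  by apply/andP; split; near: s; [exact: nbhs_left_ge|exact: nbhs_left_lt].
exists x, t; split=> //; first by rewrite t_gt0.
by apply/eqP; rewrite eq_le at_t.
Unshelve. all: by end_near. Qed.

Section one_dimensional_tests.
Context {R : realType}.
Implicit Types (s : R) (q p : R).

Lemma is_derive_quad (q0 q1 q2 s : R) :
  is_derive s 1 (fun s => q0 + q1 * s + q2 * s ^+ 2) (q1 + 2 * q2 * s).
Proof.
have D : is_derive s 1 (cst q0 + q1 *: id + q2 *: (id ^+ 2)) (q1 + 2 * q2 * s).
  by apply: is_derive_eq; rewrite /= add0r /GRing.scale /=; ring.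
exact: D.
Qed.

Lemma is_derive_sqrt_quad (q0 q1 q2 s : R) : 0 < q0 + q1 * s + q2 * s ^+ 2 ->
  is_derive s 1 (fun s => Num.sqrt (q0 + q1 * s + q2 * s ^+ 2))
    ((q1 + 2 * q2 * s) / (2 * Num.sqrt (q0 + q1 * s + q2 * s ^+ 2))).
Proof.
move=> q_gt0; rewrite mulrC.
exact: (@is_derive1_comp _ Num.sqrt _ s _ _ (is_derive1_sqrt q_gt0) (is_derive_quad _ _ _ _)).
Qed.

Lemma is_derive2_sqrt_quad (q0 q1 q2 : R) : 0 < q0 ->
  is_derive (0 : R) 1
    (fun s => (q1 + 2 * q2 * s) / (2 * Num.sqrt (q0 + q1 * s + q2 * s ^+ 2)))
    (q2 / Num.sqrt q0 - q1 ^+ 2 / (4 * Num.sqrt q0 ^+ 3)).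
Proof.
move=> q_gt0.
have E : q0 + q1 * 0 + q2 * 0 ^+ 2 = q0 by ring.
have D1 := @is_derive_quad q1 (2 * q2) 0 0.
have q_gt0' : 0 < q0 + q1 * 0 + q2 * 0 ^+ 2 by rewrite E.
have D2 := is_derive_sqrt_quad q_gt0'.
have q0' : Num.sqrt (q0 + q1 * 0 + q2 * 0 ^+ 2) != 0.
  by rewrite E sqrtr_eq0 -ltNge.
have D3 := @is_deriveV R _ 0 _ 1 q0' D2.
have := is_deriveM D1 (is_deriveZ (2^-1) D3).
rewrite (_ : _ * _ = fun s => (q1 + 2 * q2 * s) /
   (2 * Num.sqrt (q0 + q1 * s + q2 * s ^+ 2))); last first.
  by apply/funext => s; rewrite /GRing.scale /=; rewrite !fctE mul0r addr0 invfM.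
move=> /is_derive_eq; apply; rewrite /GRing.scale /= E.
have q0n : Num.sqrt q0 != 0 by rewrite -E.
by rewrite [2^-1 *: _]mulrC; field.
Qed.

(** On a line both barriers of the proof have this form: the square root carries the distance of the
    two points, the polynomial the growth at infinity. The one-point barrier is the case where [V2]
    and [M] are 0. *)
Lemma second_derivative_test_sqrt (V1 V2 V1' V2' : R -> R)
    (d1 d2 M q0 q1 q2 p0 p1 p2 : R) :
  (forall s : R, is_derive s 1 V1 (V1' s)) ->
  (forall s : R, is_derive s 1 V2 (V2' s)) ->
  is_derive (0 : R) 1 V1' d1 -> is_derive (0 : R) 1 V2' d2 ->
  (forall s, 0 < q0 + q1 * s + q2 * s ^+ 2) ->
  (forall s, V1 s - V2 s - M * Num.sqrt (q0 + q1 * s + q2 * s ^+ 2)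
    - (p0 + p1 * s + p2 * s ^+ 2) <= V1 0 - V2 0 - M * Num.sqrt q0 - p0) ->
  V1' 0 - V2' 0 - M * (q1 / (2 * Num.sqrt q0)) - p1 = 0 /\
  d1 - d2 - M * (q2 / Num.sqrt q0 - q1 ^+ 2 / (4 * Num.sqrt q0 ^+ 3)) - 2 * p2 <= 0.
Proof.
move=> DV1 DV2 DV1' DV2' q_gt0 gmax.
have E : q0 + q1 * 0 + q2 * 0 ^+ 2 = q0 by ring.
have q0_gt0 : 0 < q0 by have := q_gt0 0; rewrite E.
pose g s := V1 s - V2 s - M * Num.sqrt (q0 + q1 * s + q2 * s ^+ 2)
  - (p0 + p1 * s + p2 * s ^+ 2).
pose g1 s := V1' s - V2' s
  - M * ((q1 + 2 * q2 * s) / (2 * Num.sqrt (q0 + q1 * s + q2 * s ^+ 2)))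
  - (p1 + (2 * p2) * s).
have D1 (s : R) : is_derive s 1 g (g1 s).
  exact: (is_deriveB (is_deriveB (is_deriveB (DV1 s) (DV2 s))
    (is_deriveZ M (is_derive_sqrt_quad (q_gt0 s)))) (is_derive_quad p0 p1 p2 s)).
have D2 : is_derive (0 : R) 1 g1
    (d1 - d2 - M * (q2 / Num.sqrt q0 - q1 ^+ 2 / (4 * Num.sqrt q0 ^+ 3)) - 2 * p2).
  have DL : is_derive (0 : R) 1 (fun s => p1 + (2 * p2) * s) (2 * p2).
    rewrite (_ : (fun s => _) = fun s => p1 + (2 * p2) * s + 0 * s ^+ 2).
      by apply: is_derive_eq (is_derive_quad p1 (2 * p2) 0 0) _; ring.
    by apply/funext => s; ring.
  exact: (is_deriveB (is_deriveB (is_deriveB DV1' DV2')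
    (is_deriveZ M (is_derive2_sqrt_quad q1 q2 q0_gt0))) DL).
have gmax' s : g s <= g 0.
  apply: (le_trans (gmax s)).
  by rewrite /g E mulr0 expr0n/= mulr0 !addr0.
have [g10 g20] := second_derivative_test D1 D2 gmax'.
split=> //.
by move: g10; rewrite /g1 E !mulr0 !addr0.
Qed.

End one_dimensional_tests.

(** * The algebra of the contact point *)

Section touching_algebra.
Context {R : realFieldType}.

(* The numbers come from the touching point of the doubled function with its
   barrier: psi = sqrt (|x - y|^2 + D), h is the value of the quadratic barrier,
   W = v x - v y, S = (sqrt A - sqrt B)^2 for the diffusion coefficients A and B
   at x and y, and L, G, F are the Laplacians, squared gradients and sources. *)
Lemma touching_point_absurd (n M psi D delta A B S W P h C0 C1 C2 Ca Cb bX bY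
    Lx Ly Gx Gy FX FY Lam K : R) :
  1 <= n -> 0 < M -> 0 < delta -> delta <= psi -> 0 < D -> D <= psi ^+ 2 ->
  0 <= S -> W = M * psi + h -> 0 < h -> W <= C0 -> 0 <= C1 -> 0 <= C2 ->
  P = bY - bX -> (n - 1) * S <= P * W -> S <= C1 * W ^+ 2 -> P <= C2 * W ->
  0 <= K ->
  A * Lx - B * Ly <= M * S * (n / psi - (psi ^+ 2 - D) / psi ^+ 3) + 4 * n * Ca * h ->
  `|Gx - M ^+ 2 * (psi ^+ 2 - D) / psi ^+ 2| <= K * h ->
  `|Gy - M ^+ 2 * (psi ^+ 2 - D) / psi ^+ 2| <= K * h ->
  `|bX| <= Cb -> `|bY| <= Cb -> FX <= FY ->
  Lam > 4 * n * Ca + 2 * Cb * K + M * C2 * C0 / delta + 2 * M * C1 * C0 / delta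
    + C2 * M ^+ 2 ->
  0 <= A * Lx + bX * Gx + FX - (B * Ly + bY * Gy + FY)
    - M * ((C1 + C2) * M ^+ 2 * D / psi) - Lam * h ->
  False.
Proof.
move=> n1 M0 delta0 dpsi D0 Dpsi S0 WE h0 WC C10 C20 PE key k1 k2 K0 Lap gx gy
  bXC bYC FF LamC.
have psi0 : 0 < psi by lra.
pose e := psi^-1; have e0 : 0 < e by rewrite invr_gt0.
have epsi : e * psi = 1 by rewrite mulVf// gt_eqF.
pose ed := delta^-1.
have eed : e <= ed by rewrite lef_pV2.
have ed0 : 0 < ed by rewrite invr_gt0.
(* The share of psi^2 due to [D]: the squared gradient of M psi is M^2 (1 - th), and the terms in
   [th] of order psi are those to be paid for by the growth of [D] in time. *)
pose th := D * e ^+ 2.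
have th0 : 0 < th by rewrite mulr_gt0// exprn_gt0.
have th1 : th <= 1.
  have : D * e ^+ 2 <= psi ^+ 2 * e ^+ 2 by rewrite ler_wpM2r// exprn_ge0// ltW.
  by rewrite -exprMn (mulrC psi) epsi expr1n.
have thE : M ^+ 2 * (psi ^+ 2 - D) / psi ^+ 2 = M ^+ 2 * (1 - th).
  by rewrite /th /e; field; rewrite gt_eqF.
rewrite thE in gx gy.
have LapE : M * S * (n / psi - (psi ^+ 2 - D) / psi ^+ 3) =
    M * e * ((n - 1) * S) + M * e * (S * th).
  by rewrite /th /e; field; rewrite gt_eqF.
rewrite LapE in Lap.
have -> : M * ((C1 + C2) * M ^+ 2 * D / psi) = (C1 + C2) * M ^+ 3 * psi * th.
  by rewrite /th /e; field; rewrite gt_eqF.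
have Mpsi0 : 0 < M * psi by rewrite mulr_gt0.
have W0 : 0 < W by rewrite WE; lra.
have C00 : 0 < C0 by lra.
have Me0 : 0 < M * e by rewrite mulr_gt0.
have MeW : M * e * W = M ^+ 2 + M * e * h.
  by rewrite WE mulrDr -[X in _ = X + _]mulr1 -epsi; ring.
have eh : e * h <= ed * h by rewrite ler_wpM2r// ltW.
have PC : P <= C2 * C0 by apply: le_trans k2 _; rewrite ler_wpM2l.
(* The hypothesis (n - 1) S <= P W turns the curvature term into M^2 P, which the gradient terms
   cancel exactly; what is left is a multiple of [h]. *)
have T1 : M * e * ((n - 1) * S) <= M ^+ 2 * P + M * C2 * C0 * ed * h.
  have : M * e * ((n - 1) * S) <= M * e * (P * W) by rewrite ler_pM2l.
  have : P * (M * e * h) <= C2 * C0 * (M * e * h) by rewrite ler_wpM2r// !mulr_ge0// ltW.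
  have : C2 * C0 * M * (e * h) <= C2 * C0 * M * (ed * h).
    by rewrite ler_wpM2l// !mulr_ge0// ltW.
  have : M * e * (P * W) = P * (M ^+ 2 + M * e * h) by rewrite -MeW; ring.
  lra.
have W2 : W ^+ 2 <= (M * psi) ^+ 2 + 2 * C0 * h.
  have : W ^+ 2 = (M * psi) ^+ 2 + (W + M * psi) * h by rewrite WE; ring.
  have : (W + M * psi) * h <= 2 * C0 * h by rewrite ler_wpM2r; lra.
  lra.
(* [S] is at most of order W^2, so this term is of order psi th and is matched by the [C1] part of
   the time derivative of the barrier; [T3] uses the [C2] part. *)
have T2 : M * e * (S * th) <= C1 * M ^+ 3 * psi * th + 2 * M * C1 * C0 * ed * h.
  have : M * e * th * S <= M * e * th * (C1 * ((M * psi) ^+ 2 + 2 * C0 * h)).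
    rewrite ler_wpM2l ?(ltW (mulr_gt0 _ _))//.
    by apply: le_trans k1 _; rewrite ler_wpM2l.
  have -> : M * e * th * (C1 * ((M * psi) ^+ 2 + 2 * C0 * h)) =
     C1 * M ^+ 3 * psi * th * (e * psi) + 2 * M * C1 * C0 * (e * h) * th by ring.
  have c0 : 0 <= 2 * M * C1 * C0 by rewrite !mulr_ge0// ltW.
  have : 2 * M * C1 * C0 * (e * h) * th <= 2 * M * C1 * C0 * (ed * h) * 1.
    apply: ler_pM => //; first by rewrite !mulr_ge0// ltW.
      by rewrite ltW.
    by rewrite ler_wpM2l.
  rewrite epsi; lra.
have T3 : M ^+ 2 * P * th <= C2 * M ^+ 3 * psi * th + C2 * M ^+ 2 * h.
  have : M ^+ 2 * th * P <= M ^+ 2 * th * (C2 * W).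
    by rewrite ler_wpM2l ?(ltW (mulr_gt0 _ _))// exprn_gt0.
  have -> : M ^+ 2 * th * (C2 * W) = C2 * M ^+ 3 * psi * th + C2 * M ^+ 2 * h * th.
    by rewrite WE; ring.
  have : C2 * M ^+ 2 * h * th <= C2 * M ^+ 2 * h * 1.
    by rewrite ler_wpM2l// !mulr_ge0// ltW// exprn_gt0.
  lra.
pose G0 := M ^+ 2 * (1 - th).
have Kh0 : 0 <= K * h by rewrite mulr_ge0// ltW.
have Cb0 : 0 <= Cb := le_trans (normr_ge0 _) bXC.
have gb b G : `|b| <= Cb -> `|G - G0| <= K * h -> `|b * G - b * G0| <= Cb * K * h.
  by move=> ? ?; rewrite -mulrBr normrM -mulrA ler_pM.
have := gb _ _ bXC gx; have := gb _ _ bYC gy; rewrite !ler_norml.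
move=> /andP[gY _] /andP[_ gX].
(* The first term cancels the one in [T1], the second is bounded in [T3]. *)
have G0E : bX * G0 - bY * G0 = - (M ^+ 2 * P) + M ^+ 2 * P * th.
  by rewrite PE /G0; ring.
have LamC' : (4 * n * Ca + 2 * Cb * K + M * C2 * C0 * ed + 2 * M * C1 * C0 * ed
    + C2 * M ^+ 2) * h < Lam * h by rewrite ltr_pM2r.
apply/negP; rewrite -ltNge.
lra.
Qed.

End touching_algebra.

(** * Restriction of C^{2,1} functions to coordinate lines *)

Section C21_lines.
Context {R : realType} {N : nat}.
Implicit Types (w : 'rV[R]_N * R -> R) (x : 'rV[R]_N) (t : R).

Lemma add_dx_dir x t (c : R) i :
  (x, t) + c *: dx_dir i = (x + c *: delta_mx ord0 i, t).
Proof.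
by rewrite /dx_dir; congr pair => /=; rewrite [c *: (0 : R)]mulr0 addr0.
Qed.

Lemma C21_Omega_dx w x t i (c s : R) : C21_Omega w -> 0 < t ->
  is_derive s 1 (fun h : R => w (x + (h * c) *: delta_mx ord0 i, t))
    (c * dx i w (x + (s * c) *: delta_mx ord0 i, t)).
Proof.
move=> C21 t0; rewrite (_ : (fun h => _) = (fun h => w ((x, t) + (h * c) *: dx_dir i))).
  rewrite -add_dx_dir; apply: is_derive_scaled_line; apply: derivableP.
  have Oz : Omega ((x, t) + (s * c) *: dx_dir i) by rewrite add_dx_dir.
  by have [_ _ /(_ i)[]] := C21 _ Oz.
by apply/funext => h; rewrite add_dx_dir.
Qed.

Lemma C21_Omega_dxx w x t i (c : R) : C21_Omega w -> 0 < t ->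
  is_derive (0 : R) 1 (fun h : R => c * dx i w (x + (h * c) *: delta_mx ord0 i, t))
    (c ^+ 2 * dx i (dx i w) (x, t)).
Proof.
move=> C21 t0.
rewrite (_ : (fun h => _) = c *: (fun h => dx i w ((x, t) + (h * c) *: dx_dir i))).
  have E : c *: (c * dx i (dx i w) (x, t)) = c ^+ 2 * dx i (dx i w) (x, t).
    by rewrite [LHS]mulrA expr2.
  rewrite -E; apply: is_deriveZ.
  apply: is_derive_scaled_line; rewrite mul0r scale0r addr0; apply: derivableP.
  by have [_ _ _ /(_ i i)[]] := C21 (x, t) t0.
by apply/funext => h; rewrite fctE add_dx_dir.
Qed.

Lemma C21_Omega_dt w x t : C21_Omega w -> 0 < t ->
  is_derive t 1 (fun s : R => w (x, s)) (dt w (x, t)).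
Proof.
have E s : (x, 0) + s *: dt_dir = (x, s) :> 'rV[R]_N * R.
  by rewrite /dt_dir; congr pair => /=; rewrite ?scaler0 ?addr0// add0r [s *: _]mulr1.
move=> C21 t0; rewrite (_ : (fun s => _) = (fun s : R => w ((x, 0) + s *: dt_dir))).
  apply: is_derive_line; rewrite E; apply: derivableP.
  by have [_ []] := C21 (x, t) t0.
by apply/funext => s; rewrite E.
Qed.

(** Replacing negative times by 0 extends a function controlled on the closed half-space only, since
    [first_touch] asks for continuity everywhere. *)
Lemma continuous_max0 w : {within cOmega, continuous w} ->
  continuous (fun z : 'rV[R]_N * R => w (z.1, Num.max z.2 0)).
Proof.
move=> /subspace_continuousP cw z.
have cz : cOmega (z.1, Num.max z.2 0) by rewrite /cOmega/= le_max lexx orbT.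
apply: (@cvg_trans _ (w @ (within cOmega (nbhs (z.1, Num.max z.2 0))))); last exact: cw.
move=> A /=; rewrite nbhs_simpl /= => wA.
have cg : (fun z : 'rV[R]_N * R => (z.1, Num.max z.2 0)) @ z -->
    (z.1, Num.max z.2 0).
  apply: continuous_pair_at; first exact: cvg_fst.
  by apply: continuous_max; [exact: cvg_snd|exact: cvg_cst].
have := cg _ wA; rewrite !nbhs_simpl /=; apply: filterS => y; apply.
by rewrite /cOmega/= le_max lexx orbT.
Qed.

End C21_lines.

Lemma is_derive_expR_scale {R : realType} (c t : R) :
  is_derive t 1 (fun s => expR (c * s)) (c * expR (c * t)).
Proof.
have D : is_derive t 1 (fun s : R => c * s) c.
  rewrite (_ : (fun s => _) = c *: id)//.
  by apply: is_derive_eq; rewrite [_ *: _]mulr1.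
by rewrite mulrC; exact: (@is_derive1_comp _ expR _ t _ _ (is_derive_expR _) D).
Qed.

(** * Propagation of a Lipschitz bound *)

Section doubling.
Context {R : realType} {N : nat}.
Variables (v : 'rV[R]_N * R -> R) (a b : R -> R) (F : R -> R -> R).
Variables (m1 m2 M C1 C2 Ca Cb : R).
Hypotheses (N1 : (1 <= N)%N) (M0 : 0 < M) (C21 : C21_Omega v).
Hypothesis cv : {within cOmega, continuous v}.
Hypothesis vm : forall z, cOmega z -> m1 <= v z <= m2.
Hypothesis pde : forall z, Omega z -> dt v z = a (v z) * laplacian v z
  + b (v z) * dotv (grad v z) (grad v z) + F z.2 (v z).
Hypotheses (C10 : 0 <= C1) (C20 : 0 <= C2).
Hypothesis abC : forall X, m1 <= X <= m2 -> 0 <= a X <= Ca /\ `|b X| <= Cb.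
Hypothesis key : forall X Y, m1 <= Y -> Y < X -> X <= m2 ->
  [/\ (N%:R - 1) * (Num.sqrt (a X) - Num.sqrt (a Y)) ^+ 2 <= (b Y - b X) * (X - Y),
      (Num.sqrt (a X) - Num.sqrt (a Y)) ^+ 2 <= C1 * (X - Y) ^+ 2,
      b Y - b X <= C2 * (X - Y) &
      forall t, 0 < t -> F t X <= F t Y].
Hypothesis init : forall x y, v (x, 0) - v (y, 0) <= M * enorm (x - y).

(** Chosen so that the time derivative of M sqrt(rho) is (C1 + C2) M^3 D / psi with D = d e^(Ct);
    the 2 compensates the derivative of the square root. *)
Let C := 2 * (C1 + C2) * M ^+ 2.

Section barrier.
Variables (d Lam kap : R).
Hypotheses (d0 : 0 < d) (kap0 : 0 < kap).

(** [d] keeps the square root smooth on the diagonal and, for nonnegative times, at least sqrt(d);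
    [beta] forces the contact points into a compact set. *)
Let rho x y t := dotv (x - y : 'rV[R]_N) (x - y) + d * expR (C * t).
Let beta (x y : 'rV[R]_N) t := expR (Lam * t) * (1 + dotv x x + dotv y y).

Let rho_gt0 x y t : 0 < rho x y t.
Proof. by rewrite ltr_wpDl ?dotv_ge0// mulr_gt0// expR_gt0. Qed.

(* Moving x and y along one axis with the speeds sg and ta; the useful choice is
   the square roots of the diffusion coefficients at the two points. *)
Let touch_space x y t (sg ta : R) i : 0 < t ->
  (forall x' y', v (x', t) - v (y', t) - M * Num.sqrt (rho x' y' t)
     - kap * beta x' y' t <=
   v (x, t) - v (y, t) - M * Num.sqrt (rho x y t) - kap * beta x y t) ->
  let psi := Num.sqrt (rho x y t) in let E := expR (Lam * t) in
  let z := x - y in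
  sg * dx i v (x, t) - ta * dx i v (y, t) - M * ((sg - ta) * z ord0 i / psi)
    - 2 * kap * E * (sg * x ord0 i + ta * y ord0 i) = 0 /\
  sg ^+ 2 * dx i (dx i v) (x, t) - ta ^+ 2 * dx i (dx i v) (y, t)
   - M * (sg - ta) ^+ 2 * (1 / psi - z ord0 i ^+ 2 / psi ^+ 3)
   - 2 * kap * E * (sg ^+ 2 + ta ^+ 2) <= 0.
Proof.
move=> t0 vmax psi E z.
have psi0 : psi != 0 by rewrite sqrtr_eq0 -ltNge.
pose e : 'rV[R]_N := delta_mx ord0 i.
have rhoE s : rho (x + (s * sg) *: e) (y + (s * ta) *: e) t =
    rho x y t + (2 * (sg - ta) * z ord0 i) * s + (sg - ta) ^+ 2 * s ^+ 2.
  rewrite /rho (_ : _ - _ = z + (s * (sg - ta)) *: e); last first.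
    by rewrite /z mulrBr scalerBl opprD addrACA.
  by rewrite dotv_add_delta; ring.
have betaE s : kap * beta (x + (s * sg) *: e) (y + (s * ta) *: e) t =
    kap * beta x y t + (2 * kap * E * (sg * x ord0 i + ta * y ord0 i)) * s
    + (kap * E * (sg ^+ 2 + ta ^+ 2)) * s ^+ 2.
  by rewrite /beta !dotv_add_delta /E; ring.
pose V1 s := v (x + (s * sg) *: e, t); pose V2 s := v (y + (s * ta) *: e, t).
have pos s : 0 < rho x y t + (2 * (sg - ta) * z ord0 i) * s + (sg - ta) ^+ 2 * s ^+ 2.
  by rewrite -rhoE; exact: rho_gt0.
have mx s : V1 s - V2 s - M * Num.sqrt (rho x y t +
    (2 * (sg - ta) * z ord0 i) * s + (sg - ta) ^+ 2 * s ^+ 2) -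
    (kap * beta x y t + (2 * kap * E * (sg * x ord0 i + ta * y ord0 i)) * s
    + (kap * E * (sg ^+ 2 + ta ^+ 2)) * s ^+ 2) <=
    V1 0 - V2 0 - M * Num.sqrt (rho x y t) - kap * beta x y t.
  by rewrite -rhoE -betaE /V1 /V2 !mul0r !scale0r !addr0; exact: vmax.
have [g1 g2] := second_derivative_test_sqrt
    (fun s => C21_Omega_dx x i sg s C21 t0) (fun s => C21_Omega_dx y i ta s C21 t0)
    (C21_Omega_dxx x i sg C21 t0) (C21_Omega_dxx y i ta C21 t0) pos mx.
have alg1 (p m c w : R) : p != 0 -> m * ((2 * c * w) / (2 * p)) = m * (c * w / p).
  by move=> p0; field.
have alg2 (p m c w : R) : p != 0 ->
    m * (c ^+ 2 / p - (2 * c * w) ^+ 2 / (4 * p ^+ 3)) =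
    m * c ^+ 2 * (1 / p - w ^+ 2 / p ^+ 3).
  by move=> p0; field.
split; first by rewrite -[RHS]g1 !mul0r !scale0r !addr0 alg1.
by rewrite alg2 in g2; rewrite // -(mulrA 2) -(mulrA 2).
Qed.

Let touch_time x y t : 0 < t ->
  (forall s, 0 <= s < t -> v (x, s) - v (y, s) - M * Num.sqrt (rho x y s)
     - kap * beta x y s <=
   v (x, t) - v (y, t) - M * Num.sqrt (rho x y t) - kap * beta x y t) ->
  0 <= dt v (x, t) - dt v (y, t)
    - M * ((C1 + C2) * M ^+ 2 * (d * expR (C * t)) / Num.sqrt (rho x y t))
    - Lam * (kap * beta x y t).
Proof.
move=> t0 vmax.
have D1 : is_derive t 1 (fun s => rho x y s) (d * (C * expR (C * t))).
  by have := is_deriveD (is_derive_cst (dotv (x - y) (x - y)) t 1)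
    (is_deriveZ d (is_derive_expR_scale C t)); rewrite add0r.
have D2 : is_derive t 1 (fun s => Num.sqrt (rho x y s))
    ((2 * Num.sqrt (rho x y t))^-1 * (d * (C * expR (C * t)))).
  exact: (@is_derive1_comp _ Num.sqrt _ t _ _ (is_derive1_sqrt (rho_gt0 x y t)) D1).
have D3 : is_derive t 1 (fun s => kap * beta x y s) (Lam * (kap * beta x y t)).
  have := is_deriveZ (kap * (1 + dotv x x + dotv y y)) (is_derive_expR_scale Lam t).
  rewrite (_ : _ \*: _ = fun s => kap * beta x y s); last first.
    by apply/funext => s; rewrite /beta /= /GRing.scale/=; ring.
  by move=> /is_derive_eq; apply; rewrite /beta /GRing.scale/=; ring.
have D4 := is_deriveB (is_deriveB (is_deriveB (C21_Omega_dt x C21 t0)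
  (C21_Omega_dt y C21 t0)) (is_deriveZ M D2)) D3.
have := left_max_derive_ge0 t0 D4 vmax.
congr (0 <= _); congr (_ - _ - _ - _); rewrite /GRing.scale/=; congr (_ * _).
have psi0 : Num.sqrt (rho x y t) != 0 by rewrite sqrtr_eq0 -ltNge.
by rewrite /C; field.
Qed.

(** In each coordinate the difference is 2 M k (z_i / psi) x_i + k^2 x_i^2, with |z_i| <= psi. At
    the second point it is applied to -y, because the penalty enters there with the opposite
    sign. *)
Let gradient_error (g z x : 'rV[R]_N) (psi k : R) : 0 < psi -> 0 <= k ->
  dotv z z <= psi ^+ 2 -> (forall i, g ord0 i = M * z ord0 i / psi + k * x ord0 i) ->
  `|dotv g g - M ^+ 2 * dotv z z / psi ^+ 2| <=
    M * k * (N%:R + dotv x x) + k ^+ 2 * dotv x x.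
Proof.
move=> psi0 k0 zpsi gE.
have -> : dotv g g - M ^+ 2 * dotv z z / psi ^+ 2 =
    \sum_i (2 * M * k * (z ord0 i / psi * x ord0 i) + k ^+ 2 * x ord0 i ^+ 2).
  rewrite /dotv -mulrA mulr_suml mulr_sumr -sumrB; apply: eq_bigr => i _.
  by rewrite gE; field; rewrite gt_eqF.
have -> : M * k * (N%:R + dotv x x) + k ^+ 2 * dotv x x =
    \sum_i (M * k * (1 + x ord0 i ^+ 2) + k ^+ 2 * x ord0 i ^+ 2).
  rewrite big_split -!mulr_sumr big_split/= sumr_const card_ord.
  by [].
apply: (le_trans (ler_norm_sum _ _ _)); apply: ler_sum => i _.
rewrite (le_trans (ler_normD _ _))// lerD//; last first.
  by rewrite ger0_norm// mulr_ge0 ?sqr_ge0.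
have -> : 2 * M * k * (z ord0 i / psi * x ord0 i) =
  M * k * (2 * (z ord0 i / psi * x ord0 i)) by ring.
have Mk : 0 <= M * k by rewrite mulr_ge0// ltW.
rewrite normrM (ger0_norm Mk) ler_wpM2l// normrM normr_nat normrM.
have : `|z ord0 i / psi| <= 1.
  rewrite normf_div (gtr0_norm psi0) ler_pdivrMr// mul1r.
  rewrite -(@ler_pXn2r _ 2) ?nnegrE ?normr_ge0 ?(ltW psi0)//.
  by rewrite real_normK ?num_real// (le_trans _ zpsi)// le_coord_dotv.
move: (normr_ge0 (x ord0 i)) (normr_ge0 (z ord0 i / psi)) (sqr_ge0 (`|x ord0 i| - 1)).
rewrite -(real_normK (num_real (x ord0 i))).
nra.
Qed.

Let C0 := m2 - m1.
Let K := 2 * M * N%:R + 4 * C0.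

(** The sum of all multiples of [h] met in [touching_point_absurd], plus 1 for strictness. It
    depends on [d] through the lower bound sqrt(d) of psi. *)
Hypothesis LamE : Lam = 4 * N%:R * Ca + 2 * Cb * K + M * C2 * C0 / Num.sqrt d
  + 2 * M * C1 * C0 / Num.sqrt d + C2 * M ^+ 2 + 1.

Let C0_ge0 : 0 <= C0.
Proof.
have := vm (z := (0, 0)); rewrite /cOmega/= => /(_ (lexx _))/andP[mv vm2].
by rewrite subr_ge0 (le_trans mv).
Qed.

Lemma doubling_barrier x y t : 0 <= t ->
  v (x, t) - v (y, t) < M * Num.sqrt (rho x y t) + kap * beta x y t.
Proof.
move=> tge0; rewrite ltNge; apply/negP => Hxy.
have N1' : 1 <= N%:R :> R by rewrite ler1n.
have N0' : 0 <= N%:R :> R by rewrite ler0n.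
have C0' := C0_ge0.
have sd0 : 0 < Num.sqrt d by rewrite sqrtr_gt0.
have [Ca0 Cb0] : 0 <= Ca /\ 0 <= Cb.
  have /abC[/andP[a0 a1] b1] : m1 <= v (0, 0) <= m2 by apply: vm; exact: lexx.
  by split; [exact: le_trans a1|exact: le_trans b1].
have K0 : 0 <= K by rewrite /K addr_ge0// !mulr_ge0// ltW.
have Lam0 : 0 <= Lam.
  have MCC : 0 <= M * C2 * C0 / Num.sqrt d by rewrite !mulr_ge0 ?invr_ge0// ltW.
  have MCC' : 0 <= 2 * M * C1 * C0 / Num.sqrt d.
    by rewrite !mulr_ge0 ?invr_ge0// ltW.
  have : 0 <= 4 * N%:R * Ca by rewrite !mulr_ge0.
  have : 0 <= 2 * Cb * K by rewrite !mulr_ge0.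
  have : 0 <= C2 * M ^+ 2 by rewrite mulr_ge0 ?sqr_ge0.
  by rewrite LamE; lra.
have Cge0 : 0 <= C by rewrite mulr_ge0 ?sqr_ge0// mulr_ge0// addr_ge0.
have exp1 c s : 0 <= c -> 0 <= s -> 1 <= expR (c * s).
  by move=> c0 s0; rewrite -expR0 ler_expR mulr_ge0.
(* [Num.max] matters at negative times only, where [v] is not controlled. *)
pose H (q : ('rV[R]_N * 'rV[R]_N) * R) :=
  v (q.1.1, Num.max q.2 0) - v (q.1.2, Num.max q.2 0)
  - M * Num.sqrt (rho q.1.1 q.1.2 q.2) - kap * beta q.1.1 q.1.2 q.2.
have HE x' y' s : 0 <= s -> H ((x', y'), s) = v (x', s) - v (y', s)
    - M * Num.sqrt (rho x' y' s) - kap * beta x' y' s.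
  by move=> s0; rewrite /H/= max_l.
have Hc : continuous H.
  move=> q.
  pose V1 : topologicalType := 'rV[R]_N; pose V2 : topologicalType := (V1 * V1)%type.
  pose V2R : topologicalType := (V2 * R)%type.
  have cB (f g : ('rV[R]_N * 'rV[R]_N) * R -> R) : {for q, continuous f} ->
    {for q, continuous g} -> {for q, continuous (fun q => f q - g q)} by exact: continuousB.
  have cD (f g : ('rV[R]_N * 'rV[R]_N) * R -> R) : {for q, continuous f} ->
    {for q, continuous g} -> {for q, continuous (fun q => f q + g q)} by exact: continuousD.
  have cM (f g : ('rV[R]_N * 'rV[R]_N) * R -> R) : {for q, continuous f} ->
    {for q, continuous g} -> {for q, continuous (fun q => f q * g q)} by exact: continuousM.
  have cst c : {for q, continuous (fun _ : ('rV[R]_N * 'rV[R]_N) * R => c : R)}.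
    exact: cvg_cst.
  have c11 : {for q, continuous (fun q : ('rV[R]_N * 'rV[R]_N) * R => q.1.1)}.
    exact: (@continuous_comp V2R V2 V1 fst fst q cvg_fst cvg_fst).
  have c12 : {for q, continuous (fun q : ('rV[R]_N * 'rV[R]_N) * R => q.1.2)}.
    exact: (@continuous_comp V2R V2 V1 fst snd q cvg_fst cvg_snd).
  have c2 : {for q, continuous (fun q : ('rV[R]_N * 'rV[R]_N) * R => q.2)} by exact: cvg_snd.
  have cz : {for q, continuous (fun q : ('rV[R]_N * 'rV[R]_N) * R => q.1.1 - q.1.2)}.
    exact: (continuousB c11 c12).
  have cexp c : {for q, continuous (fun q : ('rV[R]_N * 'rV[R]_N) * R => expR (c * q.2))}.
    apply: (@continuous_comp V2R R R (fun q => c * q.2) expR).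
      by apply: (@cM _ _).
    exact: continuous_expR.
  have cmax f : {for q, continuous f} ->
      {for q, continuous (fun q : ('rV[R]_N * 'rV[R]_N) * R => v (f q, Num.max q.2 0))}.
    move=> cf; apply: (@continuous_comp V2R (V1 * R)%type R (fun q => (f q, q.2))
      (fun z : 'rV[R]_N * R => v (z.1, Num.max z.2 0))); last exact: continuous_max0.
    exact: (continuous_pair_at cf c2).
  apply: (@cB _ _); [apply: (@cB _ _); [apply: (@cB _ _); exact: cmax|]|]; apply: (@cM _ _) => //.
    apply: (@continuous_comp V2R R R (fun q => rho q.1.1 q.1.2 q.2) Num.sqrt).
      by apply: (@cD _ _); [exact: (continuous_dotv cz cz)|exact: (@cM _ _)].
    exact: sqrt_continuous.
  have cb : {for q, continuous (fun q : V2R => 1 + dotv q.1.1 q.1.1 + dotv q.1.2 q.1.2)}.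
    exact: (cD _ _ (cD _ _ (cst 1) (continuous_dotv c11 c11)) (continuous_dotv c12 c12)).
  exact: (cM _ _ (cexp Lam) cb).
have vdiff x' y' s : 0 <= s -> v (x', s) - v (y', s) <= C0.
  move=> s0; have /andP[_ h1] := vm (z := (x', s)) s0.
  by have /andP[h2 _] := vm (z := (y', s)) s0; rewrite /C0 lerB.
have Msqrt0 x' y' s : 0 < M * Num.sqrt (rho x' y' s) by rewrite mulr_gt0 ?sqrtr_gt0.
have [Kc cKc Kcin] := compact_dotv_le (n := N) (R := R) (C0 / kap).
(* Contact needs kap beta <= C0, and beta is at least 1 + |x|^2 + |y|^2 because [Lam] and the time
   are nonnegative. *)
have bound x' y' s : 0 <= s -> 0 <= H ((x', y'), s) ->
    dotv x' x' <= C0 / kap /\ dotv y' y' <= C0 / kap.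
  move=> s0; rewrite HE// => Hge.
  have kb : kap * beta x' y' s <= C0.
    by have := vdiff x' y' s s0; have := Msqrt0 x' y' s; lra.
  have k1 : kap * (1 + dotv x' x' + dotv y' y') <= C0.
    apply: le_trans kb; rewrite ler_wpM2l ?(ltW kap0)// /beta.
    by rewrite ler_peMl ?exp1// !addr_ge0// dotv_ge0.
  have := dotv_ge0 x'; have := dotv_ge0 y'.
  by rewrite !ler_pdivlMr// ![_ * kap]mulrC; split; nra.
have [|||||[x' y'] [t' [/andP[t'0 _] HE0 Hle Hlt]]] :=
  @first_touch R _ H (Kc `*` Kc) t (x, y) _ Hc.
- exact: compact_setX.
- move=> [x1 y1] s /andP[s0 _] Hge; have [? ?] := bound _ _ _ s0 Hge.
  by split; exact: Kcin.
- move=> [x1 y1]; rewrite HE//.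
  have := init x1 y1; have : M * enorm (x1 - y1) <= M * Num.sqrt (rho x1 y1 0).
    rewrite ler_pM2l// ler_wsqrtr// /rho lerDl mulr_ge0 ?expR_ge0// ltW//.
  have : 0 < kap * beta x1 y1 0.
    by rewrite mulr_gt0// mulr_gt0 ?expR_gt0// -addrA ltr_pwDl// addr_ge0 ?dotv_ge0.
  lra.
- by [].
- by rewrite HE//; lra.
have t'ge0 := ltW t'0.
move: HE0; rewrite HE// => HE0.
have {}Hle x1 y1 : v (x1, t') - v (y1, t') - M * Num.sqrt (rho x1 y1 t')
     - kap * beta x1 y1 t' <=
   v (x', t') - v (y', t') - M * Num.sqrt (rho x' y' t') - kap * beta x' y' t'.
  by rewrite HE0; have := Hle (x1, y1); rewrite HE.
have {}Hlt s : 0 <= s < t' -> v (x', s) - v (y', s) - M * Num.sqrt (rho x' y' s)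
     - kap * beta x' y' s <=
   v (x', t') - v (y', t') - M * Num.sqrt (rho x' y' t') - kap * beta x' y' t'.
  move=> sI; rewrite HE0; have := Hlt (x', y') s sI.
  by rewrite HE ?(andP sI).1// => /ltW.
set psi := Num.sqrt (rho x' y' t') in HE0 Hle Hlt.
set h := kap * beta x' y' t' in HE0 Hle Hlt.
pose X := v (x', t'); pose Y := v (y', t'); pose E := expR (Lam * t').
pose k := 2 * kap * E.
have E1 : 1 <= E by exact: exp1.
have k0 : 0 < k by rewrite /k !mulr_gt0 ?expR_gt0.
have psi0 : 0 < psi by rewrite sqrtr_gt0.
have psi2 : psi ^+ 2 = dotv (x' - y') (x' - y') + d * expR (C * t').
  by rewrite sqr_sqrtr// ltW// rho_gt0.
have h0 : 0 < h.
  by rewrite mulr_gt0// mulr_gt0 ?expR_gt0// -addrA ltr_pwDl// addr_ge0 ?dotv_ge0.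
have WE : X - Y = M * psi + h by rewrite /X /Y; lra.
have WC : X - Y <= C0 by exact: vdiff.
have YX : Y < X by rewrite -subr_gt0 WE addr_gt0// mulr_gt0.
have Xm : m1 <= X <= m2 by exact: vm.
have Ym : m1 <= Y <= m2 by exact: vm.
have [/andP[aX0 aXC] bXC] := abC Xm.
have [/andP[aY0 aYC] bYC] := abC Ym.
have [k1 k2 k3 kF] := key (andP Ym).1 YX (andP Xm).2.
pose sA := Num.sqrt (a X); pose sB := Num.sqrt (a Y).
have sA2 : sA ^+ 2 = a X by rewrite sqr_sqrtr.
have sB2 : sB ^+ 2 = a Y by rewrite sqr_sqrtr.
(* The speeds (1, 0) move the first point alone and give the gradient there; (0, 1) does the same
   for the second point. *)
have gxE i : grad v (x', t') ord0 i = M * (x' - y') ord0 i / psi + k * x' ord0 i.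
  have [g1 _] := touch_space 1 0 i t'0 Hle.
  by apply: subr0_eq; rewrite -[RHS]g1 mxE /k /E; ring.
have gyE i : grad v (y', t') ord0 i = M * (x' - y') ord0 i / psi + k * (- y') ord0 i.
  have [g1 _] := touch_space 0 1 i t'0 Hle.
  have -> : (- y') ord0 i = - y' ord0 i by rewrite mxE.
  by apply/subr0_eq/oppr_inj; rewrite oppr0 -[RHS]g1 [grad _ _ _ _]mxE /k /E; ring.
have khx : k * (1 + dotv x' x' + dotv y' y') = 2 * h by rewrite /h /beta -/E /k; ring.
have xx := dotv_ge0 x'; have yy := dotv_ge0 y'.
have hC0 : h <= C0 by have := mulr_gt0 M0 psi0; lra.
(* k (1 + |x|^2 + |y|^2) = 2 h, so first-order errors in [k] are multiples of [h], and second-order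
   ones too because h <= C0. *)
have err (q : R) : 0 <= q -> q <= dotv x' x' + dotv y' y' ->
   M * k * (N%:R + q) + k ^+ 2 * q <= K * h.
  move=> q0 qle.
  have kq1 : k * (1 + q) <= 2 * h by rewrite -khx ler_pM2l// -addrA lerD2l.
  have : M * (k * (N%:R + q)) <= M * (N%:R * (2 * h)).
    rewrite ler_pM2l//.
    have : N%:R * (k * (1 + q)) <= N%:R * (2 * h) by rewrite ler_wpM2l.
    have : 0 <= (N%:R - 1) * (k * q) by rewrite mulr_ge0 ?subr_ge0// mulr_ge0// ltW.
    lra.
  have : k ^+ 2 * q <= 4 * C0 * h.
    have : k ^+ 2 * q <= (k * (1 + q)) ^+ 2.
      by rewrite [leRHS]exprMn; apply: ler_wpM2l; [exact: sqr_ge0|nra].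
    have : (k * (1 + q)) ^+ 2 <= (2 * h) ^+ 2.
      have kq0 : 0 <= k * (1 + q) by rewrite mulr_ge0 ?addr_ge0// ltW.
      by rewrite ler_pXn2r// nnegrE//; lra.
    have : h * h <= C0 * h by rewrite ler_pM2r.
    nra.
  by rewrite /K; lra.
have zpsi : dotv (x' - y') (x' - y') <= psi ^+ 2.
  by rewrite psi2 lerDl mulr_ge0 ?expR_ge0// ltW.
have gx := gradient_error psi0 (ltW k0) zpsi gxE.
have gy := gradient_error psi0 (ltW k0) zpsi gyE.
have yyN : dotv (- y') (- y') = dotv y' y'.
  by rewrite -scaleN1r dotvZl dotvZr; ring.
have dz : dotv (x' - y') (x' - y') = psi ^+ 2 - d * expR (C * t') by rewrite psi2; ring.
have time := touch_time t'0 Hlt.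
(* The speeds sqrt(a X) and sqrt(a Y) have the diffusion coefficients as squares. The sum over the
   axes turns 1 / psi into N / psi and the z_i^2 into |z|^2. *)
have Lap : a X * laplacian v (x', t') - a Y * laplacian v (y', t') <=
    M * (sA - sB) ^+ 2 * (N%:R / psi - (psi ^+ 2 - d * expR (C * t')) / psi ^+ 3)
    + 4 * N%:R * Ca * h.
  have le_i i : a X * dx i (dx i v) (x', t') - a Y * dx i (dx i v) (y', t') <=
      M * (sA - sB) ^+ 2 * (1 / psi - (x' - y') ord0 i ^+ 2 / psi ^+ 3) + k * (a X + a Y).
    have [_] := touch_space sA sB i t'0 Hle.
    by rewrite sA2 sB2 -/psi -/E -/k -addrA -opprD subr_le0.
  have sum_i : \sum_(i < N) (M * (sA - sB) ^+ 2 *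
      (1 / psi - (x' - y') ord0 i ^+ 2 / psi ^+ 3) + k * (a X + a Y)) =
      M * (sA - sB) ^+ 2 * (N%:R / psi - dotv (x' - y') (x' - y') / psi ^+ 3)
      + N%:R * (k * (a X + a Y)).
    rewrite big_split/= -mulr_sumr sumrB !sumr_const card_ord -mulr_suml.
    by rewrite -[1 / psi *+ N]mulr_natl mulrA mulr1 -[X in _ + X]mulr_natl.
  rewrite /laplacian !mulr_sumr -sumrB; apply: (le_trans (ler_sum _ (fun i _ => le_i i))).
  rewrite sum_i -dz lerD2l.
  have kh : k <= 2 * h.
    by rewrite -khx; apply: ler_peMr; [exact: ltW|rewrite -addrA lerDl addr_ge0].
  have kab : k * (a X + a Y) <= 2 * h * (Ca + Ca).
    by apply: ler_pM; [exact: ltW|exact: addr_ge0|exact: kh|exact: lerD].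
  have -> : 4 * N%:R * Ca * h = N%:R * (2 * h * (Ca + Ca)) by ring.
  by apply: ler_wpM2l.
apply: (@touching_point_absurd _ N%:R M psi (d * expR (C * t')) (Num.sqrt d)
  (a X) (a Y) ((sA - sB) ^+ 2) (X - Y) (b Y - b X) h C0 C1 C2 Ca Cb (b X) (b Y)
  (laplacian v (x', t')) (laplacian v (y', t'))
  (dotv (grad v (x', t')) (grad v (x', t'))) (dotv (grad v (y', t')) (grad v (y', t')))
  (F t' X) (F t' Y) Lam K) => //.
- rewrite ler_wsqrtr// (le_trans _ (_ : d * expR (C * t') <= _))//.
    by rewrite ler_peMr ?exp1// ltW.
  by rewrite /rho lerDr dotv_ge0.
- by rewrite mulr_gt0// expR_gt0.
- by rewrite psi2 lerDr dotv_ge0.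
- by rewrite sqr_ge0.
- by rewrite -dz; apply: (le_trans gx); apply: err => //; rewrite lerDl.
- by rewrite -dz; apply: (le_trans gy); rewrite yyN; apply: err => //; rewrite lerDr.
- exact: kF.
- by rewrite LamE ltrDl.
- by move: time; rewrite !pde.
Qed.

End barrier.
Lemma lipschitz_propagation x y t : 0 <= t ->
  v (x, t) - v (y, t) <= M * enorm (x - y).
Proof.
move=> t0; apply/ler_addgt0Pr => e e0.
pose E := expR (C * t); have E0 : 0 < E by exact: expR_gt0.
(* Makes sqrt(d E) = e / M, so that removing [d] costs at most [e]. *)
pose d := (e / M) ^+ 2 / E.
have d0 : 0 < d by rewrite divr_gt0// exprn_gt0// divr_gt0.
apply: (@le_trans _ _ (M * Num.sqrt (dotv (x - y) (x - y) + d * E))); last first.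
  have -> : M * enorm (x - y) + e = M * (enorm (x - y) + e / M).
    by field; rewrite gt_eqF.
  rewrite ler_pM2l// -(@ler_pXn2r _ 2) ?nnegrE ?sqrtr_ge0//; last first.
    by rewrite addr_ge0 ?enorm_ge0// divr_ge0// ltW.
  rewrite sqr_sqrtr; last by rewrite addr_ge0 ?dotv_ge0// mulr_ge0 ?ltW.
  rewrite /d divfK ?gt_eqF// sqrrD enorm_sqr -addrA [_ *+ 2 + _]addrC addrA lerDl.
  by rewrite mulrn_wge0// mulr_ge0 ?enorm_ge0// divr_ge0// ltW.
(* [Lam] depends on [d], so the weight e' / B of the penalty is sent to 0 with [d] already fixed. *)
apply/ler_addgt0Pr => e' e'0.
have [Lam LamE] : exists Lam : R, Lam = 4 * N%:R * Ca +
  2 * Cb * (2 * M * N%:R + 4 * (m2 - m1)) + M * C2 * (m2 - m1) / Num.sqrt d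
  + 2 * M * C1 * (m2 - m1) / Num.sqrt d + C2 * M ^+ 2 + 1 by exact: ex_intro.
pose B := expR (Lam * t) * (1 + dotv x x + dotv y y).
have B0 : 0 < B.
  by rewrite mulr_gt0 ?expR_gt0// -addrA ltr_pwDl// addr_ge0 ?dotv_ge0.
have := doubling_barrier d0 (divr_gt0 e'0 B0) LamE x y t0.
by rewrite -/B (divfK (lt0r_neq0 B0)) => /ltW.
Qed.

End doubling.

(** * Inequalities for real powers *)

Section real_powers.
Context {R : realType}.
Implicit Types (p q r x y : R).

Lemma le0_ler_powR r x y : r <= 0 -> 0 < x -> x <= y -> y `^ r <= x `^ r.
Proof.
move=> r0 x0 xy; have y0 := lt_le_trans x0 xy.
rewrite -(opprK r) !(powRN _ (- r)) lef_pV2 ?posrE ?powR_gt0//.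
by rewrite ge0_ler_powR ?nnegrE ?oppr_ge0 ?(ltW x0) ?(ltW y0).
Qed.

(** A sum instead of a maximum spares later proofs a split on the sign of the exponent. *)
Lemma powR_le_endpoints r (m1 m2 x : R) : 0 < m1 -> m1 <= x <= m2 ->
  x `^ r <= m1 `^ r + m2 `^ r.
Proof.
move=> m10 /andP[mx xm]; have x0 := lt_le_trans m10 mx.
have [r0|r0] := leP 0 r.
  rewrite ler_wpDl ?powR_ge0// ge0_ler_powR// nnegrE ltW//.
  exact: lt_le_trans xm.
by rewrite ler_wpDr ?powR_ge0// le0_ler_powR// ltW.
Qed.

Lemma powR_mean_value r x y : 0 < y -> y < x -> exists2 c, y <= c <= x &
  x `^ r - y `^ r = r * c `^ (r - 1) * (x - y).
Proof.
move=> y0 yx.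
have D (c : R) : 0 < c -> is_derive c 1 (fun u : R => u `^ r) (r * c `^ (r - 1)).
  by move=> c0; exact: is_derive1_powR.
have [c|c|c cI E] := @MVT R (fun u : R => u `^ r) (fun c => r * c `^ (r - 1)) y x yx.
- by rewrite in_itv/= => /andP[yc _]; apply: D; exact: lt_trans yc.
- apply: derivable_within_continuous c => c; rewrite in_itv/= => /andP[yc _].
  by have [] := D c (lt_le_trans y0 yc).
by exists c => //; move: cI; rewrite in_itv/= => /andP[/ltW -> /ltW ->].
Qed.

Lemma powR_lipschitz r (m1 m2 : R) : 0 < m1 -> exists2 L, 0 <= L &
  forall x y, m1 <= y -> y < x -> x <= m2 -> `|x `^ r - y `^ r| <= L * (x - y).
Proof.
move=> m10; exists (`|r| * (m1 `^ (r - 1) + m2 `^ (r - 1))).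
  by rewrite mulr_ge0// addr_ge0 ?powR_ge0.
move=> x y my yx xm.
have [c /andP[yc cx] ->] := powR_mean_value r (lt_le_trans m10 my) yx.
rewrite normrM (gtr0_norm (_ : 0 < x - y)) ?subr_gt0// ler_wpM2r ?subr_ge0 ?(ltW yx)//.
rewrite normrM ler_wpM2l// ger0_norm ?powR_ge0// powR_le_endpoints//.
by rewrite (le_trans my yc) (le_trans cx xm).
Qed.

(* Cauchy-Schwarz for the integrals over [y, x] of u^(q/2-1) and of its square,
   read off from the monotonicity in u of a primitive of (l - (q/2) u^(q/2-1))^2
   at the optimal l. *)
Lemma powR_cauchy_schwarz q x y : q != 1 -> 0 < y -> y < x ->
  (x `^ (q / 2) - y `^ (q / 2)) ^+ 2 <=
  q ^+ 2 / 4 * ((x `^ (q - 1) - y `^ (q - 1)) / (q - 1)) * (x - y).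
Proof.
move=> q1 y0 yx.
have q1' : q - 1 != 0 by rewrite subr_eq0.
have xy0 : 0 < x - y by rewrite subr_gt0.
pose l := (x `^ (q / 2) - y `^ (q / 2)) / (x - y).
pose h (u : R) := l ^+ 2 * u - (2 * l) * u `^ (q / 2) + (q ^+ 2 / 4 / (q - 1)) * u `^ (q - 1).
have dh (c : R) : 0 < c -> is_derive c 1 h ((l - q / 2 * c `^ (q / 2 - 1)) ^+ 2).
  move=> c0.
  have D1 : is_derive c 1 (fun u : R => u `^ (q / 2)) (q / 2 * c `^ (q / 2 - 1)).
    exact: is_derive1_powR.
  have D2 : is_derive c 1 (fun u : R => u `^ (q - 1)) ((q - 1) * c `^ (q - 1 - 1)).
    exact: is_derive1_powR.
  have := is_deriveD (is_deriveB (is_deriveZ (l ^+ 2) (is_derive_id c 1))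
    (is_deriveZ (2 * l) D1)) (is_deriveZ (q ^+ 2 / 4 / (q - 1)) D2).
  move=> /is_derive_eq; apply; rewrite /GRing.scale/= mulr1.
  have -> : c `^ (q - 1 - 1) = c `^ (q / 2 - 1) ^+ 2.
    rewrite expr2 -powRD; last by rewrite (gt_eqF c0) implybT.
    by congr (_ `^ _); field.
  by field.
have [c|c|c] := @MVT R h (fun c => (l - q / 2 * c `^ (q / 2 - 1)) ^+ 2) y x yx.
- by rewrite in_itv/= => /andP[yc _]; apply: dh; exact: lt_trans yc.
- apply: derivable_within_continuous c => c; rewrite in_itv/= => /andP[yc _].
  by have [] := dh c (lt_le_trans y0 yc).
move=> _ E; have {E} : 0 <= h x - h y by rewrite E mulr_ge0 ?sqr_ge0// ltW.
have -> : h x - h y = l ^+ 2 * (x - y) - 2 * l * (x `^ (q / 2) - y `^ (q / 2)) +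
    q ^+ 2 / 4 * ((x `^ (q - 1) - y `^ (q - 1)) / (q - 1)).
  by rewrite /h; field.
have -> : x `^ (q / 2) - y `^ (q / 2) = l * (x - y) by rewrite /l divfK// gt_eqF.
move=> H; rewrite -subr_ge0.
rewrite (_ : _ - _ = (l ^+ 2 * (x - y) - 2 * l * (l * (x - y)) +
  q ^+ 2 / 4 * ((x `^ (q - 1) - y `^ (q - 1)) / (q - 1))) * (x - y)).
  by rewrite mulr_ge0// ltW.
by field.
Qed.

(** Let J be the integral of u^(q-2) over [y, x]. Cauchy-Schwarz bounds the left side by (n - 1)
    (q^2 / 4) J (x - y); since q (1 - p) = q - 1, the right side equals q^2 (gamma - (1 - p)) (1 -
    p) J (x - y). The condition on [p] is exactly the comparison of the two coefficients. *)
Lemma powR_key_inequality (n gamma p q c x y : R) : q = p^-1 ->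
  c = (1 - p - gamma) / p -> 1 <= n -> p != 0 -> p < 1 ->
  n - 1 + 4 * (p - 1) ^+ 2 + 4 * gamma * (p - 1) <= 0 ->
  0 < y -> y < x ->
  (n - 1) * (Num.sqrt (x `^ q) - Num.sqrt (y `^ q)) ^+ 2 <=
    (c * y `^ (q - 1) - c * x `^ (q - 1)) * (x - y).
Proof.
move=> qE cE n1 p0 p1 cond y0 yx.
have q1 : q != 1 by rewrite qE invr_eq1 lt_eqF.
have x0 := lt_trans y0 yx.
have sq z : Num.sqrt (z `^ q) = z `^ (q / 2).
  by rewrite -powR12_sqrt ?powR_ge0// -powRrM.
rewrite !sq.
set J := (x `^ (q - 1) - y `^ (q - 1)) / (q - 1).
have := powR_cauchy_schwarz q1 y0 yx; rewrite -/J.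
set S := (_ - _) ^+ 2 => SJ.
have qp : q * p = 1 by rewrite qE mulVf.
have S0 : 0 <= S by rewrite sqr_ge0.
have xy0 : 0 < x - y by rewrite subr_gt0.
have q2 : 0 < q ^+ 2 by rewrite exprn_even_gt0//= qE invr_eq0.
have J0 : 0 <= J * (x - y).
  have := le_trans S0 SJ; rewrite -mulrA pmulr_rge0//.
  by rewrite divr_gt0.
have -> : (c * y `^ (q - 1) - c * x `^ (q - 1)) * (x - y) =
    q ^+ 2 * (((gamma - (1 - p)) * (1 - p)) * (J * (x - y))).
  have -> : q ^+ 2 * (((gamma - (1 - p)) * (1 - p)) * (J * (x - y))) =
    (gamma - (1 - p)) * q * (q * (1 - p)) * J * (x - y) by ring.
  have -> : q * (1 - p) = q - 1 by rewrite mulrBr mulr1 qp.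
  have q1' : q - 1 != 0 by rewrite subr_eq0.
  have -> : (gamma - (1 - p)) * q = - c by rewrite cE qE; field.
  by rewrite /J; field.
have {}n1 : 0 <= n - 1 by rewrite subr_ge0.
have : (n - 1) * S <= (n - 1) * (q ^+ 2 / 4 * J * (x - y)) by rewrite ler_wpM2l.
move=> /le_trans; apply.
rewrite (_ : (n - 1) * _ = q ^+ 2 * ((n - 1) / 4 * (J * (x - y)))); last by field.
by rewrite ler_pM2l// ler_wpM2r//; lra.
Qed.

End real_powers.

(** * The equation satisfied by the regularized power *)

Section C21_composition.
Context {R : realType} {N : nat}.
Variables (u : 'rV[R]_N * R -> R) (g g1 g2 : R -> R).
Hypothesis C21 : C21_Omega u.
Hypothesis dg : forall z, Omega z -> is_derive (u z) 1 g (g1 (u z)).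
Hypothesis dg1 : forall z, Omega z -> is_derive (u z) 1 g1 (g2 (u z)).
Hypothesis cg2 : forall z, Omega z -> {for u z, continuous g2}.

Lemma near_Omega (z : 'rV[R]_N * R) : Omega z -> \forall y \near z, Omega y.
Proof.
move=> Oz; have : (y.2 @[y --> z] --> z.2)%classic by exact: cvg_snd.
by move=> /cvgr_gt; apply.
Qed.

Lemma is_derive_dt_comp z : Omega z ->
  is_derive z dt_dir (g \o u) (g1 (u z) * dt u z).
Proof.
move=> Oz; apply: is_derive_comp1; last exact: dg.
by apply: derivableP; have [_ []] := C21 Oz.
Qed.

Lemma is_derive_dx_comp z i : Omega z ->
  is_derive z (dx_dir i) (g \o u) (g1 (u z) * dx i u z).
Proof.
move=> Oz; apply: is_derive_comp1; last exact: dg.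
by apply: derivableP; have [_ _ /(_ i)[]] := C21 Oz.
Qed.

Lemma dt_compE z : Omega z -> dt (g \o u) z = g1 (u z) * dt u z.
Proof. by move=> Oz; have [_ <-] := is_derive_dt_comp Oz. Qed.

Lemma dx_compE z i : Omega z -> dx i (g \o u) z = g1 (u z) * dx i u z.
Proof. by move=> Oz; have [_ <-] := is_derive_dx_comp i Oz. Qed.

Lemma is_derive_dxdx_comp z i j : Omega z ->
  is_derive z (dx_dir j) (dx i (g \o u))
    (g2 (u z) * dx j u z * dx i u z + g1 (u z) * dx j (dx i u) z).
Proof.
move=> Oz.
have D1 : is_derive z (dx_dir j) (g1 \o u) (g2 (u z) * dx j u z).
  apply: is_derive_comp1; last exact: dg1.
  by apply: derivableP; have [_ _ /(_ j)[]] := C21 Oz.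
have D2 : is_derive z (dx_dir j) (dx i u) (dx j (dx i u) z).
  by apply: derivableP; have [_ _ _ /(_ i j)[]] := C21 Oz.
(* The first-order formula holds on [Omega] only, which is enough because [Omega] is a neighbourhood
   of [z]. *)
apply: (@near_eq_is_derive _ _ _ (fun y => g1 (u y) * dx i u y)).
  by apply: filterS (near_Omega Oz) => y Oy; rewrite dx_compE.
have := is_deriveM D1 D2.
by move=> /is_derive_eq; apply; rewrite addrC; congr (_ + _); exact: mulrC.
Qed.

Lemma dxdx_compE z i j : Omega z -> dx j (dx i (g \o u)) z =
  g2 (u z) * dx j u z * dx i u z + g1 (u z) * dx j (dx i u) z.
Proof. by move=> Oz; have [_ <-] := is_derive_dxdx_comp i j Oz. Qed.

Lemma C21_Omega_comp : C21_Omega (g \o u).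
Proof.
move=> z Oz; have [cu [_ cdt] cdx cdxx] := C21 Oz.
have [cg cg1] : {for u z, continuous g} /\ {for u z, continuous g1}.
  split; apply/differentiable_continuous/derivable1_diffP.
    by have [] := dg Oz.
  by have [] := dg1 Oz.
have near_cts (h1 h2 : 'rV[R]_N * R -> R) : (forall y, Omega y -> h1 y = h2 y) ->
    {for z, continuous h2} -> {for z, continuous h1}.
  move=> h12 ch2; have : h1 y @[y --> z] --> h2 z.
    apply: cvg_trans ch2; apply: near_eq_cvg.
    by apply: filterS (near_Omega Oz) => y Oy; rewrite h12.
  by rewrite -(h12 _ Oz).
have cgu : {for z, continuous (g1 \o u)} by exact: continuous_comp.
have cg2u : {for z, continuous (g2 \o u)} by apply: continuous_comp => //; exact: cg2.
split.
- exact: continuous_comp.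
- split; first by have [] := is_derive_dt_comp Oz.
  apply: (near_cts _ (fun y => g1 (u y) * dt u y)); first exact: dt_compE.
  exact: (continuousM cgu cdt).
- move=> i; split; first by have [] := is_derive_dx_comp i Oz.
  apply: (near_cts _ (fun y => g1 (u y) * dx i u y)) => [y|]; first exact: dx_compE.
  exact: (continuousM cgu (cdx i).2).
- move=> i j; split; first by have [] := is_derive_dxdx_comp i j Oz.
  apply: (near_cts _ (fun y => g2 (u y) * dx j u y * dx i u y + g1 (u y) * dx j (dx i u) y)).
    by move=> y; exact: dxdx_compE.
  exact: (continuousD (continuousM (continuousM cg2u (cdx j).2) (cdx i).2)
    (continuousM cgu (cdxx i j).2)).
Qed.

Lemma laplacian_compE z : Omega z -> laplacian (g \o u) z =
  g2 (u z) * dotv (grad u z) (grad u z) + g1 (u z) * laplacian u z.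
Proof.
move=> Oz; rewrite /laplacian /dotv !mulr_sumr -big_split; apply: eq_bigr => i _.
by rewrite dxdx_compE// !mxE mulrA.
Qed.

Lemma dotv_grad_compE z : Omega z -> dotv (grad (g \o u) z) (grad (g \o u) z) =
  g1 (u z) ^+ 2 * dotv (grad u z) (grad u z).
Proof.
move=> Oz; rewrite /dotv mulr_sumr; apply: eq_bigr => i _.
by rewrite !mxE dx_compE//; ring.
Qed.

End C21_composition.

Section regularized_power.
Context {R : realType} {N : nat}.
Variables (gamma eps p : R) (f : R -> R -> R) (u0 : 'rV[R]_N -> R)
  (u : 'rV[R]_N * R -> R).
Hypotheses (eps0 : 0 < eps) (p0 : p != 0) (p1 : p < 1).
Hypothesis sol : classical_solution gamma f u0 eps u.
Hypothesis u_ge0 : forall z, cOmega z -> 0 <= u z.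
Hypothesis u0b : exists K, forall x, `|u0 x| <= K.
Hypothesis f_ge0 : forall t v, 0 < t -> 0 <= f t v.
Hypothesis f_decr : forall t v w, 0 < t -> v <= w -> f t w <= f t v.

Let g (y : R) := (y + eps) `^ p.
Let g1 (y : R) := p * (y + eps) `^ (p - 1).
Let g2 (y : R) := p * ((p - 1) * (y + eps) `^ (p - 1 - 1)).

Let is_derive_shifted_powR (r y : R) : 0 <= y ->
  is_derive y 1 (fun s : R => (s + eps) `^ r) (r * (y + eps) `^ (r - 1)).
Proof.
move=> y0; have ye : 0 < y + eps by rewrite ltr_wpDl.
have D1 : is_derive (y + eps) 1 (fun u : R => u `^ r) (r * (y + eps) `^ (r - 1)).
  exact: is_derive1_powR.
have D2 : is_derive y 1 (fun s : R => s + eps) 1.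
  by have := is_deriveD (is_derive_id y (1 : R)) (is_derive_cst eps y 1); rewrite addr0.
by have := @is_derive1_comp _ (fun u : R => u `^ r) (fun s => s + eps) y _ _ D1 D2; rewrite mulr1.
Qed.

Lemma OmegaW (z : 'rV[R]_N * R) : Omega z -> cOmega z.
Proof. exact: ltW. Qed.

Let dg z : Omega z -> is_derive (u z) 1 g (g1 (u z)).
Proof. by move=> Oz; apply/is_derive_shifted_powR/u_ge0/OmegaW. Qed.

Let dg1 z : Omega z -> is_derive (u z) 1 g1 (g2 (u z)).
Proof.
move=> Oz; apply: is_deriveZ.
exact/is_derive_shifted_powR/u_ge0/OmegaW.
Qed.

Let cg2 z : Omega z -> {for u z, continuous g2}.
Proof.
move=> Oz; apply/differentiable_continuous/derivable1_diffP.
have [d _] := is_deriveZ p (is_deriveZ (p - 1)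
  (is_derive_shifted_powR (p - 1 - 1) (u_ge0 (OmegaW Oz)))).
exact: d.
Qed.

Definition powR_eps (z : 'rV[R]_N * R) : R := (u z + eps) `^ p.

Lemma C21_Omega_powR_eps : C21_Omega powR_eps.
Proof. by case: sol => C21 _ _ _ _; exact: (C21_Omega_comp C21 dg dg1 cg2). Qed.

Let q := p^-1.
Let c := (1 - p - gamma) / p.
Let W z : 0 < u z + eps -> powR_eps z `^ q = u z + eps.
Proof. by move=> w0; rewrite -powRrM mulfV// powRr1// ltW. Qed.

(** With w = u + eps, the term v^q Delta v contains p (p - 1) w^(p-1) |grad w|^2; taking it back and
    keeping the original term in - gamma gives the numerator 1 - p - gamma of [c]. *)
Lemma pde_powR_eps z : Omega z -> dt powR_eps z =
  powR_eps z `^ q * laplacian powR_eps z +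
  c * powR_eps z `^ (q - 1) * dotv (grad powR_eps z) (grad powR_eps z) +
  p * (powR_eps z `^ q) `^ (p - 1) * f z.2 (powR_eps z `^ q - eps).
Proof.
move=> Oz; have [C21 _ _ + _] := sol => /(_ z Oz) pde.
have w0 : 0 < u z + eps by rewrite ltr_wpDl// (u_ge0 (OmegaW Oz)).
have -> : dt powR_eps z = g1 (u z) * dt u z by exact: (dt_compE C21 dg).
have -> : laplacian powR_eps z = g2 (u z) * dotv (grad u z) (grad u z) +
   g1 (u z) * laplacian u z by exact: (laplacian_compE C21 dg dg1).
have -> : dotv (grad powR_eps z) (grad powR_eps z) =
  g1 (u z) ^+ 2 * dotv (grad u z) (grad u z) by exact: (dotv_grad_compE C21 dg).
rewrite W// pde addrK.
have q1 : powR_eps z `^ (q - 1) = (u z + eps) `^ (1 - p).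
  by rewrite -powRrM mulrBr mulfV// mulr1.
rewrite q1 /g1 /g2.
set w := u z + eps in w0 *; set G := dotv _ _; set L := laplacian u z.
have wn : w != 0 by rewrite gt_eqF.
have E1 : w `^ (p - 1) = w * w `^ (p - 1 - 1).
  by rewrite -[X in X * _]powRr1 ?(ltW w0)// -powRD ?(gt_eqF w0) ?implybT// addrCA subrr addr0.
have E2 : w `^ (1 - p) * w `^ (p - 1) = 1.
  by rewrite -powRD ?(gt_eqF w0) ?implybT// addrA subrK subrr powRr0.
have -> : c * w `^ (1 - p) * ((p * w `^ (p - 1)) ^+ 2 * G) =
   (1 - p - gamma) * p * (w `^ (1 - p) * w `^ (p - 1)) * w `^ (p - 1) * G.
  by rewrite /c; field.
rewrite E2 E1 /w; ring.
Qed.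

End regularized_power.

(** * A quadratic supersolution *)

Section quadratic_barrier.
Context {R : realType} {N : nat}.
Variables (v : 'rV[R]_N * R -> R) (a b : R -> R) (F : R -> R -> R) (m2 A B : R).
Hypothesis C21 : C21_Omega v.
Hypothesis cv : {within cOmega, continuous v}.
Hypothesis vm : forall z, cOmega z -> v z <= m2.
Hypothesis pde : forall z, Omega z -> dt v z = a (v z) * laplacian v z
  + b (v z) * dotv (grad v z) (grad v z) + F z.2 (v z).
Hypothesis abB : forall X, 1 <= X -> 0 <= a X <= 1 /\ `|b X| * X <= B.
Hypothesis F_le0 : forall t X, 0 < t -> F t X <= 0.
Hypothesis A1 : 1 <= A.
Hypothesis init : forall x, v (x, 0) < A * (1 + dotv x x).

(** At a first contact the value X is at least 1, where [abB] applies; the Laplacian is at most 2 N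
    X and the squared gradient at most 4 X^2, so a growth rate above 2 N + 4 B contradicts the
    equation. [m2] confines the contact to a compact set but stays out of the bound: in the
    application it is eps^p, which blows up. *)
Lemma quadratic_barrier x t : 0 <= t ->
  v (x, t) <= A * expR ((2 * N%:R + 4 * B + 1) * t) * (1 + dotv x x).
Proof.
move=> tge0; rewrite leNgt; apply/negP => Hx.
set Lam := 2 * N%:R + 4 * B + 1 in Hx *.
have A0 : 0 < A by exact: lt_le_trans A1.
have N0 : 0 <= N%:R :> R by rewrite ler0n.
have B0 : 0 <= B.
  by have [_] := abB (lexx 1); apply: le_trans; rewrite mulr1.
have Lam0 : 0 <= Lam by rewrite /Lam; lra.
pose H (z : 'rV[R]_N * R) := v (z.1, Num.max z.2 0) -
  A * expR (Lam * z.2) * (1 + dotv z.1 z.1).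
have HE y s : 0 <= s -> H (y, s) = v (y, s) - A * expR (Lam * s) * (1 + dotv y y).
  by move=> s0; rewrite /H/= max_l.
have exp1 s : 0 <= s -> 1 <= expR (Lam * s).
  by move=> s0; rewrite -expR0 ler_expR mulr_ge0.
have Hc : continuous H.
  move=> z; apply: (continuousB (continuous_max0 cv (x := z))).
  have c2 : {for z, continuous (fun z : 'rV[R]_N * R => z.2)} by exact: cvg_snd.
  have c1 : {for z, continuous (fun z : 'rV[R]_N * R => z.1)} by exact: cvg_fst.
  have ce : {for z, continuous (fun z : 'rV[R]_N * R => expR (Lam * z.2))}.
    apply: (@continuous_comp ('rV[R]_N * R)%type R R (fun z => Lam * z.2) expR).
      exact: (continuousM (cvg_cst Lam) c2).
    exact: continuous_expR.
  exact: (continuousM (continuousM (cvg_cst A) ce)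
    (continuousD (cvg_cst (1 : R)) (continuous_dotv c1 c1))).
have [K cK Kin] := compact_dotv_le (n := N) (R := R) m2.
have Kb y s : 0 <= s <= t -> 0 <= H (y, s) -> K y.
  move=> /andP[s0 _]; rewrite HE// => Hge; apply: Kin.
  have := vm (z := (y, s)) s0; have := dotv_ge0 y.
  have : 1 * (1 + dotv y y) <= A * expR (Lam * s) * (1 + dotv y y).
    apply: ler_wpM2r; first by rewrite addr_ge0// dotv_ge0.
    by rewrite -[1]mulr1; apply: ler_pM => //; exact: exp1.
  lra.
have H0 y : H (y, 0) < 0 by rewrite HE// mulr0 expR0 mulr1 subr_lt0.
have Hxt : 0 <= H (x, t) by rewrite HE// subr_ge0 ltW.
have [y [s [/andP[s0 _] HE0 Hle Hlt]]] := first_touch cK Hc Kb H0 tge0 Hxt.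
have sge0 := ltW s0.
move: HE0; rewrite HE// => /eqP; rewrite subr_eq0 => /eqP XE.
pose E := expR (Lam * s); pose X := v (y, s).
have E1 : 1 <= E by exact: exp1.
have yy := dotv_ge0 y.
have AE1 : 1 <= A * E by rewrite -[1]mulr1; apply: ler_pM.
have AEX : A * E <= X by rewrite /X XE ler_peMr ?lerDl//; lra.
have X1 : 1 <= X by exact: le_trans AEX.
have [/andP[aX0 aX1] bX] := abB X1.
have space i : dx i v (y, s) = 2 * A * E * y ord0 i /\ dx i (dx i v) (y, s) <= 2 * A * E.
  pose e : 'rV[R]_N := delta_mx ord0 i.
  (* The one-point case of the test: second function 0, and 1 as a dummy under the square root. *)
  have pos (r : R) : 0 < 1 + 0 * r + 0 * r ^+ 2 by rewrite !mul0r !addr0.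
  have mx (r : R) : v (y + (r * 1) *: e, s) - 0 - 0 * Num.sqrt (1 + 0 * r + 0 * r ^+ 2)
      - (A * E * (1 + dotv y y) + (2 * A * E * y ord0 i) * r + A * E * r ^+ 2) <=
      v (y + (0 * 1) *: e, s) - 0 - 0 * Num.sqrt 1 - A * E * (1 + dotv y y).
    rewrite !mul0r scale0r !addr0 !subr0 XE subrr mulr1.
    have := Hle (y + r *: e); rewrite HE// dotv_add_delta -/E.
    by apply: le_trans; rewrite le_eqVlt; apply/orP; left; apply/eqP; ring.
  have [g1 g2] := second_derivative_test_sqrt
    (fun r => C21_Omega_dx y i 1 r C21 s0) (fun r => is_derive_cst (0 : R) r 1)
    (C21_Omega_dxx y i 1 C21 s0) (is_derive_cst (0 : R) (0 : R) 1) pos mx.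
  move: g1 g2; rewrite !mul0r scale0r !addr0 !subr0 !mul1r expr1n mul1r => g1 g2.
  by split; [exact: subr0_eq|move: g2; rewrite subr_le0 mulrA].
have time : 0 <= dt v (y, s) - Lam * X.
  pose h w := v (y, w) - A * expR (Lam * w) * (1 + dotv y y).
  have D : is_derive s 1 h (dt v (y, s) - Lam * X).
    have := is_deriveB (C21_Omega_dt y C21 s0)
      (is_deriveZ (A * (1 + dotv y y)) (is_derive_expR_scale Lam s)).
    rewrite (_ : _ - _ = h); last first.
      by apply/funext => w; rewrite /h /= -mulrA (mulrC (expR _)) mulrA.
    by move=> /is_derive_eq; apply; rewrite /X XE /GRing.scale/=; ring.
  apply: (left_max_derive_ge0 s0 D) => r rI; have r0 := (andP rI).1.
  by rewrite {2}/h XE subrr /h -HE// ltW// Hlt.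
have lap : laplacian v (y, s) <= 2 * N%:R * X.
  apply: (@le_trans _ _ (\sum_(i < N) 2 * A * E)).
    by apply: ler_sum => i _; have [] := space i.
  rewrite sumr_const card_ord -mulr_natl.
  have : N%:R * (A * E) <= N%:R * X by rewrite ler_wpM2l.
  lra.
have gradE : dotv (grad v (y, s)) (grad v (y, s)) = 4 * (A * E) ^+ 2 * dotv y y.
  rewrite /dotv mulr_sumr; apply: eq_bigr => i _.
  by rewrite !mxE (space i).1; ring.
have grad_le : dotv (grad v (y, s)) (grad v (y, s)) <= 4 * X ^+ 2.
  have -> : 4 * X ^+ 2 = 4 * (A * E) ^+ 2 * (1 + dotv y y) ^+ 2.
    by rewrite /X XE -/E; ring.
  rewrite gradE ler_wpM2l//; last by nra.
  by rewrite mulr_ge0// sqr_ge0.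
have t1 : a X * laplacian v (y, s) <= 2 * N%:R * X.
  apply: (@le_trans _ _ (a X * (2 * N%:R * X))); first by rewrite ler_wpM2l.
  by rewrite ler_piMl// mulr_ge0 ?mulr_ge0//; lra.
have t2 : b X * dotv (grad v (y, s)) (grad v (y, s)) <= 4 * B * X.
  apply: (@le_trans _ _ (`|b X| * (4 * X ^+ 2))).
    apply: (@le_trans _ _ (`|b X| * dotv (grad v (y, s)) (grad v (y, s)))).
      by rewrite ler_wpM2r ?dotv_ge0// ler_norm.
    by rewrite ler_wpM2l.
  have : `|b X| * X * X <= B * X by rewrite ler_wpM2r//; lra.
  lra.
have t3 : F s X <= 0 by exact: F_le0.
move: time; apply/negP; rewrite -ltNge pde// -/X /= /Lam.
lra.
Qed.

End quadratic_barrier.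

(** * Estimates for the regularized power *)

Section regularized_estimates.
Context {R : realType} {N : nat}.
Variables (gamma eps p : R) (f : R -> R -> R) (u0 : 'rV[R]_N -> R)
  (u : 'rV[R]_N * R -> R).
Hypotheses (eps0 : 0 < eps) (p0 : p != 0) (p1 : p < 1).
Hypothesis sol : classical_solution gamma f u0 eps u.
Hypothesis u_ge0 : forall z, cOmega z -> 0 <= u z.
Hypothesis u0b : exists K, forall x, `|u0 x| <= K.
Hypothesis f_ge0 : forall t v, 0 < t -> 0 <= f t v.
Hypothesis f_decr : forall t v w, 0 < t -> v <= w -> f t w <= f t v.

Let v := powR_eps eps p u.
Let q := p^-1.
Let c := (1 - p - gamma) / p.

(** The definition of a classical solution bounds it at positive times; the initial datum supplies t
    = 0. *)
Let u_bounded : exists K, forall z, cOmega z -> u z <= K.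
Proof.
have [_ _ [K1 uK1] _ ui] := sol; have [K2 uK2] := u0b.
exists (Num.max K1 K2) => -[x t] /=; rewrite /cOmega/= le_eqVlt => /predU1P[<-|t0].
  by rewrite ui le_max (le_trans (ler_norm _) (uK2 x)) orbT.
by rewrite le_max (le_trans (ler_norm _) (uK1 _ _)).
Qed.

Let v_bounds : exists m, [/\ 0 < m.1, m.1 <= m.2 &
  forall z, cOmega z -> m.1 <= v z <= m.2].
Proof.
have [K uK] := u_bounded.
have K0 : 0 <= K by apply: le_trans (uK 0 _); [apply: u_ge0|]; exact: lexx.
have Ke : 0 < K + eps by rewrite ltr_wpDl.
have ue z : cOmega z -> eps <= u z + eps <= K + eps.
  by move=> Oz; rewrite lerDr u_ge0//= lerD2r uK.
have Kee : eps <= K + eps by rewrite lerDr.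
have [pp|pp] := leP 0 p.
  exists (eps `^ p, (K + eps) `^ p); split => /=.
  - exact: powR_gt0.
  - by rewrite ge0_ler_powR// nnegrE ltW.
  move=> z /ue /andP[h1 h2]; have h3 := lt_le_trans eps0 h1.
  by rewrite !ge0_ler_powR// nnegrE ltW.
exists ((K + eps) `^ p, eps `^ p); split => /=.
- exact: powR_gt0.
- by rewrite le0_ler_powR// ltW.
move=> z /ue /andP[h1 h2]; have h3 := lt_le_trans eps0 h1.
by rewrite !le0_ler_powR// ltW.
Qed.

Let continuous_v : {within cOmega, continuous v}.
Proof.
have [_ /subspace_continuousP cu _ _ _] := sol.
apply/subspace_continuousP => z Oz.
have ue : 0 < u z + eps by rewrite ltr_wpDl// u_ge0.
have cp : {for u z + eps, continuous (fun y : R => y `^ p)}.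
  apply/differentiable_continuous/derivable1_diffP.
  by have [] := is_derive1_powR p ue.
apply: (@cvg_comp _ _ _ (fun z => u z + eps) (fun y => y `^ p) _ (nbhs (u z + eps))).
  by apply: cvgD; [exact: cu|exact: cvg_cst].
exact: cp.
Qed.

Lemma powR_eps_lipschitz (M : R) : (1 <= N)%N -> 0 < M ->
  N%:R - 1 + 4 * (p - 1) ^+ 2 + 4 * gamma * (p - 1) <= 0 ->
  (forall x y, v (x, 0) - v (y, 0) <= M * enorm (x - y)) ->
  forall x y t, 0 <= t -> v (x, t) - v (y, t) <= M * enorm (x - y).
Proof.
move=> N1 M0 cond init.
have [[m1 m2] /= [m10 m12 vm]] := v_bounds.
have [L1 L10 lip1] := powR_lipschitz (q / 2) m2 m10.
have [L2 L20 lip2] := powR_lipschitz (q - 1) m2 m10.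
have sq z : Num.sqrt (z `^ q) = z `^ (q / 2).
  by rewrite -powR12_sqrt ?powR_ge0// -powRrM.
have C21 : C21_Omega v := C21_Omega_powR_eps p eps0 sol u_ge0.
have pde := pde_powR_eps eps0 p0 sol u_ge0.
apply: (@lipschitz_propagation R N v (fun X => X `^ q) (fun X => c * X `^ (q - 1))
  (fun t X => p * (X `^ q) `^ (p - 1) * f t (X `^ q - eps)) m1 m2 M
  (L1 ^+ 2) (`|c| * L2) (m1 `^ q + m2 `^ q)
  (`|c| * (m1 `^ (q - 1) + m2 `^ (q - 1)))) => //.
- exact: sqr_ge0.
- exact: mulr_ge0.
- move=> X Xm; rewrite powR_ge0/= powR_le_endpoints//; split=> //.
  by rewrite normrM ler_wpM2l// ger0_norm ?powR_ge0// powR_le_endpoints.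
move=> X Y mY YX Xm; have Y0 := lt_le_trans m10 mY; have X0 := lt_trans Y0 YX.
split.
- by apply: (powR_key_inequality (p := p) (gamma := gamma)) => //; rewrite ler1n.
- rewrite !sq -exprMn -real_normK ?num_real// ler_pXn2r ?nnegrE ?normr_ge0 ?lip1//.
  by rewrite mulr_ge0// subr_ge0 ltW.
- rewrite -mulrBr (le_trans (ler_norm _))// normrM -mulrA ler_wpM2l//.
  by rewrite distrC lip2.
move=> t t0.
have Xq := powR_gt0 q X0; have Yq := powR_gt0 q Y0.
(* The source is p w^(p-1) f(t, w - eps) with w = X^q, and w^(p-1) f(t, w - eps) is nonincreasing in
   w as a product of nonnegative factors. For positive [p], w increases with X; for negative [p] it
   decreases, and the sign of the factor [p] restores the order. *)
have [pp|pp] := ltP 0 p.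
  have q0 : 0 <= q by rewrite invr_ge0 ltW.
  have XYq : Y `^ q <= X `^ q by rewrite ge0_ler_powR// ?nnegrE ltW.
  have Wle : (X `^ q) `^ (p - 1) <= (Y `^ q) `^ (p - 1).
    by rewrite le0_ler_powR// subr_le0 ltW.
  have fle : f t (X `^ q - eps) <= f t (Y `^ q - eps) by rewrite f_decr// lerD2r.
  rewrite -[leLHS]mulrA -[leRHS]mulrA (ler_pM2l pp).
  exact: (ler_pM (powR_ge0 _ _) (f_ge0 _ t0) Wle fle).
have pn : p < 0 by rewrite lt_neqAle p0.
have q0 : q <= 0 by rewrite invr_le0 ltW.
have XYq : X `^ q <= Y `^ q by rewrite le0_ler_powR// ltW.
have Wle : (Y `^ q) `^ (p - 1) <= (X `^ q) `^ (p - 1).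
  by rewrite le0_ler_powR// subr_le0 ltW.
have fle : f t (Y `^ q - eps) <= f t (X `^ q - eps) by rewrite f_decr// lerD2r.
rewrite -[leLHS]mulrA -[leRHS]mulrA (ler_nM2l pn).
exact: (ler_pM (powR_ge0 _ _) (f_ge0 _ t0) Wle fle).
Qed.

(** For negative [p] also q is negative, so on v >= 1 the diffusion coefficient is at most 1, the
    gradient coefficient times v at most |c|, and the source is nonpositive. These bounds do not
    involve [eps]. *)
Lemma powR_eps_barrier (A : R) : p < 0 -> 1 <= A ->
  (forall x, v (x, 0) < A * (1 + dotv x x)) ->
  forall x t, 0 <= t ->
    v (x, t) <= A * expR ((2 * N%:R + 4 * `|c| + 1) * t) * (1 + dotv x x).
Proof.
move=> pn A1 init.
have [[m1 m2] /= [m10 m12 vm]] := v_bounds.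
have C21 : C21_Omega v := C21_Omega_powR_eps p eps0 sol u_ge0.
have pde := pde_powR_eps eps0 p0 sol u_ge0.
have q0 : q <= 0 by rewrite invr_le0 ltW.
have Xq X : 1 <= X -> X `^ q <= 1.
  have q1 : (1 : R) `^ q = 1 by rewrite powR1.
  by move=> X1; rewrite -[leRHS]q1 le0_ler_powR.
apply: (@quadratic_barrier R N v (fun X => X `^ q) (fun X => c * X `^ (q - 1))
  (fun t X => p * (X `^ q) `^ (p - 1) * f t (X `^ q - eps)) m2 A `|c|) => //.
- by move=> z /vm /andP[].
- move=> X X1; rewrite powR_ge0 Xq//; split=> //.
  have X0 : 0 < X by exact: lt_le_trans X1.
  rewrite normrM (ger0_norm (powR_ge0 _ _)) -mulrA.
  rewrite -[X in _ * (_ * X)]powRr1 ?(ltW X0)// -powRD ?(gt_eqF X0) ?implybT//.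
  by rewrite subrK ler_piMr// Xq.
- by move=> t X t0; rewrite -mulrA nmulr_rle0// mulr_ge0 ?powR_ge0 ?f_ge0.
Qed.

End regularized_estimates.

(** * Integration over row vectors *)

Section row_boxes.
Context {R : realType}.

Definition row_box n (A : 'I_n -> set R) : set 'rV[R]_n :=
  [set x | forall i, A i (x ord0 i)].

Definition cube n (r : R) : set 'rV[R]_n := row_box (fun=> [set` `[- r, r]]).
Arguments cube n r : clear implicits.

Lemma measurable_row_box n (A : 'I_n -> set R) :
  (forall i, measurable (A i)) -> measurable (row_box A).
Proof.
move=> mA.
have -> : row_box A = \bigcap_(i in [set: 'I_n]) ((fun x : 'rV[R]_n => x ord0 i) @^-1` A i).
  by apply/seteqP; split => [x Ax i _|x Ax i]; exact: Ax.
apply: fin_bigcap_measurable => // i _.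
rewrite -[X in measurable X]setTI.
exact: (@measurable_coord _ (measurableTypeR R) n i measurableT _ (mA i)).
Qed.

Lemma row_lebesgue_boxS n (A : 'I_n.+1 -> set R) :
  (forall i, measurable (A i)) ->
  row_lebesgue n.+1 (row_box A) =
  (lebesgue_measure (A ord0) * row_lebesgue n (row_box (fun i => A (lift ord0 i))))%E.
Proof.
move=> mA /=; rewrite /row_lebesgue_step /pushforward.
rewrite (_ : @row_cons R n @^-1` _ = A ord0 `*` row_box (fun i => A (lift ord0 i))).
  rewrite product_measure1E //; [exact: mA|apply: measurable_row_box => i; exact: mA].
apply/seteqP; split => [[a v] /= Av|[a v] /= [Aa Av] i].
  split=> [|i] /=; first by have := Av ord0; rewrite mxE unlift_none.
  by have := Av (lift ord0 i); rewrite mxE liftK.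
by rewrite mxE; case: unliftP => [j|] ->.
Qed.

Lemma row_lebesgue_box_lty n (A : 'I_n -> set R) : (forall i, measurable (A i)) ->
  (forall i, lebesgue_measure (A i) < +oo)%E -> (row_lebesgue n (row_box A) < +oo)%E.
Proof.
elim: n A => [|n IHn] A mA Aoo.
  by rewrite /= diracE; case: (_ \in _); exact: ltry.
rewrite row_lebesgue_boxS// lte_mul_pinfty//.
- by rewrite ge0_fin_numE.
- exact: IHn.
Qed.

Lemma row_lebesgue_box_gt0 n (A : 'I_n -> set R) : (forall i, measurable (A i)) ->
  (forall i, 0 < lebesgue_measure (A i))%E -> (0 < row_lebesgue n (row_box A))%E.
Proof.
elim: n A => [|n IHn] A mA A0.
  by rewrite /= diracE mem_set ?lte01// => -[].
by rewrite row_lebesgue_boxS// mule_gt0//; exact: IHn.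
Qed.

Lemma measurable_cube n r : measurable (cube n r).
Proof. by apply: measurable_row_box => i; exact: measurable_itv. Qed.

Lemma cube_lty n r : (row_lebesgue n (cube n r) < +oo)%E.
Proof.
apply: row_lebesgue_box_lty => i; first exact: measurable_itv.
by rewrite lebesgue_measure_itv/=; case: ifPn => // _; rewrite -EFinB ltry.
Qed.

Lemma compact_cube n r : compact (cube n r).
Proof. by apply: (@rV_compact R n (fun=> [set` `[- r, r]])) => i; exact: segment_compact. Qed.

Lemma row_ballP n (x y : 'rV[R]_n) (e : R) : 0 < e ->
  ball x e y <-> forall i, `|x ord0 i - y ord0 i| < e.
Proof.
move=> e0; split=> [[_ xy] i|xy]; first exact: xy.
by split=> // i j; rewrite (ord1 i); exact: xy.
Qed.

Lemma compact_sub_cube n (K : set 'rV[R]_n) : compact K -> exists2 r, 0 < r & K `<=` cube n r.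
Proof.
move=> cK.
have cd : continuous (fun x : 'rV[R]_n => dotv x x).
  by move=> x; apply: (@continuous_dotv R n _ id id); exact: cvg_id.
have /compact_bounded[r [_ Kr]] := continuous_compact (continuous_subspaceT cd) cK.
exists (`|r| + 2); first by rewrite ltr_wpDl.
move=> x Kx i /=; rewrite in_itv/= -ler_norml.
have : `|dotv x x| <= `|r| + 1 by apply: Kr; [rewrite ltr_pwDr// ler_norm|exists x].
rewrite ger0_norm ?dotv_ge0// => /(le_trans (le_coord_dotv x i)).
by have := sqr_ge0 (`|x ord0 i| - 1); rewrite -(real_normK (num_real (x ord0 i))); nra.
Qed.

(** The sigma-algebra is generated by the coordinates, so an open set is written as the union of the
    countably many boxes with rational centre and radius 1/(m+1) that it contains; the other boxes
    are replaced by [set0]. *)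
Lemma open_row_measurable n (U : set 'rV[R]_n) : open U -> measurable U.
Proof.
move=> oU.
pose box (q : 'rV[rat]_n * nat) : set 'rV[R]_n :=
  row_box (fun i => ball (ratr (q.1 ord0 i) : R) (q.2.+1%:R^-1)).
pose F q := if `[< box q `<=` U >] then box q else set0.
have -> : U = \bigcup_q F q.
  apply/seteqP; split=> [x Ux|x [q _]]; last first.
    by rewrite /F; case: asboolP => // qU; exact: qU.
  have /nbhs_ballP[e /= e0 eU] := open_nbhs_nbhs (conj oU Ux).
  have [m me] : exists m : nat, m.+1%:R^-1 < e / 2.
    have e20 : 0 < e / 2 by rewrite divr_gt0.
    by have [m] := ltr_add_invr e20; rewrite add0r => me; exists m.
  have m0 : 0 < m.+1%:R^-1 :> R by rewrite invr_gt0.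
  have [q qx] : exists q : 'rV[rat]_n, forall i, `|x ord0 i - ratr (q ord0 i)| < m.+1%:R^-1.
    have /choice[q qx] i : exists q : rat, `|x ord0 i - ratr q| < m.+1%:R^-1.
      have xm : x ord0 i < x ord0 i + m.+1%:R^-1 by rewrite ltrDl.
      have [q] := rat_in_itvoo xm; rewrite in_itv/= => /andP[q1 q2].
      by exists q; rewrite ltr_distlC q2 andbT (lt_trans _ q1)// ltrBlDr ltrDl.
    by exists (\row_i q i) => i; rewrite mxE.
  exists (q, m) => //; rewrite /F ifT; first by move=> i; rewrite /ball/= distrC.
  apply/asboolP => y qy; apply: eU; apply/row_ballP => // i.
  have := qx i; have := qy i; rewrite /ball/= => h1 h2.
  rewrite (le_lt_trans (ler_distD (ratr (q ord0 i)) _ _))// (splitr e).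
  by rewrite ltrD// (lt_trans _ me).
apply: countable_bigcupT_measurable; first exact: countableP.
move=> q; rewrite /F; case: asboolP => // _; apply: measurable_row_box => i.
by apply: open_measurable; apply: ball_open; rewrite invr_gt0.
Qed.

Lemma continuous_row_measurable n (f : 'rV[R]_n -> R) :
  continuous f -> measurable_fun setT f.
Proof.
move=> /continuousP cf; apply: (measurability _ (RGenOpens.measurableE R)).
move=> _ [_ [a [b ->] <-]]; rewrite setTI; apply: open_row_measurable.
exact/cf/interval_open.
Qed.

Lemma compact_row_measurable n (K : set 'rV[R]_n) : compact K -> measurable K.
Proof.
move=> /(compact_closed (@norm_hausdorff R _))/closed_openC/open_row_measurable.
by move=> /measurableC; rewrite setCK.
Qed.

Lemma compact_row_lty n (K : set 'rV[R]_n) : compact K -> (row_lebesgue n K < +oo)%E.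
Proof.
move=> cK; have [r r0 Kr] := compact_sub_cube cK.
apply: le_lt_trans (cube_lty n r); apply: le_measure => //; rewrite inE.
  exact: compact_row_measurable.
exact: measurable_cube.
Qed.

Lemma continuous_compact_row_integrable n (K : set 'rV[R]_n) (f : 'rV[R]_n -> R) :
  compact K -> continuous f -> (row_lebesgue n).-integrable K (EFin \o f).
Proof.
move=> cK cf; apply: measurable_bounded_integrable.
- exact: compact_row_measurable.
- exact: compact_row_lty.
- by apply: measurable_funTS; exact: (continuous_row_measurable cf).
have := @continuous_compact _ _ f K (continuous_subspaceT cf) cK.
move=> /compact_bounded[r [rreal Kr]]; exists r; split=> // s rs x Kx.
by apply: Kr => //; exists x.
Qed.

Lemma continuous_cube_integrable n r (f : 'rV[R]_n -> R) :
  continuous f -> (forall x, ~ cube n r x -> f x = 0) ->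
  (row_lebesgue n).-integrable setT (EFin \o f).
Proof.
move=> cf f0; have := continuous_compact_row_integrable (@compact_cube n r) cf.
move/(integrable_mkcond _ (@measurable_cube n r)).
congr (integrable _ _ _); apply/funext => x; rewrite patchE/=.
by case: ifPn => //; rewrite notin_setE => /f0 ->.
Qed.

End row_boxes.
Arguments cube {R} n r.

(** * The integral of a partial derivative of compact support *)

Section integration_by_parts.
Context {R : realType}.

Lemma integral_derivative_eq0 (G G' : R -> R) r :
  (forall a : R, is_derive a 1 G (G' a)) -> continuous G' ->
  (forall a, r < `|a| -> G a = 0) ->
  (\int[lebesgue_measure]_a (G' a)%:E = 0)%E.
Proof.
(* [s] is positive and exceeds [r] whatever the sign of [r], so [G] vanishes at both ends of
   [-s, s]. *)
move=> dG cG' G0; pose s := `|r| + 1.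
have s0 : 0 < s by rewrite ltr_wpDl.
have rs : r < s by rewrite (le_lt_trans (ler_norm r))// ltrDl.
have G'0 a : r < `|a| -> G' a = 0.
  move=> ra; have : is_derive a 1 G 0.
    have D0 : is_derive a 1 (cst (0 : R)) 0 := is_derive_cst 0 a 1.
    apply: near_eq_is_derive D0.
    have : (`|b| @[b --> a] --> `|a|) by exact: norm_continuous.
    by move=> /cvgr_gt/(_ _ ra); apply: filterS => b /G0 ->.
  by have [_ <-] := dG a; move=> [_ ->].
have -> : (\int[lebesgue_measure]_a (G' a)%:E =
    \int[lebesgue_measure]_(a in `[(- s)%R, s]) (G' a)%:E)%E.
  rewrite [RHS]integral_mkcond; apply: eq_integral => a _; rewrite patchE.
  case: ifPn => //; rewrite notin_setE/= in_itv/= => /negP.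
  by rewrite -ler_norml -ltNge => sa; rewrite G'0// (lt_trans rs).
have cG : continuous G.
  by move=> a; apply/differentiable_continuous/derivable1_diffP; have [] := dG a.
rewrite (@continuous_FTC2 _ G' G).
- by rewrite !G0 ?normrN ?gtr0_norm// subee.
- by rewrite (lt_trans _ s0)// oppr_lt0.
- exact: continuous_subspaceT.
- split.
  + by move=> a _; have [] := dG a.
  + exact/cvg_at_right_filter/cG.
  + exact/cvg_at_left_filter/cG.
- by move=> a _; rewrite derive1E; have [_ ->] := dG a.
Qed.

Lemma row_cons_continuous n : continuous (@row_cons R n).
Proof.
move=> [a v]; apply/cvg_ballP => e e0.
have H (i : 'I_n.+1) : \forall z \near ((a, v) : R * 'rV[R]_n),
    `|row_cons (a, v) ord0 i - row_cons z ord0 i| < e.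
  case: (unliftP ord0 i) => [j|] ->.
    have : {for (a, v), continuous (fun z : R * 'rV[R]_n => z.2 ord0 j)}.
      exact: (@continuous_comp (R * 'rV[R]_n)%type 'rV[R]_n R snd
        (fun x => x ord0 j) (a, v) cvg_snd (@coord_continuous R 1 n ord0 j v)).
    by move=> /cvgr_dist_lt/(_ e e0); apply: filterS => z; rewrite !mxE liftK.
  have : {for (a, v), continuous (fun z : R * 'rV[R]_n => z.1)} by exact: cvg_fst.
  by move=> /cvgr_dist_lt/(_ e e0); apply: filterS => z; rewrite !mxE unlift_none.
by apply: filterS (filter_forall _ H) => z Hz; apply/row_ballP.
Qed.

(** Gives access to Fubini: the measure is by construction the image of a product measure. *)
Lemma row_integralS n (f : 'rV[R]_n.+1 -> R) :
  (row_lebesgue n.+1).-integrable setT (EFin \o f) ->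
  (@lebesgue_measure R \x row_lebesgue n)%E.-integrable setT (EFin \o (f \o @row_cons R n)) /\
  (\int[row_lebesgue n.+1]_x (f x)%:E =
   \int[@lebesgue_measure R \x row_lebesgue n]_z (f (row_cons z))%:E)%E.
Proof.
move=> fi; have mf : measurable_fun setT (EFin \o f) by case/integrableP : fi.
have mrc := @measurable_row_cons R n.
have fi' : (@lebesgue_measure R \x row_lebesgue n)%E.-integrable setT
    (EFin \o (f \o @row_cons R n)).
  apply/integrableP; split; first exact: (measurableT_comp mf mrc).
  case/integrableP : fi => _; apply: le_lt_trans.
  have mabs : measurable_fun setT (abse \o (EFin \o f)) by exact: measurableT_comp.
  by rewrite [leRHS](@ge0_integral_pushforward _ _ _ _ _ _ mrc _ setT _ measurableT
    mabs (fun x _ => abse_ge0 _)).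
split=> //.
exact: (@integral_pushforward _ _ _ _ _ _ mrc _ setT (EFin \o f) mf fi' measurableT).
Qed.

Lemma row_cons_delta_lift n (a : R) (v : 'rV[R]_n) j (h : R) :
  row_cons (a, v + h *: delta_mx ord0 j) =
  row_cons (a, v) + h *: delta_mx ord0 (lift ord0 j).
Proof.
apply/rowP => i; rewrite !mxE; case: unliftP => [k|] -> /=.
  by rewrite !mxE (inj_eq (@lift_inj _ _)).
by rewrite mulr0 addr0.
Qed.

Lemma row_cons_delta0 n (a : R) (v : 'rV[R]_n) (h : R) :
  row_cons (a + h, v) = row_cons (a, v) + h *: delta_mx ord0 ord0.
Proof.
apply/rowP => i; rewrite !mxE; case: unliftP => [k|] -> /=.
  by rewrite mulr0 addr0.
by rewrite mulr1.
Qed.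

(** Induction on the dimension: a derivative in the head coordinate is integrated first along the
    head, any other one first along the tail, where the induction hypothesis applies to each
    slice. *)
Lemma integral_partial_eq0 n (i : 'I_n) (g g' : 'rV[R]_n -> R) r :
  (forall x, is_derive x (delta_mx ord0 i) g (g' x)) -> continuous g' ->
  (forall x, ~ cube n r x -> g x = 0) ->
  (\int[row_lebesgue n]_x (g' x)%:E = 0)%E.
Proof.
elim: n i g g' => [[]//|n IHn] i g g' dg cg' g0.
have g'0 x : ~ cube n.+1 r x -> g' x = 0.
  move=> xr; have : is_derive x (delta_mx ord0 i) g 0.
    have D0 : is_derive x (delta_mx ord0 i) (cst (0 : R)) 0 := is_derive_cst 0 x _.
    apply: near_eq_is_derive D0.
    have oC : open (~` cube n.+1 r).
      apply: closed_openC; apply: compact_closed; first exact: norm_hausdorff.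
      exact: compact_cube.
    by apply: filterS (open_nbhs_nbhs (conj oC xr)) => y /g0 ->.
  by have [_ <-] := dg x; move=> [_ ->].
have gi := continuous_cube_integrable cg' g'0.
have [gi' ->] := row_integralS gi.
have outT (a : R) (v : 'rV[R]_n) : ~ cube n r v -> ~ cube n.+1 r (row_cons (a, v)).
  by move=> + H; apply => j; have := H (lift ord0 j); rewrite mxE liftK.
have outH (a : R) (v : 'rV[R]_n) : r < `|a| -> ~ cube n.+1 r (row_cons (a, v)).
  move=> ra H; have := H ord0; rewrite mxE unlift_none/= in_itv/= -ler_norml.
  by rewrite leNgt ra.
have crv (a : R) : continuous (fun v : 'rV[R]_n => row_cons (a, v)).
  move=> v; apply: (@continuous_comp 'rV[R]_n (R * 'rV[R]_n)%type 'rV[R]_n.+1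
    (fun v => (a, v)) (@row_cons R n) v); last exact: row_cons_continuous.
  by apply: (@continuous_pair_at 'rV[R]_n R 'rV[R]_n (fun=> a) id v) => //; exact: cst_continuous.
have cra (v : 'rV[R]_n) : continuous (fun a : R => row_cons (a, v)).
  move=> a; apply: (@continuous_comp R (R * 'rV[R]_n)%type 'rV[R]_n.+1
    (fun a => (a, v)) (@row_cons R n) a); last exact: row_cons_continuous.
  by apply: (@continuous_pair_at R R 'rV[R]_n id (fun=> v) a) => //; exact: cst_continuous.
case: (unliftP ord0 i) dg => [j|] -> dg.
  rewrite -integral12_prod_meas1//; rewrite (eq_integral (cst 0%E)) ?integral0// => a _.
  apply: (IHn j (fun v => g (row_cons (a, v)))) => [v|v|v va].
  - apply/is_derive_line0; have /is_derive_line0 := dg (row_cons (a, v)).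
    by under eq_fun do rewrite -row_cons_delta_lift.
  - exact: (@continuous_comp _ _ _ (fun v => row_cons (a, v)) g' v (crv a v) (cg' _)).
  - exact/g0/outT.
rewrite -integral21_prod_meas1//; rewrite (eq_integral (cst 0%E)) ?integral0// => v _.
apply: (@integral_derivative_eq0 (fun a => g (row_cons (a, v))) _ r) => [a|a|a ra].
- apply/(is_derive_line0 (V := R^o)); have /is_derive_line0 := dg (row_cons (a, v)).
  under eq_fun do rewrite -row_cons_delta0.
  by under [X in _ -> is_derive _ _ X _]eq_fun do rewrite [_ *: 1]mulr1.
- exact: (@continuous_comp _ _ _ (fun a : R => row_cons (a, v)) g' a (cra v a) (cg' _)).
- exact/g0/outH.
Qed.

End integration_by_parts.

(** * Functions with continuous partial derivatives *)

Section continuous_partials.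
Context {R : realType} {n : nat}.
Variables (h : 'rV[R]_n -> R) (d : 'I_n -> 'rV[R]_n -> R).
Hypothesis dh : forall i x, is_derive x (delta_mx ord0 i) h (d i x).

(** The path from [x] to [x + k] changes one coordinate at a time, and the mean value theorem is
    applied on each leg, because only derivatives along the axes are given. *)
Lemma partial_mean_value (x k : 'rV[R]_n) : exists xi : 'I_n -> 'rV[R]_n,
  (forall i j, `|xi i ord0 j - x ord0 j| <= `|k ord0 j|) /\
  h (x + k) - h x = \sum_i k ord0 i * d i (xi i).
Proof.
pose y m : 'rV[R]_n := \row_j (x ord0 j + if (j < m)%N then k ord0 j else 0).
have step (i : 'I_n) : exists z : 'rV[R]_n,
    (forall j, `|z ord0 j - x ord0 j| <= `|k ord0 j|) /\
    h (y i.+1) - h (y i) = k ord0 i * d i z.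
  have yE s : (y i + (s * k ord0 i) *: delta_mx ord0 i) ord0 i = x ord0 i + s * k ord0 i.
    by rewrite !mxE !eqxx ltnn addr0 mulr1.
  have yS : y i.+1 = y i + (1 * k ord0 i) *: delta_mx ord0 i.
    apply/rowP => j; rewrite !mxE eqxx/= mul1r ltnS.
    have [->|ji] := eqVneq j i; first by rewrite leqnn ltnn mulr1 addr0.
    rewrite mulr0 addr0 leq_eqVlt.
    by have -> : (j == i :> nat) = false by exact: negbTE.
  have D (s : R) := is_derive_scaled_line (dh i (y i + (s * k ord0 i) *: delta_mx ord0 i)).
  have [|s sI E] := @MVT R (fun s => h (y i + (s * k ord0 i) *: delta_mx ord0 i))
    (fun s => k ord0 i * d i (y i + (s * k ord0 i) *: delta_mx ord0 i)) 0 1 ltr01 (fun s _ => D s).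
    by apply: derivable_within_continuous => s _; have [] := D s.
  move: sI; rewrite in_itv/= => /andP[s0 s1].
  exists (y i + (s * k ord0 i) *: delta_mx ord0 i); split; last first.
    by rewrite yS -[RHS]mulr1 -[in RHS](subr0 1) -E mul0r scale0r addr0.
  move=> j; have [->|ji] := eqVneq j i.
    rewrite yE addrAC subrr add0r normrM (gtr0_norm s0) ler_piMl// ltW//.
  rewrite !mxE (negbTE ji) andbF mulr0 addr0 addrAC subrr add0r.
  by case: ifP => // _; rewrite normr0.
have [xi xiP] := choice step.
exists xi; split=> [i j|]; first by have [] := xiP i.
have y0 : y 0%N = x by apply/rowP => j; rewrite mxE ltn0 addr0.
have yn : y n = x + k by apply/rowP => j; rewrite !mxE ltn_ord.
have -> : h (x + k) - h x = h (y n) - h (y 0%N) by rewrite y0 yn.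
rewrite -(@telescope_sumr _ 0 n (fun m => h (y m)))// big_mkord.
by apply: eq_bigr => i _; have [] := xiP i.
Qed.

Hypothesis cd : forall i, continuous (d i).

Lemma near_partials (x : 'rV[R]_n) e : 0 < e -> exists2 r, 0 < r &
  forall z : 'rV[R]_n, (forall j, `|z ord0 j - x ord0 j| < r) -> forall i, `|d i z - d i x| < e.
Proof.
move=> e0.
have H i : \forall z \near x, `|d i x - d i z| < e.
  by have /cvgr_dist_lt/(_ e e0) := @cd i x.
have : nbhs x (fun z => forall i, `|d i x - d i z| < e) 
  by exact: (@filter_forall _ _ (fun i z => `|d i x - d i z| < e) (nbhs x) _ H).
move=> /nbhs_ballP[r /= r0 rH].
exists r => // z zx i; rewrite distrC; apply: rH.
by apply/row_ballP => // j; rewrite distrC.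
Qed.

Lemma continuous_of_partials : continuous h.
Proof.
move=> x; apply: (proj2 (@cvgrPdist_lt _ _ _ (nbhs x) _ h (h x))) => e e0.
have [r r0 rd] := near_partials x ltr01.
pose B := \sum_i (`|d i x| + 1).
have B0 : 0 <= B by apply: sumr_ge0 => i _; rewrite addr_ge0.
have eB : 0 < e / (B + 1) by rewrite divr_gt0// ltr_wpDl.
have m0 : 0 < Num.min r (e / (B + 1)) by rewrite lt_min r0.
apply/nbhs_ballP; exists (Num.min r (e / (B + 1))) => //= z /(row_ballP _ _ m0) zx.
have [xi [xiP E]] := partial_mean_value x (z - x).
rewrite distrC; have -> : h z - h x = h (x + (z - x)) - h x by rewrite [x + _]addrC subrK.
rewrite E (le_lt_trans (ler_norm_sum _ _ _))//.
apply: (@le_lt_trans _ _ (\sum_i (e / (B + 1) * (`|d i x| + 1)))).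
  apply: ler_sum => i _; rewrite normrM; apply: ler_pM => //.
    have := zx i; rewrite lt_min => /andP[_ /ltW].
    by rewrite distrC !mxE.
  have /ltW : `|d i (xi i) - d i x| < 1.
    apply: rd => j; apply: le_lt_trans (xiP i j) _; rewrite !mxE distrC.
    by have := zx j; rewrite lt_min => /andP[].
  move=> H; rewrite -[d i (xi i)](subrK (d i x)) addrC (le_trans (ler_normD _ _))//.
  by rewrite lerD2l.
rewrite -mulr_sumr -/B mulrAC ltr_pdivrMr ?ltr_wpDl// ltr_pM2l// ltrDl.
by [].
Qed.

(** Move from [x] along the gradient G itself: to first order the increment is s |G|^2, and the
    Lipschitz bound allows s M |G|. *)
Lemma lipschitz_gradient_le (M : R) (x : 'rV[R]_n) : 0 <= M ->
  (forall y, h y - h x <= M * enorm (y - x)) -> enorm (\row_i d i x) <= M.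
Proof.
move=> M0 lip; set G := \row_i d i x.
have [->|G0] := eqVneq G 0; first by rewrite enorm0.
have nG : 0 < enorm G.
  by rewrite sqrtr_gt0 lt_neqAle dotv_ge0 andbT eq_sym dotv_eq0.
suff : enorm G * enorm G <= M * enorm G by rewrite ler_pM2r.
rewrite -expr2 enorm_sqr; apply/ler_addgt0Pr => e e0.
pose B := \sum_i `|G ord0 i|.
have B0 : 0 <= B by exact: sumr_ge0.
have eB : 0 < e / (B + 1) by rewrite divr_gt0// ltr_wpDl.
have [r r0 rd] := near_partials x eB.
(* Keeps every coordinate of s G below [r], the radius within which the partial derivatives vary by
   less than e / (B + 1). *)
pose s := r / (B + 1).
have s0 : 0 < s by rewrite divr_gt0// ltr_wpDl.
have [xi [xiP E]] := partial_mean_value x (s *: G).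
have Gle j : `|(s *: G) ord0 j| < r.
  rewrite mxE normrM (gtr0_norm s0) /s mulrAC ltr_pdivrMr ?ltr_wpDl// ltr_pM2l//.
  rewrite (@le_lt_trans _ _ B)// ?ltrDl// /B (bigD1 j)//= lerDl.
  exact: sumr_ge0.
have dxi i : `|d i (xi i) - d i x| < e / (B + 1).
  by apply: rd => j; apply: le_lt_trans (xiP i j) _.
have : s * \sum_i G ord0 i * d i (xi i) <= s * (M * enorm G).
  have := lip (x + s *: G); rewrite E addrC addKr enormZ (gtr0_norm s0).
  rewrite mulrCA mulr_sumr; apply: le_trans; rewrite le_eqVlt; apply/orP; left.
  by apply/eqP/eq_bigr => i _; rewrite !mxE mulrA.
rewrite ler_pM2l// => H.
have -> : dotv G G = \sum_i G ord0 i * d i (xi i) +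
    \sum_i G ord0 i * (d i x - d i (xi i)).
  rewrite -big_split; apply: eq_bigr => i _ /=.
  by rewrite -mulrDr addrC subrK [in RHS]mulrC !mxE.
rewrite lerD// (le_trans (ler_norm _))// (le_trans (ler_norm_sum _ _ _))//.
apply: (@le_trans _ _ (\sum_i `|G ord0 i| * (e / (B + 1)))).
  by apply: ler_sum => i _; rewrite normrM ler_wpM2l// distrC ltW.
rewrite -mulr_suml -/B mulrCA ger_pMr// ler_pdivrMr ?ltr_wpDl// mul1r lerDl//.
Qed.

End continuous_partials.

Section integration_by_parts_weak.
Context {R : realType} {n : nat}.
Implicit Types (phi V : 'rV[R]_n -> R).

Lemma C1c_is_derive phi x v : C1c phi -> is_derive x v phi ('D_v phi x).
Proof. by move=> [C1 _]; apply: derivableP; have [] := C1 v x I. Qed.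

Lemma C1c_continuous_derive phi v : C1c phi -> continuous ('D_v phi).
Proof. by move=> [C1 _] x; have [_] := C1 v x I. Qed.

Lemma C1c_continuous phi : C1c phi -> continuous phi.
Proof.
move=> Cphi; apply: (@continuous_of_partials _ _ _ (fun i => 'D_(delta_mx ord0 i) phi)).
  by move=> i x; exact: C1c_is_derive.
by move=> i; exact: C1c_continuous_derive.
Qed.

Lemma C1c_cube phi : C1c phi -> exists2 r, 0 < r & forall x, ~ cube n r x ->
  phi x = 0 /\ forall v, 'D_v phi x = 0.
Proof.
move=> [C1 [K cK K0]]; have [r r0 Kr] := compact_sub_cube cK.
exists r => // x xr; have oC : open (~` cube n r).
  apply: closed_openC; apply: compact_closed; first exact: norm_hausdorff.
  exact: compact_cube.
have phi0 y : ~ cube n r y -> phi y = 0 by move=> yr; apply: K0 => /Kr.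
split=> [|v]; first exact: phi0.
have D0 : is_derive x v (cst (0 : R)) 0 := is_derive_cst 0 x v.
suff : is_derive x v phi 0 by move=> [_ ->].
apply: near_eq_is_derive D0.
by apply: filterS (open_nbhs_nbhs (conj oC xr)) => y /phi0 ->.
Qed.

Lemma integration_by_parts_C1c (i : 'I_n) V V' phi :
  (forall x, is_derive x (delta_mx ord0 i) V (V' x)) ->
  continuous V -> continuous V' -> C1c phi ->
  \int[row_lebesgue n]_x (V x * 'D_(delta_mx ord0 i) phi x) =
  - \int[row_lebesgue n]_x (V' x * phi x).
Proof.
move=> dV cV cV' Cphi; have [r r0 rphi] := C1c_cube Cphi.
set e : 'rV[R]_n := delta_mx ord0 i.
have cphi := C1c_continuous Cphi; have cD := C1c_continuous_derive (v := e) Cphi.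
have i1 : (row_lebesgue n).-integrable setT (EFin \o (fun x => V x * 'D_e phi x)).
  apply: (@continuous_cube_integrable _ _ r) => [x|x /rphi[_ ->]]; last by rewrite mulr0.
  exact: (continuousM (cV x) (cD x)).
have i2 : (row_lebesgue n).-integrable setT (EFin \o (fun x => V' x * phi x)).
  apply: (@continuous_cube_integrable _ _ r) => [x|x /rphi[-> _]]; last by rewrite mulr0.
  exact: (continuousM (cV' x) (cphi x)).
apply/eqP; rewrite -addr_eq0 -RintegralD//; apply/eqP.
rewrite /Rintegral [X in fine X](_ : _ = 0%E)//.
apply: (@integral_partial_eq0 _ _ i (fun x => V x * phi x) _ r).
- move=> x; have := is_deriveM (dV x) (C1c_is_derive x e Cphi).
  by move=> /is_derive_eq; apply; congr (_ + _); exact: mulrC.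
- move=> x.
  exact: (continuousD (continuousM (cV x) (cD x)) (continuousM (cV' x) (cphi x))).
- by move=> x /rphi[-> _]; rewrite mulr0.
Qed.

End integration_by_parts_weak.

(** * Mazur's lemma and weak gradients of limits *)

Section mazur.
Context {R : realType}.

Lemma cvg_geometric_steps (a : nat -> R) (C : R) :
  (forall j, `|a j - a j.+1| <= C * 2^-1 ^+ j) -> cvgn a.
Proof.
move=> aC; have C0 : 0 <= C by have := aC 0%N; rewrite expr0 mulr1; exact: le_trans.
have half : `|2^-1 : R| < 1 by rewrite ger0_norm ?invr_ge0// invf_lt1// ltr1n.
have cs : cvgn (series (telescope a)).
  apply: normed_cvg; apply: (@series_le_cvg _ _ (geometric C 2^-1)).
  - by move=> k; exact: normr_ge0.
  - by move=> k; rewrite /geometric/= mulr_ge0// exprn_ge0// invr_ge0.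
  - by move=> k; rewrite /telescope/= distrC aC.
  - exact: is_cvg_geometric_series.
have -> : a = (fun k => a 0%N + series (telescope a) k).
  by apply/funext => k; exact: eq_sum_telescope.
by apply: is_cvgD => //; exact: is_cvg_cst.
Qed.

(** Bounded gradients need not be square integrable for Lebesgue measure. A positive weight of
    finite mass makes them so and keeps the null sets; a product of normal densities is one. *)
Lemma row_weight n : exists w : 'rV[R]_n -> R, [/\ measurable_fun setT w,
  (forall x, 0 < w x) & (row_lebesgue n).-integrable setT (EFin \o w)].
Proof.
suff [w [mw w0 wi]] : exists w : 'rV[R]_n -> R, [/\ measurable_fun setT w,
    (forall x, 0 < w x) & (\int[row_lebesgue n]_x (w x)%:E = 1)%E].
  exists w; split=> //; apply/integrableP; split; first exact/measurable_EFinP.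
  under eq_integral do rewrite /= ger0_norm ?(ltW (w0 _))//.
  by rewrite wi ltry.
elim: n => [|n [w [mw w0 wi]]].
  exists (cst 1); split=> //; rewrite (eq_integral (cst 1%E))// integral_cst//= mul1e.
  by rewrite diracT.
pose r := @normal_pdf R 0 1.
have r0 s : 0 < r s.
  by rewrite /r normal_pdfE ?oner_eq0// mulr_gt0 ?normal_peak_gt0 ?oner_eq0// expR_gt0.
pose f (x : 'rV[R]_n.+1) := r (row_uncons x).1 * w (row_uncons x).2.
have f0 x : 0 < f x by rewrite mulr_gt0.
have mf : measurable_fun setT f.
  apply: measurable_funM.
    apply: measurableT_comp; first exact: measurable_normal_pdf.
    by apply: measurableT_comp; [exact: measurable_fst|exact: measurable_row_uncons].
  apply: measurableT_comp => //.
  by apply: measurableT_comp; [exact: measurable_snd|exact: measurable_row_uncons].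
have mef : measurable_fun setT (EFin \o f) by exact/measurable_EFinP.
exists f; split=> //.
rewrite [LHS](@ge0_integral_pushforward _ _ _ _ _ _ (@measurable_row_cons R n) _
  setT _ measurableT mef); last first.
  by move=> x _; rewrite lee_fin ltW.
have fE z : ((EFin \o f) \o row_cons (n:=n)) z = (r z.1 * w z.2)%:E.
  by rewrite /= /f row_consK.
rewrite preimage_setT; under eq_integral do rewrite fE.
rewrite fubini_tonelli1.
- rewrite /fubini_F -(@integral_normal_pdf R 0 1); apply: eq_integral => a _ /=.
  under eq_integral do rewrite EFinM.
  rewrite ge0_integralZl//.
  + by rewrite wi mule1.
  + exact/measurable_EFinP.
  + by move=> v _; rewrite lee_fin ltW.
  + by rewrite lee_fin ltW.
- apply/measurable_EFinP; apply: measurable_funM.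
    by apply: measurableT_comp; [exact: measurable_normal_pdf|exact: measurable_fst].
  by apply: measurableT_comp => //; exact: measurable_snd.
- by move=> z; rewrite lee_fin ltW// mulr_gt0.
Qed.

Section mazur_lemma.
Context {d} {T : measurableType d} {n : nat}.
Variables (mu : {measure set T -> \bar R}) (w : T -> R) (B : R).
Variable P : nat -> set ('I_n -> T -> R).
Hypotheses (mw : measurable_fun setT w) (w0 : forall x, 0 < w x).
Hypothesis wi : mu.-integrable setT (EFin \o w).
Hypothesis P0 : forall m, P m !=set0.
Hypothesis Pdecr : forall m m', (m <= m')%N -> P m' `<=` P m.
Hypothesis Pavg : forall m g h, P m g -> P m h ->
  P m (fun i x => (g i x + h i x) / 2).
Hypothesis Pmeas : forall m g i, P m g -> measurable_fun setT (g i).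
Hypothesis Pbound : forall m g x, P m g -> \sum_i g i x ^+ 2 <= B.

Let sqw (g : 'I_n -> T -> R) x := (\sum_i g i x ^+ 2) * w x.
Let J g := \int[mu]_x sqw g x.

Let sqw_ge0 g x : 0 <= sqw g x.
Proof. by rewrite mulr_ge0 ?(ltW (w0 x))// sumr_ge0// => i _; rewrite sqr_ge0. Qed.

Let sqw_measurable g : (forall i, measurable_fun setT (g i)) ->
  measurable_fun setT (sqw g).
Proof.
move=> mg; apply: measurable_funM => //.
by apply: measurable_sum => i; apply: measurable_funX; exact: mg.
Qed.

Let sqw_integrable m g : P m g -> mu.-integrable setT (EFin \o sqw g).
Proof.
move=> Pg; have iB : mu.-integrable setT (fun x => B%:E * (w x)%:E)%E.
  exact: integrableZl.
apply: le_integrable iB => //.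
  by apply/measurable_EFinP/sqw_measurable => i; exact: Pmeas Pg.
move=> x _ /=; rewrite lee_fin (ger0_norm (sqw_ge0 _ _)).
by rewrite (le_trans _ (ler_norm _))// ler_wpM2r ?(ltW (w0 x))// (Pbound x Pg).
Qed.

Let dist2 (g h : 'I_n -> T -> R) := sqw (fun i x => g i x - h i x).

Let parallelogram m g h : P m g -> P m h ->
  \int[mu]_x dist2 g h x = 2 * J g + 2 * J h - 4 * J (fun i x => (g i x + h i x) / 2).
Proof.
move=> Pg Ph; have Pgh := Pavg Pg Ph.
have [ig ih igh] := And3 (sqw_integrable Pg) (sqw_integrable Ph) (sqw_integrable Pgh).
have iZ k f : mu.-integrable setT (EFin \o f) ->
    mu.-integrable setT (EFin \o (fun x => k * f x)).
  by move=> fi; have := integrableZl measurableT k fi.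
rewrite -!RintegralZl// -RintegralD//; [|exact: iZ..].
rewrite -RintegralB//; [|by have := integrableD measurableT (iZ 2 _ ig) (iZ 2 _ ih)|exact: iZ].
apply: eq_Rintegral => x _; rewrite /dist2 /sqw !mulrA -!mulrDl -mulrBl; congr (_ * _).
rewrite !mulr_sumr -big_split -sumrB; apply: eq_bigr => i _ /=.
by field.
Qed.

(** Near-minimizers of the weighted norm over the decreasing midpoint-convex sets [P m] are close to
    each other: their midpoint cannot go below the infimum, and the parallelogram identity turns
    this into a bound on the distance. This replaces weak compactness, and a fast enough rate gives
    convergence almost everywhere without passing to a subsequence. *)
Lemma mazur_ae_cvg : exists g : nat -> 'I_n -> T -> R,
  (forall j, P j (g j)) /\ {ae mu, forall x, forall i, cvgn (fun j => g j i x)}.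
Proof.
pose I_ m := inf (J @` P m).
have J_ge0 g : 0 <= J g by apply: Rintegral_ge0 => x _.
have lbJ m : has_lbound (J @` P m) by exists 0 => _ [g _ <-].
have JB m g : P m g -> J g <= \int[mu]_x (B * w x).
  move=> Pg; apply: le_Rintegral => //; first exact: sqw_integrable Pg.
    by have := integrableZl measurableT B wi.
  by move=> x _; rewrite ler_wpM2r ?(ltW (w0 x))// (Pbound x Pg).
have d_nd m m' : (m <= m')%N -> I_ m <= I_ m'.
  move=> mm'; apply: lb_le_inf.
    by have [g Pg] := P0 m'; exists (J g), g.
  move=> _ [g Pg <-]; apply: ge_inf => //.
  by exists g => //; exact: Pdecr Pg.
have sup_d : has_sup (range I_).
  split; first by exists (I_ 0%N), 0%N.
  exists (\int[mu]_x (B * w x)) => _ [m _ <-].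
  have [g Pg] := P0 m; apply: le_trans (JB _ _ Pg).
  by apply: ge_inf => //; exists g.
pose D := sup (range I_).
have dD m : I_ m <= D by apply: sup_upper_bound => //; exists m.
(* The 8 is the one of [dist_le] and 4^j is the weight in [F]: together they leave 2^-(j+1) for the
   integral of [F j], and these sum to 1. *)
pose e (j : nat) : R := ((4 ^ j * 8 * 2 ^ j.+1)%N%:R)^-1.
have e0 j : 0 < e j by rewrite invr_gt0 ltr0n !muln_gt0 !expn_gt0.
have /choice[s sP] j : exists mg : nat * ('I_n -> T -> R),
    [/\ (j <= mg.1)%N, D - e j < I_ mg.1, P mg.1 mg.2 & J mg.2 < D + e j].
  have [_ [m _ <-] Dm] := sup_adherent (e0 j) sup_d.
  have hinf : has_inf (J @` P (maxn m j)).
    by split=> //; have [g Pg] := P0 (maxn m j); exists (J g), g.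
  have [_ [g Pg <-] Jg] := inf_adherent (e0 j) hinf.
  exists (maxn m j, g); split=> //=; first exact: leq_maxr.
    by rewrite (lt_le_trans Dm)// d_nd// leq_maxl.
  by rewrite (lt_le_trans Jg)// lerD2r dD.
pose g j := (s j).2.
exists g; split; first by move=> j; have [jm _ Pg _] := sP j; exact: Pdecr Pg.
have emono j : e j.+1 <= e j.
  have le4 : (4 ^ j * 8 * 2 ^ j.+1 <= 4 ^ j.+1 * 8 * 2 ^ j.+2)%N.
    by rewrite leq_mul ?leq_exp2l// leq_mul// leq_exp2l.
  have epos k : 0 < (4 ^ k * 8 * 2 ^ k.+1)%N%:R :> R by rewrite ltr0n !muln_gt0 !expn_gt0.
  rewrite /e lef_pV2. by rewrite ler_nat. exact: epos. exact: epos.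
have dist_le j : \int[mu]_x dist2 (g j) (g j.+1) x <= 8 * e j.
  have [jm dm Pg Jg] := sP j; have [jm' dm' Pg' Jg'] := sP j.+1.
  (* The smaller index: both terms and their midpoint lie in [P m], and its infimum is still above D
     - e j. *)
  pose m := minn (s j).1 (s j.+1).1.
  have dme : D - e j < I_ m.
    rewrite /m /minn; case: ifP => // _.
    by rewrite (le_lt_trans _ dm')// lerD2l lerN2.
  have Pm : P m (g j) by apply: Pdecr Pg; exact: geq_minl.
  have Pm' : P m (g j.+1) by apply: Pdecr Pg'; exact: geq_minr.
  rewrite (parallelogram Pm Pm').
  have : I_ m <= J (fun i x => (g j i x + g j.+1 i x) / 2).
    by apply: ge_inf => //; exists (fun i x => (g j i x + g j.+1 i x) / 2) => //; exact: Pavg.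
  have := emono j; rewrite /g; lra.
have mg j i : measurable_fun setT (g j i) by have [_ _ Pg _] := sP j; exact: Pmeas Pg.
have mdist j : measurable_fun setT (dist2 (g j) (g j.+1)).
  by apply: sqw_measurable => i; exact: measurable_funB.
(* Where the sum of this series is finite, consecutive terms of [g] differ by at most a constant
   times 2^-j. *)
pose F j x := (4 ^+ j * dist2 (g j) (g j.+1) x)%:E.
have F0 j x : (0 <= F j x)%E by rewrite lee_fin mulr_ge0 ?exprn_ge0 ?sqw_ge0.
have mF j : measurable_fun setT (F j).
  by apply/measurable_EFinP; apply: measurable_funM => //; exact: measurable_cst.
have idist j : mu.-integrable setT (EFin \o dist2 (g j) (g j.+1)).
  have [_ _ Pg _] := sP j; have [_ _ Pg' _] := sP j.+1.
  have := integrableD measurableT (integrableZl measurableT 2 (sqw_integrable Pg))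
    (integrableZl measurableT 2 (sqw_integrable Pg')).
  apply: le_integrable => //; first exact/measurable_EFinP.
  move=> x _ /=; rewrite lee_fin (ger0_norm (sqw_ge0 _ _)).
  rewrite (le_trans _ (ler_norm _))// /dist2 /sqw !mulrA -mulrDl ler_wpM2r ?(ltW (w0 x))//.
  rewrite !mulr_sumr -big_split; apply: ler_sum => i _ /=.
  by have := sqr_ge0 ((s j).2 i x + (s j.+1).2 i x); rewrite /g; nra.
have intF j : (\int[mu]_x F j x <= (1 / (2 ^ j.+1)%:R)%:E)%E.
  have -> : (\int[mu]_x F j x = (4 ^+ j * \int[mu]_x dist2 (g j) (g j.+1) x)%:E)%E.
    rewrite -RintegralZl// /Rintegral fineK//.
    by apply: integrable_fin_num => //; have := integrableZl measurableT (4 ^+ j) (idist j).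
  rewrite lee_fin (@le_trans _ _ (4 ^+ j * (8 * e j)))// ?ler_wpM2l ?exprn_ge0//.
  rewrite /e !natrM !natrX le_eqVlt; apply/orP; left; apply/eqP.
  field.
  by rewrite !expf_neq0.
have sumF : (\int[mu]_x (\sum_(j <oo) F j x) < +oo)%E.
  rewrite integral_nneseries//; apply: (@le_lt_trans _ _ 1%:E); last exact: ltry.
  apply: le_trans (epsilon_trick0 xpredT ler01).
  by apply: lee_nneseries => // j _ _; exact: integral_ge0.
have iF : mu.-integrable setT (fun x => \sum_(j <oo) F j x)%E.
  apply/integrableP; split.
    by apply: ge0_emeasurable_sum.
  under eq_integral do rewrite gee0_abs ?nneseries_ge0//.
  exact: sumF.
have := integrable_ae measurableT iF; apply: filterS => x /(_ I) Sfin i.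
have [S SE] : exists S, (\sum_(j <oo) F j x)%E = S%:E.
  by exists (fine (\sum_(j <oo) F j x)%E); rewrite fineK.
have FS j : 4 ^+ j * dist2 (g j) (g j.+1) x <= S.
  rewrite -lee_fin -SE; apply: le_trans (nneseries_lim_ge j.+1 _) => //.
  rewrite big_nat_recr//= leeDr// sume_ge0//.
apply: (@cvg_geometric_steps _ (Num.sqrt (S / w x))) => j.
have S0 : 0 <= S by apply: le_trans (FS 0%N); rewrite mulr_ge0 ?exprn_ge0 ?sqw_ge0.
rewrite -(@ler_pXn2r _ 2) ?nnegrE ?mulr_ge0 ?sqrtr_ge0 ?exprn_ge0 ?invr_ge0//.
rewrite real_normK ?num_real// exprMn sqr_sqrtr ?divr_ge0 ?(ltW (w0 x))//.
rewrite -exprM mulnC exprM exprVn.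
have -> : 2 ^+ 2 = 4 :> R by rewrite expr2 -natrM.
rewrite exprVn ler_pdivlMr ?exprn_gt0// mulrC ler_pdivlMr// -mulrA.
apply: le_trans (FS j); rewrite ler_wpM2l ?exprn_ge0// /dist2 /sqw ler_wpM2r ?(ltW (w0 x))//.
by rewrite (bigD1 i)//= lerDl sumr_ge0// => k _; rewrite sqr_ge0.
Qed.

End mazur_lemma.
End mazur.

Lemma Rintegral_dominated_cvg {d} {T : measurableType d} {R : realType}
    (mu : {measure set T -> \bar R}) (D : set T) (F : nat -> T -> R) (f g : T -> R) :
  measurable D -> (forall k, measurable_fun D (F k)) -> measurable_fun D f ->
  {ae mu, forall x, D x -> F k x @[k --> \oo] --> f x} ->
  mu.-integrable D (EFin \o g) ->
  {ae mu, forall x, D x -> forall k, `|F k x| <= g x} ->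
  mu.-integrable D (EFin \o f) /\
  \int[mu]_(x in D) F k x @[k --> \oo] --> \int[mu]_(x in D) f x.
Proof.
move=> mD mF mf Ff gi Fg.
have [||||fi _ cv] := @dominated_convergence _ _ _ mu D mD
  (fun k => EFin \o F k) (EFin \o f) (EFin \o g) _ _ _ gi _.
- by move=> k; exact/measurable_EFinP.
- exact/measurable_EFinP.
- by apply: filterS Ff => x H Dx; apply: cvg_EFin; [exact: nearW|exact: H].
- by apply: filterS Fg => x H k Dx; rewrite /= lee_fin H.
split=> //; apply: fine_cvg.
by rewrite /Rintegral fineK//; exact: integrable_fin_num.
Qed.

Lemma enorm_continuous {R : realType} {n : nat} (c : 'rV[R]_n) :
  continuous (fun x : 'rV[R]_n => enorm (x - c)).
Proof.
move=> x; have cB : {for x, continuous (fun x : 'rV[R]_n => x - c)}.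
  by apply: (@continuousB R 'rV[R]_n 'rV[R]_n id (fun=> c)) => //; exact: cst_continuous.
apply: (@continuous_comp _ R R (fun x : 'rV[R]_n => dotv (x - c) (x - c)) Num.sqrt).
  exact: continuous_dotv.
exact: sqrt_continuous.
Qed.

Lemma row_lebesgue_null_notT {R : realType} {n : nat} (A : set 'rV[R]_n) :
  measurable A -> row_lebesgue n A = 0%E -> exists x, ~ A x.
Proof.
move=> mA A0; apply: contrapT => /forallNP AT.
pose I01 : set R := [set` `[0, 1]].
have : (0 < row_lebesgue n (row_box (fun=> I01)))%E.
  apply: row_lebesgue_box_gt0 => i; first exact: measurable_itv.
  by rewrite lebesgue_measure_itv/= lte_fin ltr01 -EFinB lte_fin subr0.
rewrite ltNge => /negP; apply; rewrite -A0; apply: le_measure; rewrite ?inE//.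
  by apply: measurable_row_box => i; exact: measurable_itv.
by move=> x _; apply: contrapT; exact: AT.
Qed.

Section lipschitz_limit.
Context {R : realType} {n : nat}.
Variables (v : nat -> 'rV[R]_n -> R) (d : nat -> 'I_n -> 'rV[R]_n -> R).
Variables (V : 'rV[R]_n -> R) (M : R).
Hypothesis dv : forall k i x, is_derive x (delta_mx ord0 i) (v k) (d k i x).
Hypothesis cd : forall k i, continuous (d k i).
Hypothesis M0 : 0 <= M.
Hypothesis lip : forall k x y, v k x - v k y <= M * enorm (x - y).
Hypothesis mV : measurable_fun setT V.
Hypothesis vV : {ae row_lebesgue n, forall x, v k x @[k --> \oo] --> V x}.

(** Functions and gradients are averaged together, so that one choice of averages serves both
    limits; using only indices from [m] on makes the averaged functions converge to [V]. *)
Inductive midpoint_hull (m : nat) : ('rV[R]_n -> R) -> ('I_n -> 'rV[R]_n -> R) -> Prop :=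
| midpoint_hull_base k : (m <= k)%N -> midpoint_hull m (v k) (d k)
| midpoint_hull_avg h1 g1 h2 g2 : midpoint_hull m h1 g1 -> midpoint_hull m h2 g2 ->
    midpoint_hull m (fun x => (h1 x + h2 x) / 2) (fun i x => (g1 i x + g2 i x) / 2).

Lemma midpoint_hull_decr m m' h g : (m <= m')%N ->
  midpoint_hull m' h g -> midpoint_hull m h g.
Proof.
move=> mm'; elim=> [k m'k|h1 g1 h2 g2 _ H1 _ H2]; last exact: midpoint_hull_avg.
by apply: midpoint_hull_base; exact: leq_trans m'k.
Qed.

Lemma midpoint_hull_derive m h g : midpoint_hull m h g ->
  forall i x, is_derive x (delta_mx ord0 i) h (g i x).
Proof.
elim=> [k _ i x|h1 g1 h2 g2 _ H1 _ H2 i x]; first exact: dv.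
have := is_deriveZ (2^-1) (is_deriveD (H1 i x) (H2 i x)).
rewrite (_ : _ \*: _ = fun x => (h1 x + h2 x) / 2); last first.
  by apply/funext => y; exact: mulrC.
by move=> /is_derive_eq; apply; exact: mulrC.
Qed.

Lemma midpoint_hull_continuous m h g : midpoint_hull m h g -> forall i, continuous (g i).
Proof.
elim=> [k _ i|h1 g1 h2 g2 _ H1 _ H2 i] x; first exact: cd.
have c2 : {for x, continuous (fun _ : 'rV[R]_n => 2^-1 : R)} by exact: cst_continuous.
exact: (continuousM (continuousD (H1 i x) (H2 i x)) c2).
Qed.

(** Each gradient satisfies the bound by [lipschitz_gradient_le], and averages inherit it by
    convexity of the square. *)
Lemma midpoint_hull_bound m h g : midpoint_hull m h g ->
  forall x, \sum_i g i x ^+ 2 <= M ^+ 2.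
Proof.
elim=> [k _ x|h1 g1 h2 g2 _ H1 _ H2 x].
  have := lipschitz_gradient_le (dv k) (@cd k) (x := x) M0 (fun y => lip k y x).
  rewrite -(@ler_pXn2r _ 2) ?nnegrE ?enorm_ge0// enorm_sqr; apply: le_trans.
  by rewrite le_eqVlt; apply/orP; left; apply/eqP/eq_bigr => i _; rewrite mxE.
apply: (@le_trans _ _ ((\sum_i g1 i x ^+ 2 + \sum_i g2 i x ^+ 2) / 2)).
  rewrite -big_split mulr_suml; apply: ler_sum => i _ /=.
  by have := sqr_ge0 (g1 i x - g2 i x); nra.
by have := H1 x; have := H2 x; lra.
Qed.

Lemma midpoint_hull_near m h g x c e : midpoint_hull m h g ->
  (forall k, (m <= k)%N -> `|v k x - c| <= e) -> `|h x - c| <= e.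
Proof.
move=> + H; elim=> [k mk|h1 g1 h2 g2 _ H1 _ H2]; first exact: H.
have -> : (h1 x + h2 x) / 2 - c = ((h1 x - c) + (h2 x - c)) / 2 by field.
rewrite normrM (ger0_norm (_ : 0 <= 2^-1)) ?invr_ge0// ler_pdivrMr//.
by rewrite (le_trans (ler_normD _ _))//; lra.
Qed.

(* The gradients of the approximations need not converge; their midpoints do
   along a sequence (Mazur), and satisfy the same pointwise bound. *)
Theorem weak_grad_of_lipschitz_limit : exists2 G, weak_grad V G &
  {ae row_lebesgue n, forall x, enorm (G x) <= M}.
Proof.
pose mu := row_lebesgue n : {sigma_finite_measure set 'rV[R]_n -> \bar R}.
have [w [mw w0 wi]] := @row_weight R n.
pose P m : set ('I_n -> 'rV[R]_n -> R) := [set g | exists h, midpoint_hull m h g].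
have [g [Pg gcv]] : exists g : nat -> 'I_n -> 'rV[R]_n -> R, (forall j, P j (g j)) /\
    {ae row_lebesgue n, forall x, forall i, cvgn (fun j => g j i x)}.
  apply: (@mazur_ae_cvg R _ _ n (row_lebesgue n) w (M ^+ 2) P) => //.
  - by move=> m; exists (d m), (v m); exact: midpoint_hull_base.
  - by move=> m m' mm' g [h hg]; exists h; exact: midpoint_hull_decr hg.
  - by move=> m g1 g2 [h1 H1] [h2 H2]; eexists; exact: midpoint_hull_avg H1 H2.
  - move=> m g i [h hg]; apply: continuous_row_measurable.
    exact: midpoint_hull_continuous hg i.
  - by move=> m g x [h hg]; exact: midpoint_hull_bound hg x.
have /choice[h hP] : forall j, exists h, midpoint_hull j h (g j) by exact: Pg.
(* One measurable null set holds all exceptional points; the statements below are proved off it. *)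
have [N [mN N0 NP]] : {ae row_lebesgue n, forall x,
    (forall i, cvgn (fun j => g j i x)) /\ (v k x @[k --> \oo] --> V x)}.
  by apply: filterS2 gcv vV => x; split.
have good x : ~ N x -> (forall i, cvgn (fun j => g j i x)) /\ (v k x @[k --> \oo] --> V x).
  by move=> Nx; apply: contrapT => H; apply: Nx; exact: NP.
have aeN (Q : 'rV[R]_n -> Prop) : (forall x, ~ N x -> Q x) ->
    {ae row_lebesgue n, forall x, Q x}.
  move=> QN; exists N; split=> // x /= Qx; apply: contrapT => /QN; exact: Qx.
(* Setting the fields to 0 on [N] makes them converge everywhere, so that [G] is a pointwise limit
   of measurable functions. *)
pose gE j i x := g j i x * \1_(~` N) x.
have gEN x j i : ~ N x -> gE j i x = g j i x.
  by move=> Nx; rewrite /gE indicE mem_set// mulr1.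
have gE0 x j i : N x -> gE j i x = 0.
  by move=> Nx; rewrite /gE indicE memNset ?mulr0//; exact.
pose G x := \row_i limn (fun j => gE j i x).
have gEG x i : gE j i x @[j --> \oo] --> G x ord0 i.
  rewrite mxE; have [Nx|Nx] := pselect (N x).
    have -> : (fun j => gE j i x) = cst 0 by apply/funext => j; rewrite gE0.
    by apply: cvgP; exact: cvg_cst.
  have -> : (fun j => gE j i x) = (fun j => g j i x) by apply/funext => j; rewrite gEN.
  by have [/(_ i)] := good x Nx.
have mgE j i : measurable_fun setT (gE j i).
  apply: measurable_funM.
    by apply: continuous_row_measurable; exact: midpoint_hull_continuous (hP j) i.
  by apply: measurable_indic; exact: measurableC.
have mG i : measurable_fun setT (fun x => G x ord0 i).
  by apply: (measurable_fun_cvg (h := fun j => gE j i)) => // x _; exact: gEG.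
have G_le x : enorm (G x) <= M.
  rewrite -(@ler_pXn2r _ 2) ?nnegrE ?enorm_ge0// enorm_sqr.
  have cG : \sum_(i < n) gE j i x * gE j i x @[j --> \oo] --> dotv (G x) (G x).
    apply: (@cvg_big R 'I_n +%R 0 xpredT add_continuous nat \oo _
      (fun i j => gE j i x * gE j i x)) => i _.
    exact: cvgM (gEG x i) (gEG x i).
  rewrite -(cvg_lim (@Rhausdorff R) cG); apply: limr_le; first exact: cvgP cG.
  apply: nearW => j; have [Nx|Nx] := pselect (N x).
    by rewrite big1 ?sqr_ge0// => i _; rewrite gE0// mul0r.
  apply: le_trans (midpoint_hull_bound (hP j) x); rewrite le_eqVlt; apply/orP; left.
  by apply/eqP/eq_bigr => i _; rewrite gEN// expr2.
have G_coord x i : `|G x ord0 i| <= M by rewrite (le_trans (le_coord_enorm _ _)).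
(* Convergence at a single point bounds all values there; the Lipschitz bound then dominates every
   [v k] and [h j] by [Bx]. *)
have [x1 Nx1] := row_lebesgue_null_notT mN N0.
have [B1 vB1] : exists B1, forall k, `|v k x1| <= B1.
  have [_ /cvgP/cvg_seq_bounded[B1 [_ HB]]] := good x1 Nx1.
  exists (`|B1| + 1) => k; apply: HB => //.
  by rewrite ltr_pwDr// ler_norm.
pose Bx x := B1 + M * enorm (x - x1).
have cBx : continuous Bx.
  move=> x; have c1 : {for x, continuous (fun _ : 'rV[R]_n => B1)} by exact: cst_continuous.
  have c2 : {for x, continuous (fun _ : 'rV[R]_n => M)} by exact: cst_continuous.
  exact: (continuousD c1 (continuousM c2 (enorm_continuous (c := x1) (x := x)))).
have vBx k x : `|v k x| <= Bx x.
  rewrite -[v k x](subrK (v k x1)) addrC (le_trans (ler_normD _ _))// lerD//.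
  rewrite ler_norml lip andbT lerNl opprB.
  by rewrite -enormN opprB lip.
have hBx j x : `|h j x| <= Bx x.
  rewrite -[h j x]subr0; apply: midpoint_hull_near (hP j) _ => k _.
  by rewrite subr0.
have hV x : ~ N x -> h j x @[j --> \oo] --> V x.
  move=> Nx; have [_ vVx] := good x Nx; apply/cvgrPdist_le => e e0.
  have /cvgrPdist_le/(_ e e0)[K _ HK] := vVx.
  exists K => // j /= Kj; rewrite distrC; apply: midpoint_hull_near (hP j) _ => k jk.
  by rewrite distrC; apply: HK => /=; exact: leq_trans jk.
have ch j : continuous (h j).
  apply: (continuous_of_partials (midpoint_hull_derive (hP j))).
  exact: midpoint_hull_continuous (hP j).
exists G; last by apply: aeN.
split.
- move=> K cK; have mK := compact_row_measurable cK.
  have mvk k : measurable_fun K (v k).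
    apply: measurable_funTS; apply: continuous_row_measurable.
    exact: continuous_of_partials (dv k) (@cd k).
  have vVK : {ae row_lebesgue n, forall x, K x -> v k x @[k --> \oo] --> V x}.
    by apply: aeN => x /good[].
  have vBK : {ae row_lebesgue n, forall x, K x -> forall k, `|v k x| <= Bx x}.
    by apply: aeN => x _ _ k.
  by have [] := Rintegral_dominated_cvg mK mvk (measurable_funTS mV) vVK
    (continuous_compact_row_integrable cK cBx) vBK.
- move=> i K cK; apply: measurable_bounded_integrable.
  + exact: compact_row_measurable.
  + exact: compact_row_lty.
  + exact: measurable_funTS.
  + exists M; split; [exact: num_real|].
    by move=> y My x _ /=; rewrite (le_trans (G_coord x i))// ltW.
- move=> i phi Cphi; set e : 'rV[R]_n := delta_mx ord0 i.
  have [r r0 rphi] := C1c_cube Cphi.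
  have cphi := C1c_continuous Cphi; have cD := C1c_continuous_derive (v := e) Cphi.
  have cabs (f : 'rV[R]_n -> R) : continuous f -> continuous (fun x => `|f x|).
    move=> cf x; apply: (@continuous_comp 'rV[R]_n R R f (fun y => `|y|)); first exact: cf.
    exact: norm_continuous.
  have int1 : (row_lebesgue n).-integrable setT (EFin \o (fun x => Bx x * `|'D_e phi x|)).
    apply: (@continuous_cube_integrable _ _ r) => [x|x /rphi[_ ->]]; last by rewrite normr0 mulr0.
    exact: (continuousM (cBx x) (cabs _ cD x)).
  have int2 : (row_lebesgue n).-integrable setT (EFin \o (fun x => M * `|phi x|)).
    apply: (@continuous_cube_integrable _ _ r) => [x|x /rphi[-> _]]; last by rewrite normr0 mulr0.
    have cM : {for x, continuous (fun _ : 'rV[R]_n => M)} by exact: cst_continuous.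
    exact: (continuousM cM (cabs _ cphi x)).
  have mphi := continuous_row_measurable cphi; have mD := continuous_row_measurable cD.
  have m1 j : measurable_fun setT (fun x => h j x * 'D_e phi x).
    by apply: measurable_funM => //; exact: continuous_row_measurable.
  have m2 j : measurable_fun setT (fun x => g j i x * phi x).
    apply: measurable_funM => //; apply: continuous_row_measurable.
    exact: midpoint_hull_continuous (hP j) i.
  have c1 : {ae row_lebesgue n, forall x, setT x ->
      h j x * 'D_e phi x @[j --> \oo] --> V x * 'D_e phi x}.
    by apply: aeN => x Nx _; apply: cvgM; [exact: hV|exact: cvg_cst].
  have c2 : {ae row_lebesgue n, forall x, setT x ->
      g j i x * phi x @[j --> \oo] --> G x ord0 i * phi x}.
    apply: aeN => x Nx _; apply: cvgM; last exact: cvg_cst.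
    have -> : (fun j => g j i x) = (fun j => gE j i x) by apply/funext => j; rewrite gEN.
    exact: gEG.
  have b1 : {ae row_lebesgue n, forall x, setT x -> forall j,
      `|h j x * 'D_e phi x| <= Bx x * `|'D_e phi x|}.
    by apply: aeN => x _ _ j; rewrite normrM ler_wpM2r.
  have b2 : {ae row_lebesgue n, forall x, setT x -> forall j,
      `|g j i x * phi x| <= M * `|phi x|}.
    apply: aeN => x _ _ j; rewrite normrM ler_wpM2r//.
    rewrite -(@ler_pXn2r _ 2) ?nnegrE// real_normK ?num_real//.
    apply: le_trans (midpoint_hull_bound (hP j) x).
    by rewrite (bigD1 i)//= lerDl sumr_ge0// => k _; rewrite sqr_ge0.
  have [_ lim1] := Rintegral_dominated_cvg measurableT m1 (measurable_funM mV mD) c1 int1 b1.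
  have [_ lim2] := Rintegral_dominated_cvg measurableT m2 (measurable_funM (mG i) mphi) c2 int2 b2.
  have ibp j : \int[row_lebesgue n]_x (h j x * 'D_e phi x) =
      - \int[row_lebesgue n]_x (g j i x * phi x).
    apply: integration_by_parts_C1c => //.
    + by move=> x; exact: midpoint_hull_derive (hP j) i x.
    + exact: midpoint_hull_continuous (hP j) i.
  move: lim1; under eq_cvg do rewrite ibp; move=> lim1.
  exact: (cvg_unique (@Rhausdorff R) lim1 (cvgN lim2)).
Qed.

End lipschitz_limit.

Lemma is_derive_quadratic_error {R : realType} (f : R -> R) (s l C : R) :
  (forall h, `|f (s + h) - f s - h * l| <= C * h ^+ 2) -> is_derive s 1 f l.
Proof.
move=> fC; have C0 : 0 <= C.
  by have := fC 1; rewrite expr1n mulr1; exact: le_trans.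
suff cv : h^-1 *: ((f \o shift s) (h *: 1) - f s) @[h --> 0^'] --> l.
  by split; [apply/cvg_ex; exists l|exact: (cvg_lim (@Rhausdorff R) cv)].
apply/cvgrPdist_le => e e0.
have eC : 0 < e / (C + 1) by rewrite divr_gt0// ltr_wpDl.
near=> h.
have h0 : h != 0 by near: h; exact: nbhs_dnbhs_neq.
have -> : l - h^-1 *: ((f \o shift s) (h *: 1) - f s) =
    - (h^-1 * (f (s + h) - f s - h * l)).
  rewrite /= [h *: 1]mulr1 [h + s]addrC [_ *: _]/(_ * _).
  by rewrite (mulrBr h^-1 _ (h * l)) mulKf// opprB.
rewrite normrN normrM normfV ler_pdivrMl ?normr_gt0//.
apply: (le_trans (fC h)); rewrite -(real_normK (num_real h)) expr2 mulrA [leRHS]mulrC.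
rewrite ler_wpM2r//.
have : `|h| <= e / (C + 1).
  near: h; apply: dnbhs0_le; exact: eC.
rewrite ler_pdivlMr ?ltr_wpDl//; nra.
Unshelve. all: by end_near. Qed.

(** * Lipschitz bounds from weak gradients *)

Section bump_function.
Context {R : realType} {n : nat}.
Implicit Types (q : R) (c z v : 'rV[R]_n).

Lemma is_derive_max0_sqr (s : R) :
  is_derive s 1 (fun s => Num.max 0 s ^+ 2) (2 * Num.max 0 s).
Proof.
apply: (@is_derive_quadratic_error _ _ _ _ 1) => h; rewrite mul1r.
rewrite /Num.max; case: ltP => h1; case: ltP => h2.
- by rewrite (_ : _ - _ - _ = h ^+ 2) ?ger0_norm ?sqr_ge0//; ring.
- by rewrite !mulr0 expr0n/= !subr0 ger0_norm ?sqr_ge0//; nra.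
- rewrite expr0n/= sub0r (_ : - s ^+ 2 - h * (2 * s) = s * (- s - 2 * h)); last by ring.
  rewrite normrM (gtr0_norm h2) ger0_norm; nra.
- by rewrite !mulr0 expr0n/= !subr0 normr0 sqr_ge0.
Qed.

(** The square makes the truncation C^1, which is all that a test function needs; [q] is the square
    of the radius. *)
Definition radial_bump q c z : R := Num.max 0 (q - dotv (z - c) (z - c)) ^+ 2.

Definition radial_dbump q c v z : R :=
  - 4 * Num.max 0 (q - dotv (z - c) (z - c)) * dotv (z - c) v.

Lemma is_derive_bump_line q w v :
  is_derive (0 : R) 1
    (fun h : R => Num.max 0 (q - dotv (w + h *: v) (w + h *: v)) ^+ 2)
    (- 4 * Num.max 0 (q - dotv w w) * dotv w v).
Proof.
pose Q h := (q - dotv w w) + (- 2 * dotv w v) * h + (- dotv v v) * h ^+ 2.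
have QE h : q - dotv (w + h *: v) (w + h *: v) = Q h by rewrite dotv_addZ /Q; ring.
under eq_fun do rewrite QE.
have Q0 : Q 0 = q - dotv w w by rewrite /Q mulr0 expr0n/= mulr0 !addr0.
have D : is_derive (0 : R) 1 Q (- 2 * dotv w v + 2 * (- dotv v v) * 0).
  exact: is_derive_quad.
have := @is_derive1_comp _ (fun s => Num.max 0 s ^+ 2) Q 0 _ _ (is_derive_max0_sqr (Q 0)) D.
by move=> /is_derive_eq; apply; rewrite Q0 mulr0 addr0; ring.
Qed.

Lemma is_derive_bump q c z v : is_derive z v (radial_bump q c) (radial_dbump q c v z).
Proof.
apply/is_derive_line0; rewrite /radial_bump.
rewrite (_ : (fun h => _) = (fun h : R =>
  Num.max 0 (q - dotv (z - c + h *: v) (z - c + h *: v)) ^+ 2)).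
  exact: is_derive_bump_line.
by apply/funext => h; rewrite addrAC.
Qed.

Lemma is_derive_bump_center q c h z (s : R) :
  is_derive s 1 (fun s : R => radial_bump q (c + s *: h) z) (- radial_dbump q (c + s *: h) h z).
Proof.
have -> : (fun s : R => radial_bump q (c + s *: h) z) = (fun s : R =>
    Num.max 0 (q - dotv ((z - c) + s *: (- h)) ((z - c) + s *: (- h))) ^+ 2).
  by apply/funext => t; rewrite /radial_bump scalerN opprD addrA.
apply/(is_derive_line0 (V := R)).
rewrite (_ : (fun t => _) = (fun t : R => Num.max 0
   (q - dotv ((z - (c + s *: h)) + t *: (- h)) ((z - (c + s *: h)) + t *: (- h))) ^+ 2)).
  have := is_derive_bump_line q (z - (c + s *: h)) (- h).
  by move=> /is_derive_eq; apply; rewrite /radial_dbump -(scaleN1r h) dotvZr; ring.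
apply/funext => t; suff -> : z - c + (s + t *: 1) *: (- h) =
  z - (c + s *: h) + t *: (- h) by [].
by rewrite [t *: 1]mulr1 scalerDl opprD !scalerN !addrA.
Qed.

Lemma bump_ge0 q c z : 0 <= radial_bump q c z. Proof. exact: sqr_ge0. Qed.

Lemma continuous_max0_dotv q c : continuous (fun z => Num.max 0 (q - dotv (z - c) (z - c))).
Proof.
move=> z; have cz : {for z, continuous (fun z : 'rV[R]_n => z - c)}.
  by apply: (@continuousB R 'rV[R]_n 'rV[R]_n id (fun=> c)) => //; exact: cst_continuous.
have cq (r : R) : {for z, continuous (fun _ : 'rV[R]_n => r)} by exact: cst_continuous.
apply: (@continuous_max _ _ (fun=> 0) (fun z => q - dotv (z - c) (z - c))) => //.
exact: (continuousB (cq q) (continuous_dotv cz cz)).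
Qed.

Lemma continuous_bump q c : continuous (radial_bump q c).
Proof. by move=> z; have cm := @continuous_max0_dotv q c z; exact: (continuousM cm cm). Qed.

Lemma continuous_dbump q c v : continuous (radial_dbump q c v).
Proof.
move=> z; have cm := @continuous_max0_dotv q c z.
have cz : {for z, continuous (fun z : 'rV[R]_n => z - c)}.
  by apply: (@continuousB R 'rV[R]_n 'rV[R]_n id (fun=> c)) => //; exact: cst_continuous.
have cv : {for z, continuous (fun _ : 'rV[R]_n => v)} by exact: cst_continuous.
have c4 : {for z, continuous (fun _ : 'rV[R]_n => - 4 : R)} by exact: cst_continuous.
exact: (continuousM (continuousM c4 cm) (continuous_dotv cz cv)).
Qed.

Lemma bump_outside q c z : q <= dotv (z - c) (z - c) ->
  radial_bump q c z = 0 /\ forall v, radial_dbump q c v z = 0.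
Proof.
move=> qz; have m0 : Num.max 0 (q - dotv (z - c) (z - c)) = 0.
  by rewrite max_l// subr_le0.
by rewrite /radial_bump /radial_dbump m0 expr0n/=; split=> // v; rewrite mulr0 mul0r.
Qed.

Lemma bump_cube q c r z : 0 <= q -> enorm c + 1 + q <= r -> ~ cube n r z ->
  radial_bump q c z = 0 /\ forall v, radial_dbump q c v z = 0.
Proof.
move=> q0 cr zr; apply: bump_outside; rewrite leNgt; apply/negP => zq; apply: zr => i /=.
rewrite in_itv/= -ler_norml; apply: le_trans cr.
have -> : z ord0 i = c ord0 i + (z - c) ord0 i by rewrite !mxE [RHS]addrC subrK.
rewrite (le_trans (ler_normD _ _))// -addrA lerD ?le_coord_enorm//.
have := le_coord_dotv (z - c) i; rewrite -(real_normK (num_real _)).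
by have := sqr_ge0 (`|(z - c) ord0 i| - 1); nra.
Qed.

(** Uniform in the centre: it dominates the differentiation under the integral in
    [bump_translation]. *)
Lemma dbump_le q c v z : 0 <= q -> `|radial_dbump q c v z| <= 4 * q * (1 + q) * enorm v.
Proof.
move=> q0; have [qz|zq] := leP q (dotv (z - c) (z - c)).
  by rewrite (bump_outside qz).2 normr0 !mulr_ge0 ?enorm_ge0 ?addr_ge0.
have mE : Num.max 0 (q - dotv (z - c) (z - c)) = q - dotv (z - c) (z - c).
  by rewrite max_r// subr_ge0 ltW.
rewrite /radial_dbump mE !normrM normrN normr_nat -!mulrA ler_pM2l//.
apply: ler_pM => //.
  by rewrite ger0_norm ?subr_ge0 ?(ltW zq)// lerBlDr lerDl dotv_ge0.
have e1 : enorm (z - c) <= 1 + q.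
  rewrite -(@ler_pXn2r _ 2) ?nnegrE ?enorm_ge0 ?addr_ge0// enorm_sqr; nra.
rewrite ler_norml -lerNl; apply/andP; split.
  rewrite -mulN1r -[- 1 * _]dotvZl scaleN1r (le_trans (dotv_cauchy _ _))//.
  by rewrite enormN ler_wpM2r ?enorm_ge0.
by rewrite (le_trans (dotv_cauchy _ _))// ler_wpM2r ?enorm_ge0.
Qed.

Lemma bump_C1c q c : 0 <= q -> C1c (radial_bump q c).
Proof.
move=> q0; have DE v : 'D_v (radial_bump q c) = radial_dbump q c v.
  by apply/funext => z; have [_ ->] := is_derive_bump q c z v.
split.
  move=> v z _; split; first by have [] := is_derive_bump q c z v.
  by rewrite DE; exact: continuous_dbump.
exists (cube n (enorm c + 1 + q)); first exact: compact_cube.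
by move=> z zr; have [] := bump_cube q0 (lexx _) zr.
Qed.

End bump_function.

Section Rintegral_lemmas.
Context {d} {T : measurableType d} {R : realType} (mu : {measure set T -> \bar R}).

Lemma integrable_Rsum (I : Type) (s : seq I) (f : I -> T -> R) :
  (forall i, mu.-integrable setT (EFin \o f i)) ->
  mu.-integrable setT (EFin \o (fun x => \sum_(i <- s) f i x)).
Proof.
move=> fi; elim: s => [|i s IHs].
  by under eq_fun do rewrite big_nil; exact: integrable0.
have := integrableD measurableT (fi i) IHs.
by congr (integrable _ _ _); apply/funext => x /=; rewrite big_cons.
Qed.

Lemma Rintegral_sum (I : Type) (s : seq I) (f : I -> T -> R) :
  (forall i, mu.-integrable setT (EFin \o f i)) ->
  \int[mu]_x (\sum_(i <- s) f i x) = \sum_(i <- s) \int[mu]_x f i x.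
Proof.
move=> fi; elim: s => [|i s IHs].
  rewrite big_nil -[RHS](_ : \int[mu]_x (0 : R) = 0).
    by apply: eq_Rintegral => x _; rewrite big_nil.
  by rewrite /Rintegral integral0.
rewrite big_cons -IHs -RintegralD//; last exact: integrable_Rsum.
by apply: eq_Rintegral => x _; rewrite big_cons.
Qed.

Lemma ae_le_Rintegral (f g : T -> R) : mu.-integrable setT (EFin \o f) ->
  mu.-integrable setT (EFin \o g) -> {ae mu, forall x, f x <= g x} ->
  \int[mu]_x f x <= \int[mu]_x g x.
Proof.
move=> fi gi fg; have [/measurable_EFinP mf _] := integrableP _ _ _ fi.
have [/measurable_EFinP mg _] := integrableP _ _ _ gi.
rewrite -subr_ge0 -RintegralB//.
have -> : \int[mu]_x (g x - f x) = \int[mu]_x (Num.max (g x - f x) 0).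
  rewrite /Rintegral; congr fine; apply: ae_eq_integral => //.
  - by apply/measurable_EFinP; exact: measurable_funB.
  - by apply/measurable_EFinP; apply: measurable_maxr => //; exact: measurable_funB.
  - by apply: filterS fg => x fgx _; rewrite /= max_l// subr_ge0.
by apply: Rintegral_ge0 => x _; rewrite le_max lexx orbT.
Qed.

End Rintegral_lemmas.

(** * Averages against moving bumps *)

Section weak_gradient_bound.
Context {R : realType} {n : nat}.
Implicit Types (V : 'rV[R]_n -> R) (G : 'rV[R]_n -> 'rV[R]_n) (q : R) (x h : 'rV[R]_n).

Let mu := row_lebesgue n : {sigma_finite_measure set 'rV[R]_n -> \bar R}.

Lemma locally_integrable_mul V phi r : locally_integrable_row V ->
  continuous phi -> (forall z, ~ cube n r z -> phi z = 0) ->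
  (row_lebesgue n).-integrable setT (EFin \o (fun z => V z * phi z)).
Proof.
move=> Vi cphi phi0; have cK := @compact_cube R n r.
have [B [_ HB]] := compact_bounded (continuous_compact (continuous_subspaceT cphi) cK).
have bphi : [bounded phi z | z in cube n r].
  exists B; split; first exact: num_real.
  by move=> s Bs z zr; apply: HB => //; exists z.
have mphi : measurable_fun (cube n r) phi.
  by apply: measurable_funTS; exact: continuous_row_measurable.
have := integrableMl (measurable_cube (n := n) r) (Vi _ cK) mphi bphi.
move/(integrable_mkcond _ (@measurable_cube R n r)).
congr (integrable _ _ _); apply/funext => z; rewrite patchE/=.
by case: ifPn => //; rewrite notin_setE => /phi0 ->; rewrite mulr0.
Qed.

Lemma bump_integrable V q x : 0 <= q -> locally_integrable_row V ->
  (row_lebesgue n).-integrable setT (EFin \o (fun z => V z * radial_bump q x z)).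
Proof.
move=> q0 Vi; apply: (@locally_integrable_mul V _ (enorm x + 1 + q)) => //.
  exact: continuous_bump.
by move=> z /(bump_cube q0 (lexx _))[].
Qed.

Lemma dbump_sum q x h z :
  radial_dbump q x h z = \sum_i h ord0 i * radial_dbump q x (delta_mx ord0 i) z.
Proof.
rewrite /radial_dbump {2}/dotv mulr_sumr; apply: eq_bigr => i _.
by rewrite dotvC dotv_delta; ring.
Qed.

(** Differentiate in s the integral of [V] against the bump centred at x + s h. The derivative falls
    on the bump, whose translates are test functions, and the weak gradient moves it to [V]; [s] is
    the point given by the mean value theorem. *)
Lemma bump_translation V G q x h : 0 <= q -> weak_grad V G -> exists s : R,
  \int[row_lebesgue n]_z (V z * radial_bump q (x + h) z) -
  \int[row_lebesgue n]_z (V z * radial_bump q x z) =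
  \int[row_lebesgue n]_z (\sum_i h ord0 i * G z ord0 i * radial_bump q (x + s *: h) z).
Proof.
move=> q0 [Vi Gi wG].
pose f (s : R) z := V z * radial_bump q (x + s *: h) z.
pose F s := \int[row_lebesgue n]_z f s z.
(* One cube for all the centres x + s h with s in (-1, 2), an open interval around [0, 1]. *)
pose r := enorm x + 2 * enorm h + 1 + q.
have out s z : s \in `]-1, 2[ -> ~ cube n r z ->
    radial_bump q (x + s *: h) z = 0 /\ forall v, radial_dbump q (x + s *: h) v z = 0.
  rewrite in_itv/= => /andP[s1 s2]; apply: bump_cube => //.
  rewrite /r !lerD2r (le_trans (enormD _ _))// lerD2l enormZ ler_wpM2r ?enorm_ge0//.
  by rewrite ler_norml; apply/andP; split; lra.
pose C := 4 * q * (1 + q) * enorm h.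
have C0 : 0 <= C by rewrite !mulr_ge0 ?enorm_ge0 ?addr_ge0.
pose D z := `|V z| * C * \1_(cube n r) z.
have D_ge0 z : 0 <= D z 
  by apply: mulr_ge0; [exact: mulr_ge0|rewrite indicE ler0n].
have Di : (row_lebesgue n).-integrable setT (EFin \o D).
  have := integrable_norm (Vi _ (@compact_cube R n r)).
  move=> /(integrableZl (@measurable_cube R n r) C).
  move/(integrable_mkcond _ (@measurable_cube R n r)).
  congr (integrable _ _ _); apply/funext => z; rewrite patchE/= /D indicE.
  by case: ifPn => _; rewrite ?mulr1 ?mulr0// mulrC.
have fi s : (row_lebesgue n).-integrable setT (EFin \o f s) by exact: bump_integrable.
have df (s : R) (z : 'rV[R]_n) : is_derive s 1 (f ^~ z) (- (V z * radial_dbump q (x + s *: h) h z)).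
  have := is_deriveZ (V z) (is_derive_bump_center q x h z s).
  by move=> /is_derive_eq; apply; rewrite /GRing.scale/= mulrN.
have d1f (s : R) (z : 'rV[R]_n) : partial1of2 f s z = - (V z * radial_dbump q (x + s *: h) h z).
  by rewrite partial1of2E; have [_ ->] := df s z.
have dle (s : R) (z : 'rV[R]_n) : s \in `]-1, 2[ -> `|partial1of2 f s z| <= D z.
  move=> sI; rewrite d1f normrN normrM /D indicE.
  have [zr|zr] := pselect (cube n r z); last first.
    by rewrite (out _ _ sI zr).2 normr0 mulr0 memNset ?mulr0.
  by rewrite mem_set// mulr1 ler_wpM2l// dbump_le.
have dF (s : R) : s \in `]-1, 2[ ->
    is_derive s 1 F (\int[row_lebesgue n]_z (- (V z * radial_dbump q (x + s *: h) h z))).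
  move=> sI.
  have d1 := derivable_under_integral (mu := row_lebesgue n) measurableT sI
    (fun s _ => fi s) (fun s z _ _ => @ex_derive _ _ _ _ _ _ _ (df s z)) D_ge0 Di
    (fun s z sI _ => dle s z sI).
  have d2 := differentiation_under_integral (mu := row_lebesgue n) measurableT sI
    (fun s _ => fi s) (fun s z _ _ => @ex_derive _ _ _ _ _ _ _ (df s z)) D_ge0 Di
    (fun s z sI _ => dle s z sI).
  split; first exact: d1.
  rewrite -derive1E d2; apply: eq_Rintegral => z _; exact: d1f.
pose F' (s : R) := \int[row_lebesgue n]_z (- (V z * radial_dbump q (x + s *: h) h z)).
have dF01 (s : R) : s \in `]0, 1[%R -> is_derive s 1 F (F' s).
  by rewrite in_itv/= => /andP[s0 s1]; apply: dF; rewrite in_itv/=; apply/andP; split; lra.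
have cF : {within `[0, 1], continuous F}.
  apply: derivable_within_continuous => s; rewrite in_itv/= => /andP[s0 s1].
  suff /dF[] : s \in `]-1, 2[%R by [].
  by rewrite in_itv/=; apply/andP; split; lra.
have [s sI E] := MVT ltr01 dF01 cF.
exists s; move: E; rewrite subr0 mulr1 /F /f scale1r scale0r addr0 => ->.
have dbi i : (row_lebesgue n).-integrable setT
    (EFin \o (fun z => V z * radial_dbump q (x + s *: h) (delta_mx ord0 i) z)).
  apply: (@locally_integrable_mul V _ (enorm (x + s *: h) + 1 + q)) => //.
    exact: continuous_dbump.
  by move=> z /(bump_cube q0 (lexx _))[_].
have bi i : (row_lebesgue n).-integrable setT
    (EFin \o (fun z => G z ord0 i * radial_bump q (x + s *: h) z)).
  exact: bump_integrable.
transitivity (\int[row_lebesgue n]_z \sum_i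
    (- h ord0 i) * (V z * radial_dbump q (x + s *: h) (delta_mx ord0 i) z)).
  apply: eq_Rintegral => z _; rewrite dbump_sum mulr_sumr -sumrN.
  by apply: eq_bigr => i _; ring.
transitivity (\int[row_lebesgue n]_z \sum_i
    h ord0 i * (G z ord0 i * radial_bump q (x + s *: h) z)); last first.
  by apply: eq_Rintegral => z _; apply: eq_bigr => i _; rewrite mulrA.
rewrite !Rintegral_sum.
- apply: eq_bigr => i _; rewrite !RintegralZl//.
  rewrite mulNr -mulrN; congr (_ * _); apply: (canLR (@opprK R)).
  rewrite -(wG i _ (bump_C1c (x + s *: h) q0)).
  apply: eq_Rintegral => z _.
  by have [_ ->] := is_derive_bump q (x + s *: h) z (delta_mx ord0 i).
- by move=> i; exact: (integrableZl measurableT _ (bi i)).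
- by move=> i; exact: (integrableZl measurableT _ (dbi i)).
Qed.

End weak_gradient_bound.

Section lipschitz_of_weak_gradient.
Context {R : realType} {n : nat}.
Implicit Types (V : 'rV[R]_n -> R) (G : 'rV[R]_n -> 'rV[R]_n) (q : R) (x y h : 'rV[R]_n).

Lemma ae_row_nbhs (P : 'rV[R]_n -> Prop) x (U : set 'rV[R]_n) : nbhs x U ->
  {ae row_lebesgue n, forall y, P y} -> exists2 y, U y & P y.
Proof.
move=> /nbhs_ballP[r /= r0 rU] [A [mA A0 PA]]; apply: contrapT => noP.
pose I i : set R := [set` `[x ord0 i - r / 2, x ord0 i + r / 2]].
have mI i : measurable (I i) by exact: measurable_itv.
have : (0 < row_lebesgue n (row_box I))%E.
  apply: row_lebesgue_box_gt0 => // i; rewrite /I lebesgue_measure_itv/= lte_fin.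
  by rewrite ifT ?ltrD2l -?EFinB ?lte_fin; lra.
rewrite ltNge => /negP; apply; rewrite -A0; apply: le_measure; rewrite ?inE//.
  exact: measurable_row_box.
move=> y yI; apply: PA => Py; apply: noP; exists y => //; apply: rU.
apply/(row_ballP _ _ r0) => i; have := yI i; rewrite /I/= in_itv/= => /andP[y1 y2].
by rewrite ltr_norml; apply/andP; split; lra.
Qed.

Lemma weak_grad_cst (a : R) : weak_grad (fun _ : 'rV[R]_n => a) (fun=> 0).
Proof.
have ca (b : R) : continuous (fun _ : 'rV[R]_n => b) by move=> x; exact: cst_continuous.
have G0 (i : 'I_n) : (fun _ : 'rV[R]_n => (0 : 'rV[R]_n) ord0 i) = fun=> 0.
  by apply/funext => x; rewrite mxE.
split=> [K cK|i K cK|i phi Cphi]; rewrite ?G0.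
- exact: continuous_compact_row_integrable.
- exact: (continuous_compact_row_integrable cK (ca 0)).
- under [in RHS]eq_Rintegral do rewrite mxE.
  exact: (@integration_by_parts_C1c _ _ i (fun=> a) (fun=> 0)).
Qed.

Lemma bump_integrable1 q x : 0 <= q ->
  (row_lebesgue n).-integrable setT (EFin \o radial_bump q x).
Proof.
move=> q0; have [i1 _ _] := weak_grad_cst 1; have := bump_integrable x q0 i1.
by congr (integrable _ _ _); apply/funext => z /=; rewrite mul1r.
Qed.

(** Moving the bump against the constant 1, whose weak gradient is 0, replaces a change of
    variables. *)
Lemma bump_mass q x h : 0 <= q ->
  \int[row_lebesgue n]_z radial_bump q (x + h) z = \int[row_lebesgue n]_z radial_bump q x z.
Proof.
move=> q0; have [s] := bump_translation x h q0 (weak_grad_cst 1).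
have E c : \int[row_lebesgue n]_z (1 * radial_bump q c z) =
    \int[row_lebesgue n]_z radial_bump q c z.
  by apply: eq_Rintegral => z _; rewrite mul1r.
rewrite !E [X in _ = X](_ : _ = 0) => [/eqP|]; first by rewrite subr_eq0 => /eqP.
rewrite -[RHS](_ : \int[row_lebesgue n]_z (0 : R) = 0); last by rewrite /Rintegral integral0.
by apply: eq_Rintegral => z _; apply: big1 => i _; rewrite mxE mulr0 mul0r.
Qed.

Lemma bump_mass_gt0 q x : 0 < q -> 0 < \int[row_lebesgue n]_z radial_bump q x z.
Proof.
move=> q0; have bi := bump_integrable1 x (ltW q0).
rewrite lt_neqAle Rintegral_ge0 ?andbT => [|z _]; last exact: bump_ge0.
apply/eqP => I0'; have I0 : (\int[row_lebesgue n]_z (radial_bump q x z)%:E = 0)%E.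
  by rewrite -[LHS]fineK ?integrable_fin_num// [fine _](esym I0').
have [/measurable_EFinP mb _] := integrableP _ _ _ bi.
have [+ _] := ae_eq_integral_abs (row_lebesgue n) measurableT
  (f := EFin \o radial_bump q x) (iffRL (measurable_EFinP _ _) mb).
have -> : (\int[row_lebesgue n]_z `|(EFin \o radial_bump q x) z| = 0)%E.
  by rewrite -I0; apply: eq_integral => z _; rewrite /= ger0_norm ?bump_ge0.
move=> /(_ erefl) b0.
have pos : \forall z \near x, 0 < radial_bump q x z.
  have := @continuous_bump R n q x x.
  move/cvgr_gt; apply; rewrite /radial_bump subrr.
  rewrite exprn_gt0// lt_max (_ : dotv 0 0 = 0) ?subr0 ?q0 ?orbT//.
  by rewrite -enorm_sqr enorm0 expr0n.
have [z z0] := ae_row_nbhs pos b0.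
by move=> /(_ I) []/= zE; move: z0; rewrite zE ltxx.
Qed.

(** Take bumps of equal mass at the two points. The averages of [V] differ by an average of G . (y -
    x), and small bumps bring each average close to the value at its centre. Continuity is asked at
    the two points only, since a negative power of [u0] may fail to be continuous at the zeros of
    [u0]. *)
Lemma lipschitz_at_of_weak_grad V G M x y : 0 <= M -> weak_grad V G ->
  {ae row_lebesgue n, forall z, enorm (G z) <= M} ->
  {for x, continuous V} -> {for y, continuous V} -> V y - V x <= M * enorm (y - x).
Proof.
move=> M0 wG GM cx cy; apply/ler_addgt0Pr => e e0.
have near_bump c : {for c, continuous V} -> exists2 q0, 0 < q0 &
    forall q z, 0 < q <= q0 -> radial_bump q c z != 0 -> `|V z - V c| <= e / 2.
  move=> cV.
  have /nbhs_ballP[r /= r0 rV] : \forall z \near c, `|V c - V z| <= e / 2.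
    by apply: (proj1 (@cvgrPdist_le _ _ _ (nbhs c) _ V (V c)) cV); rewrite divr_gt0.
  exists (r ^+ 2); first exact: exprn_gt0.
  move=> q z /andP[q0 qr] bz; rewrite distrC; apply: rV; apply/(row_ballP _ _ r0) => i.
  have zq : dotv (z - c) (z - c) < q.
    by rewrite ltNge; apply: contra bz => /bump_outside[-> _].
  rewrite distrC -(@ltr_pXn2r _ 2) ?nnegrE ?(ltW r0)// real_normK ?num_real//.
  by have := le_coord_dotv (z - c) i; rewrite !mxE; lra.
have [q1 q10 H1] := near_bump x cx.
have [q2 q20 H2] := near_bump y cy.
pose q := Num.min q1 q2.
have q0 : 0 < q by rewrite lt_min q10.
have qq1 : 0 < q <= q1 by rewrite q0 ge_min lexx.
have qq2 : 0 < q <= q2 by rewrite q0 ge_min lexx orbT.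
have [Vi Gi _] := wG.
have [s] := bump_translation x (y - x) (ltW q0) wG; rewrite [x + (y - x)]addrC subrK.
set I := \int[row_lebesgue n]_z radial_bump q x z.
have I0 : 0 < I by exact: bump_mass_gt0.
have IE c : \int[row_lebesgue n]_z radial_bump q c z = I.
  by rewrite -[c](subrK x) [c - x + x]addrC bump_mass// ltW.
have scale_int (a : R) c : (row_lebesgue n).-integrable setT
    (EFin \o (fun z => a * radial_bump q c z)).
  exact: (integrableZl measurableT _ (bump_integrable1 c (ltW q0))).
have RE (a : R) c : \int[row_lebesgue n]_z (a * radial_bump q c z) = a * I.
  by rewrite RintegralZl ?IE//; exact: bump_integrable1 (ltW q0).
have Vint c := bump_integrable c (ltW q0) Vi.
have lower : (V y - e / 2) * I <= \int[row_lebesgue n]_z (V z * radial_bump q y z).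
  rewrite -(RE _ y); apply: ae_le_Rintegral => //; apply: nearW => z.
  have [->|b0] := eqVneq (radial_bump q y z) 0; first by rewrite !mulr0.
  rewrite ler_wpM2r ?bump_ge0//.
  by have := H2 _ _ qq2 b0; rewrite ler_norml => /andP[]; lra.
have upper : \int[row_lebesgue n]_z (V z * radial_bump q x z) <= (V x + e / 2) * I.
  rewrite -(RE _ x); apply: ae_le_Rintegral => //; apply: nearW => z.
  have [->|b0] := eqVneq (radial_bump q x z) 0; first by rewrite !mulr0.
  rewrite ler_wpM2r ?bump_ge0//.
  by have := H1 _ _ qq1 b0; rewrite ler_norml => /andP[]; lra.
set c := x + s *: (y - x).
have grd : \int[row_lebesgue n]_z (\sum_i (y - x) ord0 i * G z ord0 i * radial_bump q c z)
    <= M * enorm (y - x) * I.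
  rewrite -(RE _ c); apply: ae_le_Rintegral => //.
    apply: integrable_Rsum => i.
    have iZ := integrableZl measurableT ((y - x) ord0 i) (bump_integrable c (ltW q0) (Gi i)).
    rewrite (_ : EFin \o _ =
      fun z => (((y - x) ord0 i)%:E * (G z ord0 i * radial_bump q c z)%:E)%E)//.
    apply/funext => z; exact: (congr1 EFin (esym (mulrA _ _ _))).
  apply: filterS GM => z Gz; rewrite -mulr_suml ler_wpM2r ?bump_ge0//.
  rewrite (le_trans (dotv_cauchy _ _))// mulrC ler_wpM2r ?enorm_ge0//.
rewrite -(ler_pM2r I0) [in leRHS]mulrDl; move: lower upper grd.
move: (Rintegral _ _ (fun z => V z * radial_bump q y z)) => A.
move: (Rintegral _ _ (fun z => V z * radial_bump q x z)) => B.
move: (Rintegral _ _ _) (M * _ * I) (V y) (V x) => C D a b lower upper grd E.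
by move: lower upper grd; rewrite -E; lra.
Qed.

End lipschitz_of_weak_gradient.

(** * The initial datum *)

Section powR_shift.
Context {R : realType}.
Implicit Types (a b eps p r : R).

Lemma powR_subadditive a c r : 0 <= a -> 0 <= c -> 0 < r -> r <= 1 ->
  (a + c) `^ r <= a `^ r + c `^ r.
Proof.
move=> a0 c0 r0 r1; have [a00|a0'] := eqVneq a 0.
  by rewrite a00 add0r powR0 ?gt_eqF// add0r.
have ac : 0 < a + c by rewrite ltr_wpDr// lt_neqAle eq_sym a0'.
(* t <= t^r for t in [0, 1]: each summand yields at least its share of the power of the sum. *)
have share b : 0 <= b -> b <= a + c -> b / (a + c) * (a + c) `^ r <= b `^ r.
  move=> b0 bac; have [->|b0'] := eqVneq b 0; first by rewrite !mul0r powR_ge0.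
  have bpos : 0 < b by rewrite lt_neqAle eq_sym b0'.
  have := @ger1_powR R (b / (a + c)) r.
  rewrite divr_gt0// ler_pdivrMr// mul1r bac => /(_ isT r1) h.
  rewrite (le_trans (ler_wpM2r (powR_ge0 _ _) h))//.
  by rewrite -powRM ?divfK ?gt_eqF// ?divr_ge0// ltW.
have := lerD (share _ a0 _) (share _ c0 _); rewrite lerDl lerDr -!mulrDl => /(_ c0 a0).
by rewrite divff ?gt_eqF// mul1r.
Qed.

(** For p < 1 the derivative of s^p does not grow in absolute value with s, so shifting both points
    up brings their powers closer: s^p - (s + eps)^p is monotone in a direction given by the sign of
    [p]. *)
Lemma powR_shift_le p a b eps : p < 1 -> 0 < eps -> 0 < a -> 0 < b ->
  `|(b + eps) `^ p - (a + eps) `^ p| <= `|b `^ p - a `^ p|.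
Proof.
move=> p1 e0; wlog ab : a b / a < b => [H a0 b0|a0 b0].
  have [ab|ba|->] := ltgtP a b; first exact: H.
    by rewrite distrC [leRHS]distrC; exact: H.
  by rewrite !subrr.
pose g (s : R) := s `^ p - (s + eps) `^ p.
have dg (c : R) : 0 < c -> is_derive c 1 g (p * c `^ (p - 1) - p * (c + eps) `^ (p - 1)).
  move=> c0; apply: is_deriveB; first exact: is_derive1_powR.
  have ce : 0 < c + eps by rewrite addr_gt0.
  have D1 : is_derive c 1 (fun s : R => s + eps) (1 + 0) by apply: is_deriveD.
  have := @is_derive1_comp _ (fun s => s `^ p) (fun s => s + eps) c _ _ (is_derive1_powR p ce) D1.
  by move=> /is_derive_eq; apply; rewrite addr0 mulr1.
have [c|c|c cI E] := @MVT R g (fun c => p * c `^ (p - 1) - p * (c + eps) `^ (p - 1)) a b ab.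
- by rewrite in_itv/= => /andP[ac _]; apply: dg; exact: lt_trans ac.
- apply: derivable_within_continuous c => c; rewrite in_itv/= => /andP[ac _].
  by have [] := dg c (lt_le_trans a0 ac).
have c0 : 0 < c by move: cI; rewrite in_itv/= => /andP[/(lt_trans a0)].
have mono : (c + eps) `^ (p - 1) <= c `^ (p - 1).
  by rewrite le0_ler_powR// ?subr_le0 ?ltW// ltrDl.
have ae0 : 0 < a + eps by rewrite addr_gt0.
have abe : a + eps <= b + eps by rewrite lerD2r ltW.
have gE : g b - g a = p * ((c `^ (p - 1) - (c + eps) `^ (p - 1)) * (b - a)).
  by rewrite E; ring.
have K0 : 0 <= (c `^ (p - 1) - (c + eps) `^ (p - 1)) * (b - a).
  by rewrite mulr_ge0// subr_ge0// ltW.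
have [p0|p0] := leP 0 p.
  have := mulr_ge0 p0 K0; rewrite -gE /g => h.
  rewrite !ger0_norm ?subr_ge0; [lra|rewrite ge0_ler_powR// ?nnegrE ltW//..].
  - exact: lt_le_trans abe.
have := mulr_le0_ge0 (ltW p0) K0; rewrite -gE /g => h.
by rewrite !ler0_norm ?subr_le0 ?le0_ler_powR// ?(ltW p0) ?(ltW ab)//; lra.
Qed.

Lemma powR_shift_le0 p a b eps : p < 1 -> 0 < eps -> 0 <= a -> 0 <= b ->
  (p <= 0 -> 0 < a) -> (p <= 0 -> 0 < b) ->
  `|(b + eps) `^ p - (a + eps) `^ p| <= `|b `^ p - a `^ p|.
Proof.
move=> p1 e0 a0 b0 pa pb; have [p0|p0] := leP p 0.
  by apply: powR_shift_le => //; [exact: pa|exact: pb].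
(* At the base point 0 with a positive exponent the derivative is singular; subadditivity takes the
   place of the mean value theorem. *)
have zero c : 0 <= c -> `|(c + eps) `^ p - (0 + eps) `^ p| <= `|c `^ p - 0 `^ p|.
  move=> c0; rewrite powR0 ?gt_eqF// subr0 add0r !ger0_norm ?powR_ge0//.
    by rewrite lerBlDr powR_subadditive// ltW.
  by rewrite subr_ge0 ge0_ler_powR ?nnegrE ?addr_ge0 ?(ltW p0) ?(ltW e0)// lerDr.
have [->|a0'] := eqVneq a 0; first exact: zero.
have [->|b0'] := eqVneq b 0; first by rewrite distrC [leRHS]distrC; exact: zero.
by apply: powR_shift_le => //; rewrite lt_neqAle eq_sym ?a0' ?b0'.
Qed.

(** For exponents in (0, 1] subadditivity gives |c^r - b^r| <= |c - b|^r, also at 0; hence the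
    modulus e^(1/r). *)
Lemma powR_cvg {T : Type} {F : set_system T} {FF : Filter F} (h : T -> R) a r :
  r <= 1 -> (r <= 0 -> 0 < a) -> 0 <= a -> (\forall t \near F, 0 <= h t) ->
  h t @[t --> F] --> a -> h t `^ r @[t --> F] --> a `^ r.
Proof.
move=> r1 ra a0 h0 ha; have [r0|r0] := leP r 0.
  apply: (cvg_comp _ (fun x : R => x `^ r) ha).
  suff : {for a, continuous (fun x : R => x `^ r)} by [].
  apply: differentiable_continuous; apply/derivable1_diffP.
  by have [] := is_derive1_powR r (ra r0).
apply/cvgrPdist_le => e e0.
have e1 : 0 < e `^ r^-1 by rewrite powR_gt0.
move/cvgrPdist_le : ha => /(_ _ e1).
apply: filterS2 h0 => t ht tae.
have key b c : 0 <= b -> b <= c -> `|c - b| <= e `^ r^-1 -> `|c `^ r - b `^ r| <= e.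
  move=> b0 bc cb; rewrite ger0_norm; last first.
    by rewrite subr_ge0 ge0_ler_powR ?nnegrE ?(ltW r0)// (le_trans b0).
  rewrite lerBlDl; have := @powR_subadditive b (c - b) r b0.
  rewrite subr_ge0 bc [b + _]addrC subrK => /(_ isT r0 r1) /le_trans; apply.
  rewrite lerD2l; have -> : e = (e `^ r^-1) `^ r by rewrite -powRrM mulVf ?gt_eqF// powRr1 ?ltW.
  move: cb; rewrite ger0_norm ?subr_ge0// => cb.
  by rewrite ge0_ler_powR ?nnegrE ?subr_ge0 ?(ltW r0) ?(ltW e1)//.
have [ah|/ltW ha] := leP a (h t).
  by rewrite distrC; apply: key => //; rewrite distrC.
exact: key.
Qed.

End powR_shift.

(** * The Lipschitz bound for the regularized initial datum *)

Section initial_lipschitz.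
Context {R : realType} {n : nat}.
Variables (u0 : 'rV[R]_n -> R) (p M eps : R).
Hypotheses (cu0 : continuous u0) (u0_ge0 : forall x, 0 <= u0 x) (p1 : p < 1) (p0 : p != 0).
Hypotheses (M0 : 0 <= M) (Hgrad : grad_pow_le u0 p M) (eps0 : 0 < eps).

Let W x := (u0 x + eps) `^ p.

Let continuous_pow x : (p < 0 -> 0 < u0 x) -> {for x, continuous (fun x => u0 x `^ p)}.
Proof.
move=> px; apply: (@powR_cvg _ _ (nbhs x) _ u0 (u0 x) p) => //; first exact: ltW.
- by rewrite le_eqVlt (negbTE p0).
- exact: nearW.
- exact: cu0.
Qed.

Let continuous_W : continuous W.
Proof.
move=> x; have Wpos : 0 < u0 x + eps by rewrite ltr_wpDl.
apply: (@powR_cvg _ _ (nbhs x) _ (fun x => u0 x + eps) (u0 x + eps) p) => //.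
- exact: ltW.
- exact: ltW.
- by apply: nearW => y; rewrite addr_ge0// ltW.
- by apply: cvgD; [exact: cu0|exact: cvg_cst].
Qed.

Let lip_pos x y : (p < 0 -> 0 < u0 x) -> (p < 0 -> 0 < u0 y) ->
  W x - W y <= M * enorm (x - y).
Proof.
move=> px py; have [_ [G wG GM]] := Hgrad.
have lip a b : (p < 0 -> 0 < u0 a) -> (p < 0 -> 0 < u0 b) ->
    u0 b `^ p - u0 a `^ p <= M * enorm (b - a).
  by move=> pa pb; apply: lipschitz_at_of_weak_grad wG GM _ _ => //; exact: continuous_pow.
have lipn : `|u0 x `^ p - u0 y `^ p| <= M * enorm (x - y).
  by rewrite ler_norml lerNl opprB -{1}[x - y]opprB enormN !lip.
apply: le_trans lipn; apply: (le_trans (ler_norm _)).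
have pN : p <= 0 -> p < 0 by rewrite le_eqVlt (negbTE p0).
by apply: powR_shift_le0 => //; [move=> /pN/py|move=> /pN/px].
Qed.

(** For negative [p] the bound is available where [u0] is positive; this set has full measure, hence
    is dense, and [W] is continuous everywhere because u0 + eps is positive. *)
Lemma initial_lipschitz x y : W x - W y <= M * enorm (x - y).
Proof.
have [pn|pp] := ltP p 0; last by apply: lip_pos => pn; move: (lt_le_trans pn pp); rewrite ltxx.
have [/(_ pn) u0pos _] := Hgrad.
apply/ler_addgt0Pr => e e0.
(* Of the error, e/4 goes to each of the two values of [W], and 2 M e / (4 (M + 1)) <= e/2 to the
   displacement of the two points. *)
have d0 : 0 < e / (4 * (M + 1)) by rewrite divr_gt0// mulr_gt0// ltr_wpDl.
have approx z : exists2 z', 0 < u0 z' & `|W z' - W z| <= e / 4 /\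
    enorm (z' - z) <= e / (4 * (M + 1)).
  have e4 : 0 < e / 4 by rewrite divr_gt0.
  have n1 : \forall z' \near z, `|W z - W z'| <= e / 4.
    by have /cvgrPdist_le/(_ _ e4) := @continuous_W z.
  have n2 : \forall z' \near z, `|enorm (z - z) - enorm (z' - z)| <= e / (4 * (M + 1)).
    by have /cvgrPdist_le/(_ _ d0) := @enorm_continuous R n z z.
  have [z' [w1 w2] z'0] := ae_row_nbhs (filterI n1 n2) u0pos.
  exists z' => //; split; first by rewrite distrC.
  by move: w2; rewrite subrr enorm0 sub0r normrN ger0_norm// enorm_ge0.
have [x' x'0 [wx ex]] := approx x.
have [y' y'0 [wy ey]] := approx y.
have := lip_pos (fun=> x'0) (fun=> y'0) => lip.
have tri : enorm (x' - y') <= enorm (x - y) + 2 * (e / (4 * (M + 1))).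
  rewrite (_ : x' - y' = (x - y) + ((x' - x) - (y' - y))).
    rewrite (le_trans (enormD _ _))// lerD2l (le_trans (enormD _ _))// enormN; lra.
  by apply/rowP => i; rewrite !mxE; ring.
have Mtri : M * enorm (x' - y') <= M * enorm (x - y) + e / 2.
  rewrite (le_trans (ler_wpM2l M0 tri))// mulrDr lerD2l.
  have -> : M * (2 * (e / (4 * (M + 1)))) = e / 2 * (M / (M + 1)).
    by field; rewrite gt_eqF// ltr_wpDl.
  rewrite ger_pMr ?divr_gt0// ler_pdivrMr ?ltr_wpDl// mul1r; lra.
move: wx wy; rewrite !ler_norml => /andP[wx1 wx2] /andP[wy1 wy2].
move: lip Mtri wx1 wx2 wy1 wy2; move: (M * _) (M * _) => A B; lra.
Qed.

End initial_lipschitz.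

(** * The vanishing viscosity limit *)

(** Fubini for a null set: both orders of integration give the same measure, so the measures of its
    sections have integral 0. *)
Lemma ae_ysection {d1 d2} {T1 : measurableType d1} {T2 : measurableType d2} {R : realType}
    (m1 : {sigma_finite_measure set T1 -> \bar R})
    (m2 : {sigma_finite_measure set T2 -> \bar R}) (P : T1 * T2 -> Prop) :
  {ae (m1 \x m2)%E, forall z, P z} ->
  {ae m2, forall y, {ae m1, forall x, P (x, y)}}.
Proof.
move=> [A [mA A0 PA]].
have I0 : (\int[m2]_y m1 (ysection A y) = 0)%E.
  have := @product_measure_unique _ _ _ _ R m1 m2 (m1 \x^ m2)%E
    (fun B C mB mC => product_measure2E m1 m2 mB mC) A mA.
  by rewrite A0.
have mS := measurable_fun_ysection m1 mA.
have [+ _] := ae_eq_integral_abs m2 measurableT mS.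
under eq_integral do rewrite gee0_abs//.
move=> /(_ I0); apply: filterS => y /(_ I)/= Ay.
exists (ysection A y); split; [exact: measurable_ysection|exact: Ay|].
by move=> x nP; rewrite /ysection/= inE; exact: PA.
Qed.

Lemma partially_decreasing {R : realType} (f : R -> R -> R) :
  C1_on [set tv : R * R | 0 < tv.1] (fun tv : R * R => f tv.1 tv.2) ->
  (forall t v, 0 < t -> derive1 (f t) v <= 0) ->
  forall t v w, 0 < t -> v <= w -> f t w <= f t v.
Proof.
move=> C1 f'0 t v w t0 vw.
have df (s : R) : derivable (f t) s 1.
  have [/derivableP D _] := C1 (0, 1) (t, s) t0.
  have := (iffLR (is_derive_line0 _ _ _ _)) D.
  rewrite (_ : (fun h : R => _) = (fun h : R => f t (s + h *: 1))).
    by move=> /(iffRL (is_derive_line0 _ _ _ _)) [].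
  by apply/funext => h /=; rewrite [h *: (0 : R)]mulr0 addr0.
apply: (@ler0_derive1_nincr _ (f t) v w) => //.
- by move=> x _; exact: f'0.
- exact: derivable_within_continuous.
Qed.

Lemma grad_pow_le0 {R : realType} {n : nat} (g : 'rV[R]_n -> R) (M : R) : 0 <= M ->
  grad_pow_le g 0 M.
Proof.
move=> M0; split; first by rewrite ltxx.
exists (fun=> 0); last by apply: nearW => x; rewrite enorm0.
by under eq_fun do rewrite powRr0; exact: weak_grad_cst.
Qed.

Section vanishing_viscosity.
Context {R : realType} {N : nat}.
Variables (gamma p M : R) (f : R -> R -> R) (u0 : 'rV[R]_N -> R).
Variable ueps : R -> 'rV[R]_N * R -> R.
Hypotheses (N1 : (1 <= N)%N) (p0 : p != 0) (p1 : p < 1) (M0 : 0 < M).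
Hypothesis cond : N%:R - 1 + 4 * (p - 1) ^+ 2 + 4 * gamma * (p - 1) <= 0.
Hypothesis f_ge0 : forall t v, 0 < t -> 0 <= f t v.
Hypothesis f_decr : forall t v w, 0 < t -> v <= w -> f t w <= f t v.
Hypothesis cu0 : continuous u0.
Hypothesis u0b : exists K, forall x, `|u0 x| <= K.
Hypothesis u0_ge0 : forall x, 0 <= u0 x.
Hypothesis Hgrad : grad_pow_le u0 p M.
Hypothesis sol : forall eps, 0 < eps -> classical_solution gamma f u0 eps (ueps eps).
Hypothesis ueps_ge0 : forall eps, 0 < eps -> forall z, cOmega z -> 0 <= ueps eps z.

Let v eps := powR_eps eps p (ueps eps).

Let v_initial eps x : 0 < eps -> v eps (x, 0) = (u0 x + eps) `^ p.
Proof. by move=> e0; have [_ _ _ _ E] := sol e0; rewrite /v /powR_eps E. Qed.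

Lemma viscous_lipschitz eps x y t : 0 < eps -> 0 <= t ->
  v eps (x, t) - v eps (y, t) <= M * enorm (x - y).
Proof.
move=> e0 t0; apply: (powR_eps_lipschitz e0 p0 p1 (sol e0) (ueps_ge0 e0) u0b f_ge0 f_decr N1 M0
  cond _ _ _ t0) => {}x {}y.
by rewrite -!/(v _ _) !v_initial// initial_lipschitz// ltW.
Qed.

(** For negative [p] an upper bound on v, uniform in [eps], is a lower bound on u + eps. It keeps
    the limit positive, as the meaning of its negative power requires. *)
Lemma viscous_lower_bound x t : p < 0 -> 0 <= t -> exists2 m, 0 < m &
  forall eps, 0 < eps -> m <= ueps eps (x, t) + eps.
Proof.
move=> pn t0; have [/(_ pn) u0pos _] := Hgrad.
have [x0 _ x00] := ae_row_nbhs (@filterT _ (nbhs (0 : 'rV[R]_N)) _) u0pos.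
(* Independent of [eps]: (u0 x0 + eps)^p is at most u0(x0)^p, and the Lipschitz growth M |y - x0| is
   at most M (1 + |y|^2 + |x0|). The last 1 gives strictness and A >= 1. *)
pose A := u0 x0 `^ p + M * (1 + enorm x0) + 1.
have A1 : 1 <= A by rewrite lerDr addr_ge0 ?powR_ge0// mulr_ge0 ?addr_ge0 ?enorm_ge0// ltW.
pose C := A * expR ((2 * N%:R + 4 * `|(1 - p - gamma) / p| + 1) * t) * (1 + dotv x x).
have C0 : 0 < C.
  apply: mulr_gt0; last by rewrite ltr_wpDr ?dotv_ge0.
  by apply: mulr_gt0; [exact: lt_le_trans A1|exact: expR_gt0].
exists (C `^ p^-1) => [|eps e0]; first by rewrite powR_gt0.
have w0 : 0 < ueps eps (x, t) + eps by rewrite ltr_wpDl// ueps_ge0.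
have -> : ueps eps (x, t) + eps = v eps (x, t) `^ p^-1.
  by rewrite /v /powR_eps -powRrM mulfV// powRr1// ltW.
apply: le0_ler_powR; [by rewrite invr_le0 ltW|by rewrite /v /powR_eps powR_gt0|].
apply: (powR_eps_barrier e0 p0 (sol e0) (ueps_ge0 e0) u0b f_ge0 pn A1 _ x t0) => y.
rewrite -/(v _ _) v_initial//.
have := initial_lipschitz cu0 u0_ge0 p1 p0 (ltW M0) Hgrad e0 y x0.
have : (u0 x0 + eps) `^ p <= u0 x0 `^ p by rewrite le0_ler_powR ?ltW// ltrDl.
have : M * enorm (y - x0) <= M * (1 + dotv y y + enorm x0).
  rewrite ler_wpM2l ?(ltW M0)// (le_trans (enormD _ _))// enormN lerD2r.
  by rewrite -enorm_sqr; have := sqr_ge0 (enorm y - 1); nra.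
have d0 := dotv_ge0 y; have := mulr_ge0 d0 (powR_ge0 (u0 x0) p).
have := mulr_ge0 d0 (mulr_ge0 (ltW M0) (enorm_ge0 x0)); move: d0; rewrite /A.
move: (dotv y y) (enorm x0) (M * enorm (y - x0)) (u0 x0 `^ p) => d e E b.
by move: (_ `^ p) (_ `^ p) => a c; lra.
Qed.

Lemma viscosity_limit_grad_pow_le (U : 'rV[R]_N -> R) t : 0 < t -> measurable_fun setT U ->
  {ae row_lebesgue N, forall x, ueps eps (x, t) @[eps --> 0^'+] --> U x} ->
  grad_pow_le U p M.
Proof.
move=> t0 mU cvU.
have cvD : {ae row_lebesgue N, forall x, ueps eps (x, t) + eps @[eps --> 0^'+] --> U x}.
  apply: filterS cvU => x cx; rewrite -[X in _ --> X]addr0; apply: cvgD => //.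
  by apply: cvg_at_right_filter; exact: cvg_id.
have U_ge0 : {ae row_lebesgue N, forall x, 0 <= U x}.
  apply: filterS cvU => x cx; apply: (cvgr_to_ge cx).
  by near=> eps; apply: ueps_ge0; [near: eps; exact: nbhs_right_gt|exact: ltW].
have U_gt0 : p < 0 -> {ae row_lebesgue N, forall x, 0 < U x}.
  move=> pn; apply: filterS cvD => x cx.
  have [m m0 mle] := viscous_lower_bound x pn (ltW t0).
  apply: (lt_le_trans m0); apply: (cvgr_to_ge cx).
  by near=> eps; apply: mle; near: eps; exact: nbhs_right_gt.
split=> //.
(* Mazur's argument runs along a sequence, so one tending to 0 is fixed. *)
pose e (k : nat) : R := k.+1%:R^-1.
have e0 k : 0 < e k by rewrite invr_gt0.
have e_cvg : e k @[k --> \oo] --> 0^'+.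
  move=> A A0; have : \forall k \near \oo, 0 < e k -> A (e k) by exact: (@cvg_harmonic R _ A0).
  by apply: filterS => k; exact.
have t00 : Omega (0, t) by [].
pose d k i (x : 'rV[R]_N) := dx i (v (e k)) (x, t).
have C21 k : C21_Omega (v (e k)).
  exact: (C21_Omega_powR_eps p (e0 k) (sol (e0 k)) (ueps_ge0 (e0 k))).
apply: (@weak_grad_of_lipschitz_limit R N (fun k x => v (e k) (x, t)) d).
- move=> k i x; apply/is_derive_line0.
  have := @C21_Omega_dx R N _ x t i 1 0 (C21 k) t0; rewrite mul0r scale0r addr0 mul1r.
  by under eq_fun do rewrite mulr1.
- move=> k i x; have [_ _ /(_ i)[_ cdx] _] := C21 k (x, t) t0.
  apply: (@continuous_comp _ _ _ (fun x : 'rV[R]_N => (x, t)) (dx i (v (e k)))) => //.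
  by apply: continuous_pair_at; [exact: id|exact: cst_continuous].
- exact: ltW.
- by move=> k x y; apply: viscous_lipschitz => //; exact: ltW.
- exact: (measurableT_comp (measurable_powR p) mU).
have pos : {ae row_lebesgue N, forall x, 0 <= U x /\ (p <= 0 -> 0 < U x)}.
  have [pn|pp] := ltP p 0.
    by apply: filterS2 U_ge0 (U_gt0 pn) => x a b; split.
  by apply: filterS U_ge0 => x a; split=> //; rewrite le_eqVlt (negbTE p0) ltNge pp.
apply: filterS2 pos cvD => x [Ux0 Uxp] cx.
apply: (@powR_cvg _ _ \oo%classic _ (fun k => ueps (e k) (x, t) + e k)) => //.
- exact: ltW.
- by apply: nearW => k; rewrite addr_ge0 ?ueps_ge0 ?(ltW (e0 k))//; exact: ltW.
- exact: (cvg_comp _ (fun eps => ueps eps (x, t) + eps) e_cvg cx).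
Unshelve. all: by end_near. Qed.

End vanishing_viscosity.

Theorem theorem1p1 (R : realType) (N : nat) (gamma alpha M : R)
    (f : R -> R -> R) (u0 : 'rV[R]_N -> R) (u : 'rV[R]_N * R -> R) :
  (1 <= N)%N ->
  0 <= gamma ->
  Num.sqrt (2 * N%:R) - 1 <= gamma ->
  alpha ^+ 2 + (gamma + 1) * alpha + N%:R / 2 <= 0 ->
  C1_on [set tv : R * R | 0 < tv.1] (fun tv : R * R => f tv.1 tv.2) ->
  (forall t v, 0 < t -> 0 <= f t v) ->
  (forall t v, 0 < t -> derive1 (f t) v <= 0) ->
  continuous u0 ->
  (exists K, forall x, `|u0 x| <= K) ->
  (forall x, 0 <= u0 x) ->
  0 < M ->
  grad_pow_le u0 (1 + alpha / 2) M ->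
  viscosity_solution gamma f u0 u ->
  grad_pow_le (fun x => u (x, 0)) (1 + alpha / 2) M /\
  {ae @lebesgue_measure R, forall t, 0 < t ->
    grad_pow_le (fun x => u (x, t)) (1 + alpha / 2) M}.
Proof.
move=> N1 gamma0 _ Halpha C1f f_ge0 f'_le0 cu0 u0b u0_ge0 M0 Hgrad.
move=> [[G [[mu_ _] _ _ _]] u_init [ueps [sol cv]]].
split; first by under eq_fun do rewrite u_init.
have NR : 1 <= N%:R :> R by rewrite ler1n.
(* For nonnegative alpha the left side of [Halpha] would be at least N/2 > 0. *)
have alpha0 : alpha < 0.
  rewrite ltNge; apply/negP => a0; have := mulr_ge0 gamma0 a0; have := sqr_ge0 alpha; nra.
set p := 1 + alpha / 2.
(* alpha = -2 is treated apart, as q = 1/p is then meaningless; the power is the constant 1. *)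
have [p0|p0] := eqVneq p 0.
  by apply: nearW => t t0; rewrite p0; exact/grad_pow_le0/ltW.
have p1 : p < 1 by rewrite /p gtrDl; lra.
have cond : N%:R - 1 + 4 * (p - 1) ^+ 2 + 4 * gamma * (p - 1) <= 0.
  have pE : p - 1 = alpha / 2 by rewrite /p; lra.
  (* Twice the left-hand side of Halpha, minus (alpha + 1)^2. *)
  by rewrite pE; have := sqr_ge0 (alpha + 1); nra.
have f_decr := partially_decreasing C1f f'_le0.
(* Convergence almost everywhere in space-time gives, on almost every time slice, convergence almost
   everywhere in space; the estimate is then proved slice by slice. *)
apply: filterS (ae_ysection cv) => t cvt t0.
apply: (viscosity_limit_grad_pow_le N1 p0 p1 M0 cond f_ge0 f_decr cu0 u0b u0_ge0 Hgrad
  (fun eps e0 => (sol eps e0).1) (fun eps e0 => (sol eps e0).2) t0).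
- apply: (@measurable_comp _ _ _ _ _ _ Omega u setT (fun x => (x, t))) => //.
  + rewrite (_ : Omega = setT `*` [set` `]0, +oo[%R]).
      by apply: measurableX => //; exact: measurable_itv.
    by apply/seteqP; split=> z; rewrite /Omega /= in_itv/= andbT// => -[].
  + by move=> _ [x _ <-].
- by apply: filterS cvt => x; apply.
Qed.
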